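(* Let $p$ and $q$ be positive integers with $p<q$. Then $$\zeta''\left(1,\tfrac{p}{q}\right)-\zeta''\left(1,1-\tfrac{p}{q}\right)=2\pi\sum_{j=1}^{q}\sin\left(\frac{2\pi jp}{q}\right)\zeta''\left(0,\tfrac{j}{q}\right)-4\pi\left[\gamma+\log(2\pi q)\right]\sum_{j=1}^{q}\sin\left(\frac{2\pi jp}{q}\right)\log\Gamma\left(\tfrac{j}{q}\right)+\frac{\pi}{2}\left(2\left[\gamma+\log(2\pi q)\right]^2+\frac{\pi^2}{6}\right)\cot\left(\frac{\pi p}{q}\right).$$
   Context: For real $u>0$, $\zeta(s,u)$ is the Hurwitz zeta function (the meromorphic continuation in $s$ of $\sum_{n\ge 0}(n+u)^{-s}$), and $\zeta''(s,u)=\frac{\partial^2}{\partial s^2}\zeta(s,u)$. The difference $\zeta''(1,x)-\zeta''(1,y)$ means $\lim_{s\to1}[\zeta''(s,x)-\zeta''(s,y)]$ (the poles at $s=1$ cancel). $\gamma$ is Euler's constant, $\Gamma$ the gamma function and $\log$ the natural logarithm. *)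

(* Defs.v *)
From Stdlib Require Import Reals.
From Coquelicot Require Import Coquelicot.

Open Scope R_scope.

(* x ^ s := exp (s log x) for a real base x > 0 and a complex exponent s. *)
Definition cpow_pos (x : R) (s : C) : C :=
  (exp (Re s * ln x) * cos (Im s * ln x),
   exp (Re s * ln x) * sin (Im s * ln x)).

Definition analytic_at (f : C -> C) (z : C) : Prop :=
  exists a : nat -> C, locally z (fun w : C => is_pseries a (w - z)%C (f w)).

(* The value of f at z itself is irrelevant, as befits a possible pole. *)
Definition meromorphic_at (f : C -> C) (z : C) : Prop :=
  exists (k : nat) (a : nat -> C),
    locally' z (fun w : C => is_pseries a (w - z)%C ((w - z) ^ k * f w)%C).

(* f is s |-> zeta(s,u): the series on the half-plane Re s > 1, continued
   analytically to C \ {1} and meromorphically to C.  These conditions determine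
   f on C \ {1}; its value at s = 1 is arbitrary. *)
Definition is_hurwitz_zeta (u : R) (f : C -> C) : Prop :=
  (forall s : C, 1 < Re s ->
     is_series (fun n : nat => cpow_pos (INR n + u) (- s)%C) (f s)) /\
  (forall s : C, s <> RtoC 1 -> analytic_at f s) /\
  meromorphic_at f (RtoC 1).

(* [C_derive] takes the limit of the difference quotient along the real
   direction, which is the complex derivative wherever f is analytic. *)
Definition C_derive2 (f : C -> C) (s : C) : C := C_derive (C_derive f) s.

(* At n = 0 the term is 0 - ln 0, a harmless junk value. *)
Definition euler_gamma : R :=
  real (Lim_seq (fun n : nat => sum_n_m (fun k : nat => / INR k) 1 n - ln (INR n))).

(* Euler's integral, convergent for x > 0. *)
Definition Gamma (x : R) : R :=
  RInt_gen (fun t : R => Rpower t (x - 1) * exp (- t))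
           (at_right 0) (Rbar_locally p_infty).

Definition cot (x : R) : R := cos x / sin x.

(* Main.v *)
Require Import Defs.
From Stdlib Require Import Reals Lra Lia Psatz Rtrigo_facts.
From Coquelicot Require Import Coquelicot.
Open Scope R_scope.

(* Put a = p/q, c_j = sin (2 pi j p / q) and E_u(s) = zeta(s,u) - zeta(s,1-u).
   Since the c_j are antisymmetric under j -> q - j, both sides of the theorem
   only involve the functions E_u.  On the real axis E_u(s), s > 0, is the sum of
   (n+u)^-s - (n+1-u)^-s; this series is real analytic on s > 0, so it agrees with
   the difference of the zeta functions on (0,1) by the identity theorem, the
   pole at 1 cancelling.

   The kernel K(t) = sin x / (2 (cosh t - cos x)), x = 2 pi a, has two expansions:
   the sum of sin (m x) exp (-m t), and a partial fraction expansion in t.  Taking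
   the Mellin transform of both gives, for 0 < s < 1,
     I(s) (2 pi)^(s-1) E_a(1-s) = Gamma(s) q^-s / 2 * sum_j c_j E_{j/q}(s),
   where I(s) is the Mellin transform of 1 / (1 + t^2).  Comparing the second
   order Taylor coefficients at s = 0+ gives the theorem: E_u(s) = (1 - 2u) +
   (log Gamma(u) - log Gamma(1-u)) s + ..., log Gamma(1+s) = - gamma s +
   zeta(2)/2 s^2 + ..., s I(s) = 1 + zeta(2)/4 s^2 + ..., and zeta(2) = pi^2/6 comes
   from the partial fractions at t = 0. *)

(** * Complex power series *)

(** The hypotheses on [zeta] give the series on [Re s > 1] and a continuation, but no functional
    equation, no value at 0 and no order for the pole at 1. Hence the detour through differences on
    the real axis: there a one-sided expansion already determines all coefficients of a power
    series, and boundedness of the real series near 1 is what proves that the poles cancel. The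
    shape of the formula comes from [s I(s) E_a(1-s) = pi exp(log Gamma(1+s) - s log(2 pi q)) sum_j
    c_j E_{j/q}(s)]. With [L = gamma + log(2 pi q)] the exponential is
    [1 - L s + (L^2/2 + zeta(2)/2) s^2 + ...]. The constant terms give [E_a(1) = pi cot(pi p/q)];
    the term [zeta(2)/4] of [s I(s)] multiplies this value, and moving it to the right leaves
    [L^2/2 + zeta(2)/4] in front of the cotangent. The partial fractions of the kernel come from
    iterating its duplication formula, in the manner of Herglotz, so no contour integral is
    involved; and [I(s)] is only expanded at 0, so the reflection formula is avoided. *)

Lemma Re_le_Cmod (z : C) : Rabs (Re z) <= Cmod z.
Proof. apply Rle_trans with (2 := Rmax_Cmod z). apply Rmax_l. Qed.

Lemma Im_le_Cmod (z : C) : Rabs (Im z) <= Cmod z.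
Proof. apply Rle_trans with (2 := Rmax_Cmod z). apply Rmax_r. Qed.

Lemma Cmod_le_Re_Im (z : C) : Cmod z <= Rabs (Re z) + Rabs (Im z).
Proof.
  replace z with (RtoC (Re z) + Ci * RtoC (Im z))%C at 1.
  - eapply Rle_trans; [apply Cmod_triangle|].
    rewrite Cmod_mult, !Cmod_R.
    replace (Cmod Ci) with 1; [lra|].
    unfold Cmod, Ci; simpl. rewrite <- sqrt_1 at 1. f_equal; ring.
  - destruct z as [x y]. unfold Re, Im, Ci, Cplus, Cmult, RtoC; simpl. f_equal; ring.
Qed.

(** * Complex series through real and imaginary parts *)

(** Componentwise, so that the lemmas on real [Series] apply; the value is total and convergence
    enters as a separate hypothesis. *)
Definition CSeries (u : nat -> C) : C :=
  (Series (fun k => Re (u k)), Series (fun k => Im (u k))).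

Definition summable (u : nat -> C) := ex_series (fun k => Cmod (u k)).

Lemma summable_Re (u : nat -> C) : summable u -> ex_series (fun k => Re (u k)).
Proof.
  intros H. apply (ex_series_le (V := R_CompleteNormedModule)) with (2 := H).
  intros n. apply Re_le_Cmod.
Qed.

Lemma summable_Im (u : nat -> C) : summable u -> ex_series (fun k => Im (u k)).
Proof.
  intros H. apply (ex_series_le (V := R_CompleteNormedModule)) with (2 := H).
  intros n. apply Im_le_Cmod.
Qed.

Lemma summable_le (u : nat -> C) (b : nat -> R) :
  (forall k, Cmod (u k) <= b k) -> ex_series b -> summable u.
Proof.
  intros H Hb. apply (ex_series_le (V := R_CompleteNormedModule)) with (2 := Hb).
  intros n. change (Rabs (Cmod (u n)) <= b n).
  rewrite Rabs_pos_eq; [apply H | apply Cmod_ge_0].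
Qed.

Lemma Series_abs_le (a b : nat -> R) :
  (forall k, Rabs (a k) <= b k) -> ex_series b -> Rabs (Series a) <= Series b.
Proof.
  intros H Hb.
  assert (Ha : ex_series (fun k => Rabs (a k))).
  { apply (ex_series_le (V := R_CompleteNormedModule)) with (2 := Hb).
    intros n. change (Rabs (Rabs (a n)) <= b n). now rewrite Rabs_Rabsolu. }
  eapply Rle_trans; [now apply Series_Rabs|].
  apply Series_le; [|easy]. intros n; split; [apply Rabs_pos | apply H].
Qed.

(** The two components are bounded separately, hence the factor 2. *)
Lemma CSeries_le (u : nat -> C) (b : nat -> R) :
  (forall k, Cmod (u k) <= b k) -> ex_series b -> Cmod (CSeries u) <= 2 * Series b.
Proof.
  intros H Hb. eapply Rle_trans; [apply Cmod_le_Re_Im|].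
  assert (Rabs (Re (CSeries u)) <= Series b).
  { apply Series_abs_le; [|easy]. intros k. eapply Rle_trans; [apply Re_le_Cmod|apply H]. }
  assert (Rabs (Im (CSeries u)) <= Series b).
  { apply Series_abs_le; [|easy]. intros k. eapply Rle_trans; [apply Im_le_Cmod|apply H]. }
  lra.
Qed.

Lemma CSeries_ext (u v : nat -> C) : (forall k, u k = v k) -> CSeries u = CSeries v.
Proof. intros H. unfold CSeries. f_equal; apply Series_ext; intros k; now rewrite H. Qed.

Lemma CSeries_minus (u v : nat -> C) : summable u -> summable v ->
  CSeries (fun k => u k - v k)%C = (CSeries u - CSeries v)%C.
Proof.
  intros Hu Hv. unfold CSeries, Cminus, Cplus, Copp. simpl. f_equal.
  - rewrite <- Rminus_def, <- Series_minus by now apply summable_Re. now apply Series_ext.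
  - rewrite <- Rminus_def, <- Series_minus by now apply summable_Im. now apply Series_ext.
Qed.

Lemma CSeries_scal (c : C) (u : nat -> C) : summable u ->
  CSeries (fun k => c * u k)%C = (c * CSeries u)%C.
Proof.
  intros Hu. unfold CSeries, Cmult. simpl. f_equal.
  - rewrite <- !Series_scal_l, <- Series_minus.
    + now apply Series_ext.
    + apply (ex_series_scal_l (V := R_NormedModule)). now apply summable_Re.
    + apply (ex_series_scal_l (V := R_NormedModule)). now apply summable_Im.
  - rewrite <- !Series_scal_l, <- Series_plus.
    + now apply Series_ext.
    + apply (ex_series_scal_l (V := R_NormedModule)). now apply summable_Im.
    + apply (ex_series_scal_l (V := R_NormedModule)). now apply summable_Re.
Qed.

Lemma summable_scal (c : C) (u : nat -> C) : summable u -> summable (fun k => c * u k)%C.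
Proof.
  intros H. apply summable_le with (fun k => Cmod c * Cmod (u k)).
  - intros k. rewrite Cmod_mult. lra.
  - now apply (ex_series_scal_l (V := R_NormedModule)).
Qed.

Lemma CSeries_incr_1 (u : nat -> C) : summable u ->
  CSeries u = (u 0%nat + CSeries (fun k => u (S k)))%C.
Proof.
  intros H. unfold CSeries, Cplus; simpl.
  rewrite (Series_incr_1 (fun k => Re (u k))) by now apply summable_Re.
  rewrite (Series_incr_1 (fun k => Im (u k))) by now apply summable_Im.
  reflexivity.
Qed.

Lemma Re_sum_n (u : nat -> C) (n : nat) : Re (sum_n u n) = sum_n (fun k => Re (u k)) n.
Proof.
  induction n as [|n IH]; [now rewrite !sum_O|].
  rewrite !sum_Sn, <- IH. reflexivity.
Qed.

Lemma Im_sum_n (u : nat -> C) (n : nat) : Im (sum_n u n) = sum_n (fun k => Im (u k)) n.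
Proof.
  induction n as [|n IH]; [now rewrite !sum_O|].
  rewrite !sum_Sn, <- IH. reflexivity.
Qed.

Lemma filterlim_Re (l : C) : filterlim Re (locally l) (locally (Re l)).
Proof. intros P [e He]; exists e; intros y [h1 h2]; apply He; exact h1. Qed.

Lemma filterlim_Im (l : C) : filterlim Im (locally l) (locally (Im l)).
Proof. intros P [e He]; exists e; intros y [h1 h2]; apply He; exact h2. Qed.

Lemma is_series_Re_Im (u : nat -> C) (l : C) :
  @is_series C_AbsRing C_NormedModule u l ->
  is_series (fun k => Re (u k)) (Re l) /\ is_series (fun k => Im (u k)) (Im l).
Proof.
  intros H. split; unfold is_series in *.
  - apply filterlim_ext with (fun n => Re (sum_n u n)); [apply Re_sum_n|].
    exact (filterlim_comp _ _ _ _ _ _ _ _ H (filterlim_Re l)).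
  - apply filterlim_ext with (fun n => Im (sum_n u n)); [apply Im_sum_n|].
    exact (filterlim_comp _ _ _ _ _ _ _ _ H (filterlim_Im l)).
Qed.

Lemma CSeries_unique (u : nat -> C) (l : C) :
  @is_series C_AbsRing C_NormedModule u l -> CSeries u = l.
Proof.
  intros H. apply is_series_Re_Im in H. destruct H as [H1 H2].
  unfold CSeries. rewrite (is_series_unique _ _ H1), (is_series_unique _ _ H2).
  now destruct l.
Qed.

(** * Power series with geometrically bounded coefficients *)

Definition CPSeries (a : nat -> C) (w : C) : C := CSeries (fun k => a k * w ^ k)%C.

Lemma is_pseries_is_series_C (a : nat -> C) (w l : C) :
  is_pseries a w l -> @is_series C_AbsRing C_NormedModule (fun k => a k * w ^ k)%C l.
Proof.
  intros H. unfold is_pseries in H.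
  apply is_series_ext with (2 := H).
  intros n. change (pow_n w n * a n = a n * w ^ n)%C.
  apply Cmult_comm.
Qed.

Lemma is_pseries_CPSeries (a : nat -> C) (w l : C) : is_pseries a w l -> CPSeries a w = l.
Proof. intros H. apply CSeries_unique. now apply is_pseries_is_series_C. Qed.

(** Stands in for a lower bound on the radius of convergence: it gives absolute convergence in the
    open disc of radius [r] and survives shifts, differences and, at the price of a smaller radius,
    derivation. *)
Definition geo_bounded (a : nat -> C) (r : R) : Prop :=
  exists M, forall k, Cmod (a k) * r ^ k <= M.

Lemma ex_series_bounded (u : nat -> R) : ex_series u -> exists M, forall k, Rabs (u k) <= M.
Proof.
  intros H. apply ex_series_lim_0 in H.
  destruct (filterlim_bounded u (ex_intro _ 0 H)) as [M HM].
  now exists M.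
Qed.

Lemma Cmod_pow (w : C) (k : nat) : Cmod (w ^ k)%C = Cmod w ^ k.
Proof. induction k as [|k IH]; simpl; [apply Cmod_1|]. now rewrite Cmod_mult, IH. Qed.

(** The terms of a convergent series are bounded; no absolute convergence is required at [w]
    itself. *)
Lemma is_pseries_geo_bounded (a : nat -> C) (w l : C) :
  is_pseries a w l -> geo_bounded a (Cmod w).
Proof.
  intros H. apply is_pseries_is_series_C, is_series_Re_Im in H.
  destruct H as [H1 H2].
  destruct (ex_series_bounded _ (ex_intro _ _ H1)) as [M1 HM1].
  destruct (ex_series_bounded _ (ex_intro _ _ H2)) as [M2 HM2].
  exists (M1 + M2). intros k. rewrite <- Cmod_pow, <- Cmod_mult.
  eapply Rle_trans; [apply Cmod_le_Re_Im|]. now apply Rplus_le_compat.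
Qed.

(** Abel's comparison with the geometric series of ratio [R / r]. *)
Lemma geo_bounded_series (a : nat -> C) (r R : R) :
  geo_bounded a r -> 0 <= R < r -> ex_series (fun k => Cmod (a k) * R ^ k).
Proof.
  intros [M HM] HR.
  apply (ex_series_le (V := R_CompleteNormedModule)) with (fun k => M * (R / r) ^ k).
  - intros k. change (Rabs (Cmod (a k) * R ^ k) <= M * (R / r) ^ k).
    assert (Hr : 0 < r ^ k) by (apply pow_lt; lra).
    assert (HRk : 0 <= R ^ k) by (apply pow_le; lra).
    rewrite Rabs_pos_eq by (apply Rmult_le_pos; [apply Cmod_ge_0 | easy]).
    unfold Rdiv. rewrite Rpow_mult_distr, pow_inv.
    replace (Cmod (a k) * R ^ k) with ((Cmod (a k) * r ^ k) * (R ^ k * / r ^ k)) by (field; lra).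
    apply Rmult_le_compat_r; [|apply HM].
    apply Rmult_le_pos; [easy|]. now apply Rlt_le, Rinv_0_lt_compat.
  - apply (ex_series_scal_l (V := R_NormedModule)). apply ex_series_geom.
    rewrite Rabs_pos_eq.
    + apply Rmult_lt_reg_r with r; [lra|]. unfold Rdiv. rewrite Rmult_assoc, Rinv_l; lra.
    + apply Rdiv_le_0_compat; lra.
Qed.

Lemma geo_bounded_summable (a : nat -> C) (r : R) (w : C) :
  geo_bounded a r -> Cmod w < r -> summable (fun k => a k * w ^ k)%C.
Proof.
  intros H Hw. apply summable_le with (fun k => Cmod (a k) * Cmod w ^ k).
  - intros k. rewrite Cmod_mult, Cmod_pow. lra.
  - apply geo_bounded_series with (1 := H). split; [apply Cmod_ge_0 | easy].
Qed.

(** With [r = R (1 + d)], the factor [k + 1] is absorbed by [(1 + d) ^ k] through Bernoulli's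
    inequality, which is [poly]. *)
Lemma geo_bounded_Smul (a : nat -> C) (r R : R) :
  geo_bounded a r -> 0 < R < r -> geo_bounded (fun k => RtoC (INR (S k)) * a k)%C R.
Proof.
  intros [M HM] HR.
  set (d := r / R - 1).
  assert (Hd : 0 < d).
  { unfold d. enough (1 < r / R) by lra. apply Rmult_lt_reg_r with R; [lra|].
    unfold Rdiv. rewrite Rmult_assoc, Rinv_l; lra. }
  exists ((1 + / d) * M). intros k.
  rewrite Cmod_mult, Cmod_R, Rabs_pos_eq by apply pos_INR.
  assert (Hk : INR (S k) <= (1 + / d) * (1 + d) ^ k).
  { assert (HB := poly k d Hd). rewrite S_INR.
    assert (1 <= (1 + d) ^ k) by (apply pow_R1_Rle; lra).
    assert (INR k <= / d * (1 + d) ^ k).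
    { apply Rmult_le_reg_l with d; [easy|]. rewrite <- Rmult_assoc, Rinv_r by lra. lra. }
    lra. }
  replace r with (R * (1 + d)) in HM by (unfold d; field; lra).
  specialize (HM k). rewrite Rpow_mult_distr in HM.
  assert (0 <= Cmod (a k) * R ^ k).
  { apply Rmult_le_pos; [apply Cmod_ge_0 | apply pow_le; lra]. }
  assert (0 < / d) by now apply Rinv_0_lt_compat.
  apply Rle_trans with ((1 + / d) * (1 + d) ^ k * (Cmod (a k) * R ^ k)).
  - replace (INR (S k) * Cmod (a k) * R ^ k) with (INR (S k) * (Cmod (a k) * R ^ k)) by ring.
    now apply Rmult_le_compat_r.
  - replace ((1 + / d) * (1 + d) ^ k * (Cmod (a k) * R ^ k))
      with ((1 + / d) * (Cmod (a k) * (R ^ k * (1 + d) ^ k))) by ring.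
    apply Rmult_le_compat_l; [lra | easy].
Qed.

Lemma geo_bounded_incr (a : nat -> C) (r : R) :
  0 < r -> geo_bounded a r -> geo_bounded (fun k => a (S k)) r.
Proof.
  intros Hr [M HM]. exists (M / r). intros k. specialize (HM (S k)). simpl in HM.
  apply Rmult_le_reg_r with r; [easy|]. unfold Rdiv. rewrite (Rmult_assoc M), Rinv_l by lra. lra.
Qed.

Definition CPS_derive (a : nat -> C) (k : nat) : C := (RtoC (INR (S k)) * a (S k))%C.

Lemma geo_bounded_derive (a : nat -> C) (r R : R) :
  geo_bounded a r -> 0 < R < r -> geo_bounded (CPS_derive a) R.
Proof.
  intros H HR. apply (geo_bounded_Smul (fun k => a (S k)) r); [|easy].
  apply geo_bounded_incr; [lra | easy].
Qed.

(** Induction on [k]: the next remainder is [w + h] times the present one plus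
    [(k + 1) h ^ 2 w ^ k]. The factor [R] on the left replaces an exponent [k - 1] on the right,
    which would be awkward at [k = 0]. *)
Lemma Cpow_Taylor_remainder (w h : C) (R : R) (k : nat) :
  0 < R -> Cmod w <= R -> Cmod (w + h)%C <= R ->
  R * Cmod ((w + h) ^ S k - w ^ S k - RtoC (INR (S k)) * (h * w ^ k))%C
    <= INR (S k) * INR (S k) * (Cmod h ^ 2 * R ^ k).
Proof.
  intros HR Hw Hwh. induction k as [|k IH].
  - replace ((w + h) ^ 1 - w ^ 1 - RtoC (INR 1) * (h * w ^ 0))%C with (RtoC 0)
      by (simpl; ring).
    rewrite Cmod_0. simpl.
    assert (0 <= Cmod h * (Cmod h * 1)) by (apply Rmult_le_pos; [|rewrite Rmult_1_r]; apply Cmod_ge_0).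
    lra.
  - set (e := ((w + h) ^ S k - w ^ S k - RtoC (INR (S k)) * (h * w ^ k))%C) in *.
    replace ((w + h) ^ S (S k) - w ^ S (S k) - RtoC (INR (S (S k))) * (h * w ^ S k))%C
      with ((w + h) * e + RtoC (INR (S k)) * (h * (h * w ^ k)))%C.
    2:{ unfold e. rewrite (S_INR (S k)), RtoC_plus. simpl Cpow. ring. }
    eapply Rle_trans; [apply Rmult_le_compat_l; [lra|apply Cmod_triangle]|].
    rewrite !Cmod_mult, Cmod_R, Cmod_pow, Rabs_pos_eq by apply pos_INR.
    assert (He := Cmod_ge_0 e). assert (Hw0 := Cmod_ge_0 w).
    assert (Hwk : Cmod w ^ k <= R ^ k) by (apply pow_incr; lra).
    set (n := INR (S k)) in *. assert (Hn : 0 <= n) by apply pos_INR.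
    rewrite (S_INR (S k)). fold n.
    assert (HE : R * (Cmod (w + h)%C * Cmod e) <= R * (n * n * (Cmod h ^ 2 * R ^ k))).
    { apply Rmult_le_compat_l; [lra|]. eapply Rle_trans; [|exact IH].
      apply Rmult_le_compat_r; easy. }
    assert (H2 : n * (Cmod h * (Cmod h * Cmod w ^ k)) <= n * (Cmod h ^ 2 * R ^ k)).
    { apply Rmult_le_compat_l; [easy|]. replace (Cmod h * (Cmod h * Cmod w ^ k)) with (Cmod h ^ 2 * Cmod w ^ k) by ring.
      apply Rmult_le_compat_l; [apply pow2_ge_0 | easy]. }
    assert (H3 := Rmult_le_compat_l R _ _ (Rlt_le _ _ HR) H2).
    assert (H4 : 0 <= Cmod h ^ 2 * R ^ k) by (apply Rmult_le_pos; [apply pow2_ge_0|apply pow_le; lra]).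
    simpl (R ^ S k).
    rewrite Rmult_plus_distr_l.
    apply Rle_trans with ((n * n + n) * R * (Cmod h ^ 2 * R ^ k)); [lra|].
    replace ((n + 1) * (n + 1) * (Cmod h ^ 2 * (R * R ^ k)))
      with ((n * n + 2 * n + 1) * R * (Cmod h ^ 2 * R ^ k)) by ring.
    apply Rmult_le_compat_r; [easy|]. apply Rmult_le_compat_r; lra.
Qed.

(** The quadratic remainders of the monomials are summed; the bound is uniform on the closed disc,
    so it serves at every centre [w] in it. *)
Lemma CPSeries_Taylor1 (a : nat -> C) (r R : R) :
  geo_bounded a r -> 0 < R < r ->
  exists M, forall w h, Cmod w <= R -> Cmod (w + h)%C <= R ->
    Cmod (CPSeries a (w + h) - CPSeries a w - h * CPSeries (CPS_derive a) w)%C <= M * Cmod h ^ 2.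
Proof.
  intros Ha HR.
  (* Each multiplication of the coefficients by [k + 1] costs some radius; two are needed, hence
     [R < r2 < r1 < r]. *)
  set (r1 := (R + r) / 2). set (r2 := (R + r1) / 2).
  assert (H1 : geo_bounded (CPS_derive a) r1) by (apply geo_bounded_derive with r; [easy | unfold r1; lra]).
  assert (H2 := geo_bounded_Smul _ _ r2 H1 ltac:(unfold r2, r1; lra)).
  assert (HS := geo_bounded_series _ _ R H2 ltac:(unfold r2, r1; lra)).
  exists (2 * (Series (fun k => Cmod (RtoC (INR (S k)) * CPS_derive a k)%C * R ^ k) / R)).
  intros w h Hw Hwh.
  assert (Sw : summable (fun k => a k * w ^ k)%C) by (apply geo_bounded_summable with r; [easy|lra]).
  assert (Swh : summable (fun k => a k * (w + h) ^ k)%C) by (apply geo_bounded_summable with r; [easy|lra]).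
  assert (Sd : summable (fun k => CPS_derive a k * w ^ k)%C).
  { apply geo_bounded_summable with r1; [easy|unfold r1; lra]. }
  set (u := fun k => (a (S k) * ((w + h) ^ S k - w ^ S k - RtoC (INR (S k)) * (h * w ^ k)))%C).
  assert (Hu : (CPSeries a (w + h) - CPSeries a w - h * CPSeries (CPS_derive a) w)%C = CSeries u).
  { unfold CPSeries. rewrite (CSeries_incr_1 _ Sw), (CSeries_incr_1 _ Swh).
    assert (Sw' : summable (fun k => a (S k) * w ^ S k)%C) by now apply -> (ex_series_incr_1 (V := R_NormedModule)) in Sw.
    assert (Swh' : summable (fun k => a (S k) * (w + h) ^ S k)%C) by now apply -> (ex_series_incr_1 (V := R_NormedModule)) in Swh.
    rewrite <- CSeries_scal by easy.
    match goal with |- (?a0 + ?A - (?b0 + ?B) - ?D)%C = _ =>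
      replace (a0 + A - (b0 + B) - D)%C with (A - B - D)%C by (simpl; ring) end.
    rewrite <- CSeries_minus by easy.
    rewrite <- CSeries_minus.
    - apply CSeries_ext. intros k. unfold u, CPS_derive. ring.
    - apply summable_le with (fun k => Cmod (a (S k) * (w + h) ^ S k)%C + Cmod (a (S k) * w ^ S k)%C).
      + intros k. unfold Cminus. eapply Rle_trans; [apply Cmod_triangle|]. rewrite Cmod_opp. lra.
      + now apply (ex_series_plus (V := R_NormedModule)).
    - now apply summable_scal. }
  rewrite Hu.
  apply Rle_trans with (2 * Series (fun k => (Cmod h ^ 2 / R) * (Cmod (RtoC (INR (S k)) * CPS_derive a k)%C * R ^ k))).
  - apply CSeries_le.
    + intros k. unfold u. rewrite Cmod_mult.
      assert (HT := Cpow_Taylor_remainder w h R k ltac:(lra) Hw Hwh).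
      unfold CPS_derive. rewrite !Cmod_mult, !Cmod_R, !Rabs_pos_eq by apply pos_INR.
      set (e := Cmod (_ - _ - _)%C) in *.
      replace (Cmod (a (S k)) * e) with (Cmod (a (S k)) * (R * e) / R) by (field; lra).
      replace (Cmod h ^ 2 / R * (INR (S k) * (INR (S k) * Cmod (a (S k))) * R ^ k))
       with (Cmod (a (S k)) * (INR (S k) * INR (S k) * (Cmod h ^ 2 * R ^ k)) / R) by (field; lra).
      apply Rmult_le_compat_r; [left; apply Rinv_0_lt_compat; lra|].
      apply Rmult_le_compat_l; [apply Cmod_ge_0 | easy].
    + now apply (ex_series_scal_l (V := R_NormedModule)).
  - rewrite Series_scal_l. right. field; lra.
Qed.

(** * Derivatives of power series *)

(** [C_derive] unfolds to limits of the two components along the real direction, so an estimate for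
    real increments [h] suffices: dividing by [h] leaves an error at most [M * |h|]. *)
Lemma C_derive_of_Taylor (f : C -> C) (z l : C) (d M : R) : 0 < d ->
  (forall h : R, Rabs h < d -> Cmod (f (z + RtoC h) - f z - RtoC h * l)%C <= M * h ^ 2) ->
  C_derive f z = l.
Proof.
  intros Hd H. unfold C_derive, C_lim.
  assert (HM : 0 <= M).
  { specialize (H (d / 2)). rewrite Rabs_pos_eq in H by lra.
    assert (0 <= M * (d/2)^2) by (eapply Rle_trans; [apply Cmod_ge_0|apply H; lra]).
    apply Rmult_le_reg_r with ((d/2)^2); [nra|lra]. }
  assert (HQ : forall x : R, Rabs (x - fst z) < d -> x <> fst z ->
     Cmod ((f (x, snd z) - f z) / ((x, snd z) - z) - l)%C <= M * Rabs (x - fst z)).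
  { intros x Hx Hx0. set (h := x - fst z) in *.
    assert (Hh : h <> 0) by (unfold h; lra).
    assert (E1 : (x, snd z) = (z + RtoC h)%C).
    { destruct z as [z1 z2]; unfold h, Cplus, RtoC; simpl. f_equal; ring. }
    rewrite E1. replace (z + RtoC h - z)%C with (RtoC h) by ring.
    replace ((f (z + RtoC h) - f z) / RtoC h - l)%C
      with ((f (z + RtoC h) - f z - RtoC h * l) / RtoC h)%C by (field; intros E; apply Hh; now injection E).
    rewrite Cmod_div by (intros E; apply Hh; now injection E).
    rewrite Cmod_R. apply Rmult_le_reg_r with (Rabs h); [now apply Rabs_pos_lt|].
    unfold Rdiv. rewrite Rmult_assoc, Rinv_l by now apply Rabs_no_R0.
    rewrite Rmult_1_r, Rmult_assoc.
    replace (Rabs h * Rabs h) with (h ^ 2). 2:{ rewrite <- Rabs_mult, Rabs_pos_eq; [ring|nra]. }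
    now apply H. }
  assert (HL : forall pr : C -> R, (forall w v, Rabs (pr w - pr v) <= Cmod (w - v)%C) ->
     Lim (fun x : R => pr ((f (x, snd z) - f z) / ((x, snd z) - z))%C) (fst z) = pr l).
  { intros pr Hpr. apply is_lim_unique. apply is_lim_spec. intros eps. simpl.
    assert (He : 0 < Rmin d (eps / (M + 1))).
    { apply Rmin_glb_lt; [easy|]. apply Rdiv_lt_0_compat; [apply cond_pos|lra]. }
    exists (mkposreal _ He). intros x Hx Hx0.
    assert (Hx' : Rabs (x - fst z) < Rmin d (eps / (M + 1))) by exact Hx.
    eapply Rle_lt_trans; [apply Hpr|].
    eapply Rle_lt_trans; [apply HQ; [|easy]|].
    - eapply Rlt_le_trans; [exact Hx'|apply Rmin_l].
    - assert (Rabs (x - fst z) < eps / (M + 1)) by (eapply Rlt_le_trans; [exact Hx'|apply Rmin_r]).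
      apply Rle_lt_trans with ((M + 1) * Rabs (x - fst z)).
      + apply Rmult_le_compat_r; [apply Rabs_pos|lra].
      + replace (pos eps) with ((M + 1) * (eps / (M + 1))) by (field; lra).
        apply Rmult_lt_compat_l; lra. }
  replace (Lim (fun x : R => fst ((f (x, snd z) - f z) / ((x, snd z) - z))%C) (fst z)) with (Finite (fst l)).
  replace (Lim (fun x : R => snd ((f (x, snd z) - f z) / ((x, snd z) - z))%C) (fst z)) with (Finite (snd l)).
  - now destruct l.
  - symmetry. apply (HL snd). intros w v. apply (Im_le_Cmod (w - v)%C).
  - symmetry. apply (HL fst). intros w v. apply (Re_le_Cmod (w - v)%C).
Qed.

(** Agreement with the series is asked only on a real segment around [w], and [w] need not be the
    centre; in this form the lemma can be applied again to [C_derive f]. *)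
Lemma C_derive_CPSeries (f : C -> C) (a : nat -> C) (z w : C) (r d : R) :
  geo_bounded a r -> Cmod (w - z)%C < r -> 0 < d ->
  (forall h : R, Rabs h < d -> f (w + RtoC h)%C = CPSeries a (w + RtoC h - z)%C) ->
  C_derive f w = CPSeries (CPS_derive a) (w - z)%C.
Proof.
  intros Ha Hw Hd Hf.
  set (R := (Cmod (w - z)%C + r) / 2).
  assert (H0 := Cmod_ge_0 (w - z)%C).
  destruct (CPSeries_Taylor1 a r R Ha ltac:(unfold R; lra)) as [M HM].
  apply C_derive_of_Taylor with (Rmin d (R - Cmod (w - z)%C)) M.
  - apply Rmin_glb_lt; [easy|unfold R; lra].
  - intros h Hh.
    rewrite (Hf h) by (eapply Rlt_le_trans; [exact Hh|apply Rmin_l]).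
    replace (f w) with (f (w + RtoC 0)%C) by (f_equal; ring).
    rewrite (Hf 0) by (rewrite Rabs_R0; easy).
    replace (w + RtoC 0 - z)%C with (w - z)%C by ring.
    replace (w + RtoC h - z)%C with (w - z + RtoC h)%C by ring.
    eapply Rle_trans; [apply HM|].
    + unfold R; lra.
    + eapply Rle_trans; [apply Cmod_triangle|]. rewrite Cmod_R.
      assert (Rabs h < R - Cmod (w - z)%C) by (eapply Rlt_le_trans; [exact Hh|apply Rmin_r]). lra.
    + rewrite Cmod_R. right. f_equal. apply pow2_abs.
Qed.

Lemma CPSeries_0 (a : nat -> C) (r : R) : 0 < r -> geo_bounded a r -> CPSeries a 0 = a 0%nat.
Proof.
  intros Hr H. unfold CPSeries. rewrite CSeries_incr_1.
  - assert (Hs : summable (fun k => a k * 0 ^ k)%C).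
    { apply geo_bounded_summable with r; [easy|]. now rewrite Cmod_0. }
    rewrite (CSeries_ext _ (fun k => 0 * (a k * 0 ^ k))%C) by (intros k; simpl; ring).
    rewrite CSeries_scal by easy. simpl. ring.
  - apply geo_bounded_summable with r; [easy|]. now rewrite Cmod_0.
Qed.

(** * Local expansions of analytic and meromorphic functions *)

(** The uniform structure on [C] is that of a product, with squares as balls; discs are exchanged
    for squares here and in the next lemma. *)
Lemma locally_Cmod (z : C) (P : C -> Prop) :
  locally z P -> exists d, 0 < d /\ forall w, Cmod (w - z)%C < d -> P w.
Proof.
  intros [e He]. exists e. split; [apply cond_pos|]. intros w Hw. apply He. split.
  - eapply Rle_lt_trans; [apply (Re_le_Cmod (w - z)%C)|exact Hw].
  - eapply Rle_lt_trans; [apply (Im_le_Cmod (w - z)%C)|exact Hw].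
Qed.

Lemma Cmod_locally (z : C) (d : R) : 0 < d -> locally z (fun w => Cmod (w - z)%C < d).
Proof.
  intros Hd. assert (Hd2 : 0 < d / 2) by lra.
  exists (mkposreal _ Hd2). intros w [H1 H2].
  eapply Rle_lt_trans; [apply Cmod_le_Re_Im|].
  assert (Rabs (Re (w - z)%C) < d / 2) by exact H1.
  assert (Rabs (Im (w - z)%C) < d / 2) by exact H2. lra.
Qed.

(** Convergence at the single point [z + d / 2] bounds the coefficients, which is why the radius is
    halved. *)
Lemma analytic_at_CPSeries (f : C -> C) (z : C) : analytic_at f z ->
  exists a r, 0 < r /\ geo_bounded a r /\
    forall w, Cmod (w - z)%C < r -> f w = CPSeries a (w - z)%C.
Proof.
  intros [a Ha]. apply locally_Cmod in Ha. destruct Ha as [d [Hd Ha]].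
  exists a, (d / 2). split; [lra|]. split.
  - replace (d / 2) with (Cmod (z + RtoC (d / 2) - z)%C).
    + apply is_pseries_geo_bounded with (f (z + RtoC (d/2))%C). apply Ha.
      replace (z + RtoC (d / 2) - z)%C with (RtoC (d / 2)) by ring.
      rewrite Cmod_R, Rabs_pos_eq; lra.
    + replace (z + RtoC (d / 2) - z)%C with (RtoC (d / 2)) by ring.
      rewrite Cmod_R, Rabs_pos_eq; lra.
  - intros w Hw. symmetry. apply is_pseries_CPSeries. apply Ha. lra.
Qed.

Lemma meromorphic_at_CPSeries (f : C -> C) (z : C) : meromorphic_at f z ->
  exists k a r, 0 < r /\ geo_bounded a r /\
    forall w, Cmod (w - z)%C < r -> w <> z -> ((w - z) ^ k * f w)%C = CPSeries a (w - z)%C.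
Proof.
  intros [k [a Ha]]. apply locally_Cmod in Ha. destruct Ha as [d [Hd Ha]].
  exists k, a, (d / 2). split; [lra|]. split.
  - replace (d / 2) with (Cmod (z + RtoC (d / 2) - z)%C).
    + eapply is_pseries_geo_bounded. apply Ha.
      * replace (z + RtoC (d / 2) - z)%C with (RtoC (d / 2)) by ring.
        rewrite Cmod_R, Rabs_pos_eq; lra.
      * intros E. assert (E' : (z + RtoC (d/2) - z = 0)%C) by (rewrite E; ring).
        replace (z + RtoC (d / 2) - z)%C with (RtoC (d / 2)) in E' by ring.
        injection E'. lra.
    + replace (z + RtoC (d / 2) - z)%C with (RtoC (d / 2)) by ring.
      rewrite Cmod_R, Rabs_pos_eq; lra.
  - intros w Hw Hz. symmetry. apply is_pseries_CPSeries. apply Ha; [lra|easy].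
Qed.

(** * Limits and series of real numbers *)

Lemma filterlim_R_spec {T : Type} (F : (T -> Prop) -> Prop) {FF : Filter F} (f : T -> R) (l : R) :
  filterlim f F (locally l) <-> forall eps : R, 0 < eps -> F (fun t => Rabs (f t - l) < eps).
Proof.
  split.
  - intros H eps He. apply (H (fun y => Rabs (y - l) < eps)). exists (mkposreal _ He). intros y Hy. exact Hy.
  - intros H P [e He]. specialize (H e (cond_pos e)).
    apply filter_imp with (2 := H). intros t Ht. apply He. exact Ht.
Qed.

Lemma filterlim_R_plus {T : Type} (F : (T -> Prop) -> Prop) {FF : Filter F} (f g : T -> R) (a b : R) :
  filterlim f F (locally a) -> filterlim g F (locally b) ->
  filterlim (fun t => f t + g t) F (locally (a + b)).
Proof.
  intros Hf Hg. apply (filterlim_comp_2 (G := locally a) (H := locally b) _ _ Rplus Hf Hg).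
  apply (filterlim_plus (K := R_AbsRing) (V := R_NormedModule)).
Qed.

Lemma filterlim_R_mult {T : Type} (F : (T -> Prop) -> Prop) {FF : Filter F} (f g : T -> R) (a b : R) :
  filterlim f F (locally a) -> filterlim g F (locally b) ->
  filterlim (fun t => f t * g t) F (locally (a * b)).
Proof.
  intros Hf Hg. apply (filterlim_comp_2 (G := locally a) (H := locally b) _ _ Rmult Hf Hg).
  apply (filterlim_mult (K := R_AbsRing)).
Qed.

Lemma filterlim_R_opp {T : Type} (F : (T -> Prop) -> Prop) {FF : Filter F} (f : T -> R) (a : R) :
  filterlim f F (locally a) -> filterlim (fun t => - f t) F (locally (- a)).
Proof.
  intros Hf. apply (filterlim_comp _ _ _ f Ropp _ (locally a)); [easy|].
  apply (filterlim_opp (K := R_AbsRing) (V := R_NormedModule)).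
Qed.

Lemma filterlim_R_minus {T : Type} (F : (T -> Prop) -> Prop) {FF : Filter F} (f g : T -> R) (a b : R) :
  filterlim f F (locally a) -> filterlim g F (locally b) ->
  filterlim (fun t => f t - g t) F (locally (a - b)).
Proof.
  intros Hf Hg. apply (filterlim_R_plus F); [easy|]. now apply (filterlim_R_opp F).
Qed.

Lemma filterlim_squeeze0 {T : Type} (F : (T -> Prop) -> Prop) {FF : Filter F} (f g : T -> R) (l : R) :
  F (fun t => Rabs (f t - l) <= g t) -> filterlim g F (locally 0) -> filterlim f F (locally l).
Proof.
  intros H Hg. apply filterlim_R_spec; [easy|]. intros eps He.
  assert (Hg' := proj1 (filterlim_R_spec F g 0) Hg eps He).
  apply filter_imp with (2 := filter_and _ _ H Hg'). intros t [H1 H2].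
  rewrite Rminus_0_r in H2. eapply Rle_lt_trans; [apply H1|].
  eapply Rle_lt_trans; [apply Rle_abs|easy].
Qed.

Lemma filterlim_sum_f_R0 {T : Type} (F : (T -> Prop) -> Prop) {FF : Filter F}
  (a : T -> nat -> R) (b : nat -> R) (N : nat) :
  (forall k, filterlim (fun t => a t k) F (locally (b k))) ->
  filterlim (fun t => sum_f_R0 (a t) N) F (locally (sum_f_R0 b N)).
Proof.
  intros H. induction N as [|N IH]; simpl; [apply H|]. now apply (filterlim_R_plus F).
Qed.

Lemma ex_series_Rle (a b : nat -> R) :
  (forall k, Rabs (a k) <= b k) -> ex_series b -> ex_series a.
Proof. intros H. now apply (ex_series_le (V := R_CompleteNormedModule)). Qed.

Lemma ex_series_Rscal (c : R) (a : nat -> R) :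
  ex_series a -> ex_series (fun k => c * a k).
Proof. apply (ex_series_scal_l (V := R_NormedModule)). Qed.

Lemma Series_tail_small (M : nat -> R) (eps : R) : ex_series M -> 0 < eps ->
  exists N, forall n, (N <= n)%nat -> Rabs (Series (fun k => M (S n + k)%nat)) < eps.
Proof.
  intros HM He. assert (H := Series_correct _ HM).
  apply is_series_Reals in H. destruct (H eps He) as [N HN].
  exists N. intros n Hn. specialize (HN n Hn). unfold Rdist in HN.
  rewrite (Series_incr_n M (S n)) in HN by (easy || lia). simpl in HN.
  rewrite <- Rabs_Ropp.
  replace (- Series (fun k => M (S n + k)%nat)) with
    (sum_f_R0 M n - (sum_f_R0 M n + Series (fun k : nat => M (S (n + k))))) by (simpl; ring).
  exact HN.
Qed.

(* Tannery's theorem along an arbitrary filter. *)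
Lemma filterlim_Series {T : Type} (F : (T -> Prop) -> Prop) {FF : ProperFilter F}
  (a : T -> nat -> R) (b M : nat -> R) :
  (forall k, filterlim (fun t => a t k) F (locally (b k))) ->
  F (fun t => forall k, Rabs (a t k) <= M k) -> ex_series M ->
  ex_series b /\ filterlim (fun t => Series (a t)) F (locally (Series b)).
Proof.
  intros Hlim HM HS.
  (* The limits inherit the majorant: an excess would already show at some [t], which exists because
     the filter is proper. *)
  assert (Hb : forall k, Rabs (b k) <= M k).
  { intros k. apply Rnot_lt_le. intros Hlt.
    assert (H1 := proj1 (filterlim_R_spec F _ _) (Hlim k) (Rabs (b k) - M k) ltac:(lra)).
    destruct (filter_ex _ (filter_and _ _ HM H1)) as [t [H2 H3]].
    specialize (H2 k). assert (H4 := Rabs_triang_inv (b k) (a t k)).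
    rewrite Rabs_minus_sym in H3. lra. }
  assert (Sb : ex_series b) by now apply ex_series_Rle with M.
  split; [easy|].
  apply (filterlim_R_spec F). intros eps He.
  (* One third for the finite part and one for each of the two tails, both controlled by the tail of
     [M]. *)
  destruct (Series_tail_small M (eps / 3) HS ltac:(lra)) as [N HN].
  specialize (HN N (Nat.le_refl N)).
  assert (HF := proj1 (filterlim_R_spec F _ _) (filterlim_sum_f_R0 F a b N Hlim) (eps / 3) ltac:(lra)).
  apply filter_imp with (2 := filter_and _ _ HM HF). intros t [Ht1 Ht2].
  assert (Sa : ex_series (a t)) by now apply ex_series_Rle with M.
  rewrite (Series_incr_n (a t) (S N)), (Series_incr_n b (S N)) by (easy || lia).
  simpl Init.Nat.pred.
  assert (HS' : ex_series (fun k => M (S N + k)%nat)) by now apply -> (ex_series_incr_n (V := R_NormedModule) M (S N)).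
  assert (Ta : Rabs (Series (fun k => a t (S N + k)%nat)) < eps / 3).
  { eapply Rle_lt_trans; [|exact HN].
    eapply Rle_trans; [|apply Rle_abs].
    assert (HA : ex_series (fun k => Rabs (a t (S N + k)%nat))).
    { apply ex_series_Rle with (2 := HS'). intros k. rewrite Rabs_Rabsolu. apply Ht1. }
    eapply Rle_trans; [now apply Series_Rabs|]. apply Series_le; [|easy].
    intros k. split; [apply Rabs_pos|apply Ht1]. }
  assert (Tb : Rabs (Series (fun k => b (S N + k)%nat)) < eps / 3).
  { eapply Rle_lt_trans; [|exact HN].
    eapply Rle_trans; [|apply Rle_abs].
    assert (HA : ex_series (fun k => Rabs (b (S N + k)%nat))).
    { apply ex_series_Rle with (2 := HS'). intros k. rewrite Rabs_Rabsolu. apply Hb. }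
    eapply Rle_trans; [now apply Series_Rabs|]. apply Series_le; [|easy].
    intros k. split; [apply Rabs_pos|apply Hb]. }
  apply Rabs_def2 in Ta. apply Rabs_def2 in Tb. apply Rabs_def2 in Ht2.
  apply Rabs_def1; lra.
Qed.

Lemma is_series_telescope (v : nat -> R) (l : R) :
  is_lim_seq v l -> is_series (fun n => v n - v (S n)) (v 0%nat - l).
Proof.
  intros H. unfold is_series.
  apply filterlim_ext with (fun n => v 0%nat - v (S n)).
  - intros n. induction n as [|n IH]; [now rewrite sum_O|].
    rewrite sum_Sn, <- IH. unfold plus; simpl. ring.
  - apply (filterlim_R_minus eventually); [apply filterlim_const|].
    exact (proj1 (is_lim_seq_incr_1 v l) H).
Qed.

(** * Real powers and their sums *)

Lemma Rpower_pos (x y : R) : 0 < Rpower x y.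
Proof. apply exp_pos. Qed.

Lemma is_derive_Rpower (y x : R) : 0 < x ->
  is_derive (fun x => Rpower x y) x (y * Rpower x (y - 1)).
Proof. intros H. apply is_derive_Reals. now apply derivable_pt_lim_power. Qed.

Lemma continuous_Rpower (y x : R) : 0 < x -> continuous (fun x => Rpower x y) x.
Proof.
  intros H. apply (ex_derive_continuous (K := R_AbsRing) (V := R_NormedModule)).
  eexists. now apply is_derive_Rpower.
Qed.

Lemma is_lim_seq_INR_plus (c : R) : is_lim_seq (fun n => INR n + c) p_infty.
Proof.
  apply (is_lim_seq_plus _ _ p_infty c p_infty); [apply is_lim_seq_INR|apply is_lim_seq_const|easy].
Qed.

Lemma is_lim_Rpower_neg (d : R) : 0 < d -> is_lim (fun x => Rpower x (- d)) p_infty 0.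
Proof.
  intros Hd. unfold Rpower.
  apply (is_lim_comp exp (fun x => - d * ln x) p_infty 0 m_infty).
  - apply is_lim_exp_m.
  - replace m_infty with (Rbar_mult (- d) p_infty).
    + apply is_lim_scal_l. apply is_lim_ln_p.
    + simpl. destruct (Rle_dec 0 (- d)) as [H|H]; [exfalso; lra|easy].
  - now exists 0.
Qed.

Lemma is_lim_seq_Rpower_neg (c d : R) : 0 < d -> is_lim_seq (fun n => Rpower (INR n + c) (- d)) 0.
Proof.
  intros Hd. apply (is_lim_comp_seq (fun x => Rpower x (- d)) _ p_infty).
  - now apply is_lim_Rpower_neg.
  - now exists 0%nat.
  - apply is_lim_seq_INR_plus.
Qed.

Lemma MVT_ge (f df : R -> R) (m a b D : R) : m <= a -> m <= b ->
  (forall x, m <= x -> is_derive f x (df x)) -> (forall x, m <= x -> Rabs (df x) <= D) ->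
  Rabs (f b - f a) <= D * Rabs (b - a).
Proof.
  intros Ha Hb Hd HD.
  assert (Hm : m <= Rmin a b) by now apply Rmin_glb.
  destruct (MVT_gen f a b df) as [c [Hc E]].
  - intros x Hx. apply Hd. lra.
  - intros x Hx. apply continuity_pt_filterlim.
    apply (ex_derive_continuous (K := R_AbsRing) (V := R_NormedModule)). exists (df x). apply Hd. lra.
  - rewrite E, Rabs_mult. apply Rmult_le_compat_r; [apply Rabs_pos|]. apply HD. lra.
Qed.

Lemma Rpower_antitone (x y d : R) : 0 < x <= y -> 0 <= d -> Rpower y (- d) <= Rpower x (- d).
Proof.
  intros Hx Hd. rewrite !Rpower_Ropp. apply Rinv_le_contravar; [apply Rpower_pos|].
  now apply Rle_Rpower_l.
Qed.

(** By the mean value theorem each shifted term is at most [1 / d] times a difference of consecutive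
    values of [x ^ - d], and those differences telescope. The exponent is written [- d - 1] to match
    that derivative. *)
Lemma ex_series_Rpower (c d : R) : 0 < c -> 0 < d ->
  ex_series (fun n => Rpower (INR n + c) (- d - 1)).
Proof.
  intros Hc Hd. apply (ex_series_incr_1 (V := R_NormedModule)).
  apply ex_series_Rle with (fun n => / d * (Rpower (INR n + c) (- d) - Rpower (INR (S n) + c) (- d))).
  - intros n. rewrite Rabs_pos_eq by apply Rlt_le, Rpower_pos.
    assert (Hn := pos_INR n).
    destruct (MVT_gen (fun x => Rpower x (- d)) (INR n + c) (INR (S n) + c)
               (fun x => - d * Rpower x (- d - 1))) as [x [Hx E]].
    + intros x Hx. apply is_derive_Rpower. rewrite S_INR in Hx.
      rewrite Rmin_left in Hx; lra.
    + intros x Hx. apply continuity_pt_filterlim. apply continuous_Rpower.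
      rewrite S_INR, Rmin_left in Hx; lra.
    + rewrite S_INR in *. rewrite Rmin_left, Rmax_right in Hx by lra.
      replace (Rpower (INR n + c) (- d) - Rpower (INR n + 1 + c) (- d))
        with (d * Rpower x (- d - 1)) by lra.
      rewrite <- Rmult_assoc, Rinv_l, Rmult_1_l by lra.
      replace (- d - 1) with (- (d + 1)) by ring.
      apply Rpower_antitone; lra.
  - apply ex_series_Rscal. eexists. apply is_series_telescope.
    now apply is_lim_seq_Rpower_neg.
Qed.

(** * Real analytic functions *)

(** The coefficients are embedded in [C] so that the bounds of the complex section can be reused. *)
Definition real_analytic_at (f : R -> R) (x : R) : Prop :=
  exists a r, 0 < r /\ geo_bounded (fun k => RtoC (a k)) r /\
    forall h, Rabs h < r -> f (x + h) = PSeries a h.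

Lemma geo_bounded_le (a : nat -> C) (b : nat -> C) (r : R) : 0 <= r ->
  (forall k, Cmod (b k) <= Cmod (a k)) -> geo_bounded a r -> geo_bounded b r.
Proof.
  intros Hr H [M HM]. exists M. intros k. eapply Rle_trans; [|apply HM].
  apply Rmult_le_compat_r; [now apply pow_le|apply H].
Qed.

Lemma geo_bounded_Re (a : nat -> C) (r : R) : 0 <= r ->
  geo_bounded a r -> geo_bounded (fun k => RtoC (Re (a k))) r.
Proof.
  intros Hr. apply geo_bounded_le; [easy|]. intros k. rewrite Cmod_R. apply Re_le_Cmod.
Qed.

Lemma geo_bounded_Im (a : nat -> C) (r : R) : 0 <= r ->
  geo_bounded a r -> geo_bounded (fun k => RtoC (Im (a k))) r.
Proof.
  intros Hr. apply geo_bounded_le; [easy|]. intros k. rewrite Cmod_R. apply Im_le_Cmod.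
Qed.

Lemma geo_bounded_radius_le (a : nat -> C) (r R : R) : 0 <= R <= r ->
  geo_bounded a r -> geo_bounded a R.
Proof.
  intros HR [M HM]. exists M. intros k. eapply Rle_trans; [|apply HM].
  apply Rmult_le_compat_l; [apply Cmod_ge_0|now apply pow_incr].
Qed.

Lemma geo_bounded_minus (a b : nat -> C) (r : R) : 0 <= r ->
  geo_bounded a r -> geo_bounded b r -> geo_bounded (fun k => a k - b k)%C r.
Proof.
  intros Hr [M HM] [M' HM']. exists (M + M'). intros k.
  apply Rle_trans with (Cmod (a k) * r ^ k + Cmod (b k) * r ^ k).
  - rewrite <- Rmult_plus_distr_r. apply Rmult_le_compat_r; [now apply pow_le|].
    unfold Cminus. eapply Rle_trans; [apply Cmod_triangle|]. rewrite Cmod_opp. lra.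
  - now apply Rplus_le_compat.
Qed.

Lemma Cpow_RtoC (h : R) (k : nat) : (RtoC h ^ k)%C = RtoC (h ^ k).
Proof. induction k as [|k IH]; simpl; [easy|]. now rewrite IH, RtoC_mult. Qed.

Lemma Re_CPSeries (a : nat -> C) (h : R) : Re (CPSeries a (RtoC h)) = PSeries (fun k => Re (a k)) h.
Proof.
  unfold CPSeries, CSeries, PSeries. simpl. apply Series_ext. intros k.
  rewrite Cpow_RtoC. simpl. unfold Re. ring.
Qed.

Lemma Im_CPSeries (a : nat -> C) (h : R) : Im (CPSeries a (RtoC h)) = PSeries (fun k => Im (a k)) h.
Proof.
  unfold CPSeries, CSeries, PSeries. simpl. apply Series_ext. intros k.
  rewrite Cpow_RtoC. simpl. unfold Im. ring.
Qed.

Lemma geo_bounded_ex_series (a : nat -> R) (r h : R) :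
  geo_bounded (fun k => RtoC (a k)) r -> Rabs h < r -> ex_series (fun k => a k * h ^ k).
Proof.
  intros H Hh. apply ex_series_Rle with (2 := geo_bounded_series _ _ (Rabs h) H (conj (Rabs_pos h) Hh)).
  intros k. rewrite Cmod_R, Rabs_mult, RPow_abs. lra.
Qed.

Lemma PSeries_tail (a : nat -> R) (r h : R) :
  geo_bounded (fun k => RtoC (a k)) r -> Rabs h < r ->
  PSeries a h = a 0%nat + h * PSeries (fun k => a (S k)) h.
Proof.
  intros H Hh. unfold PSeries. rewrite Series_incr_1 by now apply geo_bounded_ex_series with r.
  rewrite <- Series_scal_l. simpl. rewrite Rmult_1_r. f_equal.
  apply Series_ext. intros k. ring.
Qed.

Lemma PSeries_bounded (a : nat -> R) (r R : R) :
  geo_bounded (fun k => RtoC (a k)) r -> 0 <= R < r ->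
  exists M, forall h, Rabs h <= R -> Rabs (PSeries a h) <= M.
Proof.
  intros H HR. exists (Series (fun k => Cmod (RtoC (a k)) * R ^ k)). intros h Hh. apply Series_abs_le.
  2: exact (geo_bounded_series _ _ R H HR).
  intros k. rewrite Cmod_R, Rabs_mult, <- RPow_abs. apply Rmult_le_compat_l; [apply Rabs_pos|].
  apply pow_incr. split; [apply Rabs_pos|easy].
Qed.

(** Induction on [n]: the bound forces [a 0 = 0], then [h] is divided out. Only [h > 0] is used,
    because the zeta series give information only to the right of 1. *)
Lemma PSeries_order_right (n : nat) (a : nat -> R) (r C e : R) :
  geo_bounded (fun k => RtoC (a k)) r -> 0 < r -> 0 < e ->
  (forall h, 0 < h < e -> Rabs (PSeries a h) <= C * h ^ n) ->
  forall j, (j < n)%nat -> a j = 0.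
Proof.
  revert a e. induction n as [|n IH]; intros a e Ha Hr He H; [intros; lia|].
  assert (HC : 0 <= C).
  { specialize (H (e / 2) ltac:(lra)). assert (0 < (e / 2) ^ S n) by (apply pow_lt; lra).
    assert (H1 := Rabs_pos (PSeries a (e / 2))).
    apply Rmult_le_reg_r with ((e / 2) ^ S n); lra. }
  assert (Ha' : geo_bounded (fun k => RtoC (a (S k))) r) by now apply (geo_bounded_incr (fun k => RtoC (a k))).
  assert (H0 : a 0%nat = 0).
  { destruct (PSeries_bounded _ r (r / 2) Ha' ltac:(lra)) as [M HM].
    destruct (Req_dec (a 0%nat) 0) as [|Hn]; [easy|exfalso].
    assert (HM0 : 0 <= M).
    { eapply Rle_trans; [apply Rabs_pos|apply (HM 0)]. rewrite Rabs_R0; lra. }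
    assert (Hp := Rabs_pos_lt _ Hn).
    (* With this [h], [|a 0| <= (M + C) h] and [(M + C + 1) h <= |a 0| / 2] contradict each
       other. *)
    set (h := Rmin (Rmin (e / 2) (r / 2)) (Rmin 1 (Rabs (a 0%nat) / (2 * (M + C + 1))))).
    assert (Hq : 0 < Rabs (a 0%nat) / (2 * (M + C + 1))) by (apply Rdiv_lt_0_compat; lra).
    assert (Hh : 0 < h) by (unfold h; repeat apply Rmin_glb_lt; lra).
    assert (h <= Rmin (e / 2) (r / 2)) by apply Rmin_l.
    assert (Rmin (e / 2) (r / 2) <= e / 2) by apply Rmin_l.
    assert (Rmin (e / 2) (r / 2) <= r / 2) by apply Rmin_r.
    assert (H3 : h <= Rmin 1 (Rabs (a 0%nat) / (2 * (M + C + 1)))) by apply Rmin_r.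
    assert (h <= 1) by (eapply Rle_trans; [exact H3|apply Rmin_l]).
    assert (Hh2 : h <= Rabs (a 0%nat) / (2 * (M + C + 1))) by (eapply Rle_trans; [exact H3|apply Rmin_r]).
    assert (E := PSeries_tail a r h Ha ltac:(rewrite Rabs_pos_eq; lra)).
    assert (B1 := H h ltac:(lra)). assert (B2 := HM h ltac:(rewrite Rabs_pos_eq; lra)).
    assert (Hpow : h ^ n <= 1) by (rewrite <- (pow1 n); apply pow_incr; lra).
    assert (B3 : Rabs (a 0%nat) <= (M + C) * h).
    { replace (a 0%nat) with (PSeries a h - h * PSeries (fun k => a (S k)) h) by lra.
      eapply Rle_trans; [apply Rabs_triang|]. rewrite Rabs_Ropp, Rabs_mult, (Rabs_pos_eq h) by lra.
      simpl in B1. assert (C * (h * h ^ n) <= C * (h * 1)) by (repeat apply Rmult_le_compat_l; lra).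
      assert (h * Rabs (PSeries (fun k => a (S k)) h) <= h * M) by (apply Rmult_le_compat_l; lra).
      lra. }
    assert (B4 : (M + C + 1) * h <= Rabs (a 0%nat) / 2).
    { replace (Rabs (a 0%nat) / 2) with ((M + C + 1) * (Rabs (a 0%nat) / (2 * (M + C + 1)))) by (field; lra).
      apply Rmult_le_compat_l; lra. }
    lra. }
  intros [|j] Hj; [easy|].
  apply (IH (fun k => a (S k)) (Rmin e r) Ha' Hr (Rmin_glb_lt _ _ _ He Hr)); [|lia].
  intros h [Hh1 Hh2].
  assert (h < e) by (eapply Rlt_le_trans; [exact Hh2|apply Rmin_l]).
  assert (h < r) by (eapply Rlt_le_trans; [exact Hh2|apply Rmin_r]).
  specialize (H h ltac:(lra)).
  rewrite (PSeries_tail a r h Ha) in H by (rewrite Rabs_pos_eq; lra).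
  rewrite H0, Rplus_0_l, Rabs_mult, (Rabs_pos_eq h) in H by lra. simpl in H.
  apply Rmult_le_reg_l with h; lra.
Qed.

(** Vanishing is the order estimate with constant 0, available for every order. *)
Lemma PSeries_zero_right (a : nat -> R) (r e : R) :
  geo_bounded (fun k => RtoC (a k)) r -> 0 < r -> 0 < e ->
  (forall h, 0 < h < e -> PSeries a h = 0) -> forall j, a j = 0.
Proof.
  intros Ha Hr He H j. apply (PSeries_order_right (S j) a r 0 e); try easy.
  - intros h Hh. rewrite H, Rabs_R0 by easy. lra.
  - lia.
Qed.

Lemma PSeries_minus_geo (a b : nat -> R) (r h : R) :
  geo_bounded (fun k => RtoC (a k)) r -> geo_bounded (fun k => RtoC (b k)) r -> Rabs h < r ->
  PSeries (fun k => a k - b k) h = PSeries a h - PSeries b h.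
Proof.
  intros Ha Hb Hh. unfold PSeries. rewrite <- Series_minus.
  - apply Series_ext. intros k. ring.
  - now apply geo_bounded_ex_series with r.
  - now apply geo_bounded_ex_series with r.
Qed.

Lemma geo_bounded_Rminus (a b : nat -> R) (r : R) : 0 <= r ->
  geo_bounded (fun k => RtoC (a k)) r -> geo_bounded (fun k => RtoC (b k)) r ->
  geo_bounded (fun k => RtoC (a k - b k)) r.
Proof.
  intros Hr Ha Hb. destruct (geo_bounded_minus _ _ r Hr Ha Hb) as [M HM].
  exists M. intros k. rewrite RtoC_minus. apply HM.
Qed.

Lemma PSeries_eq_right (a b : nat -> R) (r e : R) :
  geo_bounded (fun k => RtoC (a k)) r -> geo_bounded (fun k => RtoC (b k)) r -> 0 < r -> 0 < e ->
  (forall h, 0 < h < e -> PSeries a h = PSeries b h) -> forall j, a j = b j.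
Proof.
  intros Ha Hb Hr He H j. apply Rminus_diag_uniq.
  apply (PSeries_zero_right (fun k => a k - b k) r (Rmin e r)); try easy.
  - apply geo_bounded_Rminus; [lra|easy|easy].
  - now apply Rmin_glb_lt.
  - intros h [H1 H2].
    assert (h < e) by (eapply Rlt_le_trans; [exact H2|apply Rmin_l]).
    assert (h < r) by (eapply Rlt_le_trans; [exact H2|apply Rmin_r]).
    rewrite (PSeries_minus_geo a b r) by (easy || (rewrite Rabs_pos_eq; lra)).
    rewrite H by easy. ring.
Qed.

Lemma real_analytic_minus (f g : R -> R) (x : R) :
  real_analytic_at f x -> real_analytic_at g x -> real_analytic_at (fun y => f y - g y) x.
Proof.
  intros [a [r [Hr [Ha Hf]]]] [b [r' [Hr' [Hb Hg]]]].
  assert (Hm : 0 < Rmin r r') by now apply Rmin_glb_lt.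
  assert (Ha' := geo_bounded_radius_le _ _ (Rmin r r') (conj (Rlt_le _ _ Hm) (Rmin_l r r')) Ha).
  assert (Hb' := geo_bounded_radius_le _ _ (Rmin r r') (conj (Rlt_le _ _ Hm) (Rmin_r r r')) Hb).
  exists (fun k => a k - b k), (Rmin r r'). split; [easy|]. split.
  - apply geo_bounded_Rminus; [lra|easy|easy].
  - intros h Hh. rewrite (PSeries_minus_geo a b (Rmin r r')) by easy.
    rewrite <- Hf, <- Hg; [easy| |].
    + eapply Rlt_le_trans; [exact Hh|apply Rmin_r].
    + eapply Rlt_le_trans; [exact Hh|apply Rmin_l].
Qed.

(* The set of [x] such that [f] vanishes on [(x, c)] has an infimum [m]; if [m > a], the expansion at [m] vanishes on the right of [m], hence around [m]. *)
Lemma real_analytic_zero (f : R -> R) (a b c : R) : b < c ->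
  (forall x, a < x < c -> real_analytic_at f x) ->
  (forall x, b < x < c -> f x = 0) -> forall x, a < x < c -> f x = 0.
Proof.
  intros Hbc Hf H0.
  set (S := fun y => a <= y < c /\ forall x, y < x < c -> f x = 0).
  destruct (Rlt_le_dec b a) as [Hba|Hab]; [intros x Hx; apply H0; lra|].
  (* [completeness] provides suprema, so the set is reflected and the infimum is [- m]. *)
  destruct (completeness (fun z => S (- z))) as [m [Hm1 Hm2]].
  - exists (- a). intros z [Hz _]. lra.
  - exists (- b). unfold S. rewrite Ropp_involutive. split; [lra|]. intros x Hx. apply H0; lra.
  - assert (Hb : - b <= m).
    { apply Hm1. unfold S. rewrite Ropp_involutive. split; [lra|]. intros x Hx. apply H0; lra. }
    assert (Hma : m <= - a) by (apply Hm2; intros z [Hz _]; lra).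
    assert (HS : forall x, - m < x < c -> f x = 0).
    { intros x Hx. destruct (Req_dec (f x) 0) as [|Hn]; [easy|exfalso].
      assert (m <= - x); [|lra]. apply Hm2. intros z Hz.
      apply Rnot_lt_le. intros Hlt. apply Hn. apply Hz. lra. }
    destruct (Rle_lt_or_eq_dec _ _ Hma) as [Hlt|Heq]; [|intros x Hx; apply HS; lra].
    exfalso. destruct (Hf (- m) ltac:(lra)) as [e [r [Hr [He Hfe]]]].
    set (d := Rmin r (Rmin (c - - m) (- a - m))).
    assert (Hd : 0 < d) by (unfold d; repeat apply Rmin_glb_lt; lra).
    assert (d <= r) by apply Rmin_l.
    assert (d <= Rmin (c - - m) (- a - m)) by apply Rmin_r.
    assert (Rmin (c - - m) (- a - m) <= c - - m) by apply Rmin_l.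
    assert (Rmin (c - - m) (- a - m) <= - a - m) by apply Rmin_r.
    assert (Hz : forall j, e j = 0).
    { apply (PSeries_zero_right e r d); try easy. intros h Hh.
      rewrite <- Hfe by (rewrite Rabs_pos_eq; lra). apply HS. lra. }
    assert (HP : forall h, Rabs h < r -> f (- m + h) = 0).
    { intros h Hh. rewrite Hfe by easy. unfold PSeries.
      rewrite (Series_ext _ (fun _ => 0 * 0)) by (intros k; rewrite Hz; ring).
      rewrite Series_scal_l. ring. }
    (* Vanishing on both sides of [- m] would put [- m - d / 2] into the set, below its infimum. *)
    assert (m + d / 2 <= m); [|lra].
    apply Hm1. unfold S. split; [lra|]. intros x Hx.
    destruct (Rlt_le_dec (- m) x) as [Hl|Hl]; [apply HS; lra|].
    replace x with (- m + (x - - m)) by ring. apply HP.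
    rewrite Rabs_left1; lra.
Qed.

(** * The real difference of two zeta functions and its analyticity *)

(* For [s > 0] this is [zeta(s,u) - zeta(s,1-u)]; the series converges even where the two zeta series do not. *)
Definition hdiff (u s : R) : R :=
  Series (fun n => Rpower (INR n + u) (- s) - Rpower (INR n + 1 - u) (- s)).

(** One term of the exponential series, all of whose terms are nonnegative. *)
Lemma pow_fact_le_exp (y : R) (k : nat) : 0 <= y -> y ^ k / INR (Factorial.fact k) <= exp y.
Proof.
  intros Hy. assert (H := is_exp_Reals y). apply is_pseries_R in H.
  assert (Hp : forall n, 0 <= / INR (Factorial.fact n) * y ^ n).
  { intros n. apply Rmult_le_pos; [|now apply pow_le]. left. apply Rinv_0_lt_compat, INR_fact_lt_0. }
  rewrite <- (is_series_unique _ _ H).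
  rewrite (Series_incr_n _ (S k)); [|lia|eexists; apply H]. simpl Init.Nat.pred.
  assert (0 <= Series (fun k0 : nat => / INR (Factorial.fact (S k + k0)) * y ^ (S k + k0))).
  { rewrite <- (Rmult_0_l (Series (fun k0 => / INR (Factorial.fact (S k + k0)) * y ^ (S k + k0)))).
    rewrite <- Series_scal_l. apply Series_le.
    - intros n. rewrite Rmult_0_l. split; [lra|apply Hp].
    - apply -> (ex_series_incr_n (V := R_NormedModule) (fun n => / INR (Factorial.fact n) * y ^ n) (S k)). eexists; apply H. }
  assert (y ^ k / INR (Factorial.fact k) <= sum_f_R0 (fun n => / INR (Factorial.fact n) * y ^ n) k).
  { destruct k as [|k]; [simpl; lra|]. rewrite tech5.
    assert (0 <= sum_f_R0 (fun n => / INR (Factorial.fact n) * y ^ n) k) by (apply cond_pos_sum; apply Hp).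
    unfold Rdiv. lra. }
  lra.
Qed.

(** The coefficient of [h ^ k] in [x ^ - (s + h)], regarded as a function of the base [x]. *)
Definition Rpower_coef (s : R) (k : nat) (x : R) : R :=
  (- ln x) ^ k / INR (Factorial.fact k) * Rpower x (- s).

Lemma is_series_Rpower (s x h : R) :
  is_series (fun k => Rpower_coef s k x * h ^ k) (Rpower x (- (s + h))).
Proof.
  assert (H := is_exp_Reals (- ln x * h)). apply is_pseries_R in H.
  apply is_series_scal_r with (c := Rpower x (- s)) in H.
  replace (exp (- ln x * h) * Rpower x (- s)) with (Rpower x (- (s + h))) in H.
  - apply is_series_ext with (2 := H). intros n. unfold Rpower_coef. rewrite Rpow_mult_distr.
    change (/ INR (Factorial.fact n) * ((- ln x) ^ n * h ^ n) * Rpower x (- s) =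
      (- ln x) ^ n / INR (Factorial.fact n) * Rpower x (- s) * h ^ n). field. apply INR_fact_neq_0.
  - unfold Rpower. rewrite <- exp_plus. f_equal. ring.
Qed.

(** [(e |ln x|) ^ k / k!] is at most [exp (e |ln x|)]; this plays the part of a Cauchy estimate with
    radius [e] in the exponent. *)
Lemma Rpower_coef_le (s e x : R) (k : nat) : 0 < e ->
  Rabs (Rpower_coef s k x) <= (exp (e * Rabs (ln x)) * Rpower x (- s)) * (/ e) ^ k.
Proof.
  intros He. unfold Rpower_coef, Rdiv.
  rewrite !Rabs_mult, <- RPow_abs, Rabs_Ropp, Rabs_inv, (Rabs_pos_eq (Rpower _ _)) by apply Rlt_le, Rpower_pos.
  rewrite (Rabs_pos_eq (INR _)) by apply pos_INR.
  assert (H := pow_fact_le_exp (e * Rabs (ln x)) k ltac:(apply Rmult_le_pos; [lra|apply Rabs_pos])).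
  rewrite Rpow_mult_distr in H.
  replace (Rabs (ln x) ^ k * / INR (Factorial.fact k)) with
    ((e ^ k * Rabs (ln x) ^ k / INR (Factorial.fact k)) * (/ e) ^ k).
  2:{ rewrite pow_inv. field. split; [apply INR_fact_neq_0|apply pow_nonzero; lra]. }
  assert (0 <= (/ e) ^ k) by (apply pow_le; left; now apply Rinv_0_lt_compat).
  assert (Hr := Rpower_pos x (- s)).
  replace (exp (e * Rabs (ln x)) * Rpower x (- s) * (/ e) ^ k)
    with (exp (e * Rabs (ln x)) * (/ e) ^ k * Rpower x (- s)) by ring.
  apply Rmult_le_compat_r; [lra|]. now apply Rmult_le_compat_r.
Qed.

(** Derivation in the base returns coefficients at [s + 1], that is, gains a factor [1 / x]; the
    logarithm lowers the index [k] by one, whence the case split. *)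
Lemma is_derive_Rpower_coef (s x : R) (k : nat) : 0 < x ->
  is_derive (Rpower_coef s k) x
    (- (match k with O => 0 | S j => Rpower_coef (s + 1) j x end + s * Rpower_coef (s + 1) k x)).
Proof.
  intros Hx.
  assert (HR : Rpower x (- s - 1) = Rpower x (- (s + 1))) by (f_equal; ring).
  assert (Hl : is_derive (fun y => (- ln y) ^ k / INR (Factorial.fact k)) x
     (- match k with O => 0 | S j => (- ln x) ^ j / INR (Factorial.fact j) end / x)).
  { auto_derive; [easy|]. destruct k as [|j]; [simpl; field; lra|].
    simpl Init.Nat.pred. rewrite fact_simpl, mult_INR. field.
    repeat split; try lra; try apply INR_fact_neq_0; apply not_0_INR; lia. }
  evar_last. { apply (is_derive_mult _ _ _ _ _ Hl (is_derive_Rpower (- s) x Hx)). intros; apply Rmult_comm. }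
  unfold plus, mult; simpl. rewrite HR. unfold Rpower_coef.
  assert (HX : Rpower x (- s) / x = Rpower x (- (s + 1))).
  { rewrite <- (Rpower_1 x) at 2 by easy. unfold Rdiv. rewrite <- Rpower_Ropp, <- Rpower_plus. f_equal; ring. }
  destruct k as [|j].
  - rewrite <- HX. simpl. field; lra.
  - rewrite <- HX. field. repeat split; try lra; apply INR_fact_neq_0.
Qed.

Lemma Rpower_coef_le_ge1 (s e x : R) (k : nat) : 0 < e -> 1 <= x ->
  Rabs (Rpower_coef s k x) <= Rpower x (e - s) * (/ e) ^ k.
Proof.
  intros He Hx. eapply Rle_trans; [now apply (Rpower_coef_le s e)|]. right. f_equal.
  assert (0 <= ln x) by (rewrite <- ln_1; apply ln_le; lra).
  rewrite Rabs_pos_eq by easy. unfold Rpower. rewrite <- exp_plus. f_equal. ring.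
Qed.

(** For [n >= 1] the bases [n + u] and [n + 1 - u] lie in [[n, n + 1]], and the mean value theorem
    gives [O(n ^ (e - s - 1))], summable since [e < s]. The factors [e] and [s] come from deriving
    the power of the logarithm and the power of [x]. The term [n = 0] is bounded apart, since its
    bases are below 1. Separating [n] from [k] in the bound allows both summations. *)
Lemma hdiff_coef_bound (u s e : R) : 0 < u < 1 -> 0 < e -> e < s ->
  exists B : nat -> R, ex_series B /\ forall n k,
    Rabs (Rpower_coef s k (INR n + u) - Rpower_coef s k (INR n + 1 - u)) <= B n * (/ e) ^ k.
Proof.
  intros Hu He Hs.
  set (K := fun x => exp (e * Rabs (ln x)) * Rpower x (- s)).
  exists (fun n => match n with O => K u + K (1 - u)
                   | S j => (e + s) * Rpower (INR j + 1) (- (s - e) - 1) end).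
  split.
  { apply (ex_series_incr_1 (V := R_NormedModule)). simpl. apply ex_series_Rscal. apply ex_series_Rpower; lra. }
  intros [|j] k.
  - simpl INR. rewrite Rplus_0_l. replace (0 + 1 - u) with (1 - u) by ring.
    rewrite Rmult_plus_distr_r.
    unfold Rminus at 1. eapply Rle_trans; [apply Rabs_triang|]. rewrite Rabs_Ropp.
    apply Rplus_le_compat; now apply Rpower_coef_le.
  - set (n := S j). replace (INR j + 1) with (INR n) by apply S_INR. assert (Hn : 1 <= INR n) by (apply (le_INR 1); lia).
    assert (Hek : 0 <= (/ e) ^ k) by (apply pow_le; left; now apply Rinv_0_lt_compat).
    apply Rle_trans with ((e + s) * Rpower (INR n) (- (s - e) - 1) * (/ e) ^ k * Rabs (INR n + u - (INR n + 1 - u))).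
    + apply (MVT_ge (Rpower_coef s k) (fun x => (- (match k with O => 0 | S j => Rpower_coef (s + 1) j x end + s * Rpower_coef (s + 1) k x))) (INR n)).
      * lra.
      * lra.
      * intros x Hx. apply is_derive_Rpower_coef. lra.
      * intros x Hx. rewrite Rabs_Ropp.
        assert (Hm : Rpower x (e - (s + 1)) <= Rpower (INR n) (- (s - e) - 1)).
        { replace (e - (s + 1)) with (- (s + 1 - e)) by ring.
          replace (- (s - e) - 1) with (- (s + 1 - e)) by ring. apply Rpower_antitone; lra. }
        assert (B1 : Rabs (s * Rpower_coef (s + 1) k x) <= s * Rpower (INR n) (- (s - e) - 1) * (/ e) ^ k).
        { rewrite Rabs_mult, (Rabs_pos_eq s), Rmult_assoc by lra. apply Rmult_le_compat_l; [lra|].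
          eapply Rle_trans; [apply (Rpower_coef_le_ge1 (s + 1) e); lra|]. now apply Rmult_le_compat_r. }
        assert (B2 : Rabs (match k with O => 0 | S j => Rpower_coef (s + 1) j x end) <= e * Rpower (INR n) (- (s - e) - 1) * (/ e) ^ k).
        { destruct k as [|i].
          - rewrite Rabs_R0. assert (H := Rpower_pos (INR n) (- (s - e) - 1)). rewrite pow_O, Rmult_1_r.
            apply Rmult_le_pos; lra.
          - eapply Rle_trans; [apply (Rpower_coef_le_ge1 (s + 1) e); lra|].
            replace (e * Rpower (INR n) (- (s - e) - 1) * (/ e) ^ S i)
              with (Rpower (INR n) (- (s - e) - 1) * (/ e) ^ i) by (rewrite <- tech_pow_Rmult; field; lra).
            apply Rmult_le_compat_r; [|easy]. apply pow_le; left; now apply Rinv_0_lt_compat. }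
        eapply Rle_trans; [apply Rabs_triang|]. lra.
    + match goal with |- ?a * _ <= _ => rewrite <- (Rmult_1_r a) at 2 end.
      apply Rmult_le_compat_l.
      * assert (H := Rpower_pos (INR n) (- (s - e) - 1)). apply Rmult_le_pos; [apply Rmult_le_pos; lra|easy].
      * apply Rabs_le. lra.
Qed.

Lemma is_series_sum_n_Rpower_coef (u s h : R) (N : nat) :
  is_series (fun k => sum_n (fun n => Rpower_coef s k (INR n + u) - Rpower_coef s k (INR n + 1 - u)) N * h ^ k)
    (sum_n (fun n => Rpower (INR n + u) (- (s + h)) - Rpower (INR n + 1 - u) (- (s + h))) N).
Proof.
  assert (H : forall n, is_series (fun k => (Rpower_coef s k (INR n + u) - Rpower_coef s k (INR n + 1 - u)) * h ^ k)
    (Rpower (INR n + u) (- (s + h)) - Rpower (INR n + 1 - u) (- (s + h)))).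
  { intros n.
    apply is_series_ext with (2 := is_series_minus _ _ _ _ (is_series_Rpower s (INR n + u) h) (is_series_Rpower s (INR n + 1 - u) h)).
    intros k. unfold plus, opp; simpl. ring. }
  induction N as [|N IH].
  - rewrite sum_O. apply is_series_ext with (2 := H 0%nat). intros k. now rewrite sum_O.
  - rewrite sum_Sn. apply is_series_ext with (2 := is_series_plus _ _ _ _ IH (H (S N))).
    intros k. rewrite sum_Sn. unfold plus; simpl. ring.
Qed.

Lemma sum_n_abs_le (a b : nat -> R) (N : nat) :
  (forall k, Rabs (a k) <= b k) -> ex_series b -> Rabs (sum_n a N) <= Series b.
Proof.
  intros H Hb.
  assert (Hb0 : forall k, 0 <= b k) by (intros k; eapply Rle_trans; [apply Rabs_pos|apply H]).
  apply Rle_trans with (sum_n b N).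
  - induction N as [|N IH]; [rewrite !sum_O; apply H|].
    rewrite !sum_Sn. eapply Rle_trans; [apply Rabs_triang|]. now apply Rplus_le_compat.
  - assert (HS := Series_correct _ Hb).
    apply (is_lim_seq_incr_compare (sum_n b)); [exact HS|].
    intros n. rewrite sum_Sn. unfold plus; simpl. specialize (Hb0 (S n)). lra.
Qed.

(** The case [k = 0] of the coefficient bound. *)
Lemma hdiff_ex_series (u s : R) : 0 < u < 1 -> 0 < s ->
  ex_series (fun n => Rpower (INR n + u) (- s) - Rpower (INR n + 1 - u) (- s)).
Proof.
  intros Hu Hs. destruct (hdiff_coef_bound u s (s / 2) Hu ltac:(lra) ltac:(lra)) as [B [HB H]].
  apply ex_series_Rle with (2 := HB). intros n. specialize (H n 0%nat).
  unfold Rpower_coef in H. simpl in H. rewrite Rmult_1_r in H. unfold Rdiv in H. now rewrite Rinv_1, !Rmult_1_l in H.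
Qed.

(** Each partial sum over [n] is a power series in [h]; the separated bound lets the limit in [n]
    pass through the sum over [k]. *)
Lemma hdiff_analytic (u s : R) : 0 < u < 1 -> 0 < s -> real_analytic_at (hdiff u) s.
Proof.
  intros Hu Hs. destruct (hdiff_coef_bound u s (s / 2) Hu ltac:(lra) ltac:(lra)) as [B [HB H]].
  set (e := s / 2) in *. assert (He : 0 < e) by (unfold e; lra).
  set (d := fun n k => Rpower_coef s k (INR n + u) - Rpower_coef s k (INR n + 1 - u)) in *.
  assert (HBk : forall k, ex_series (fun n => B n * (/ e) ^ k)).
  { intros k. apply (ex_series_ext (V := R_NormedModule) (fun n => (/ e) ^ k * B n)); [intros; apply Rmult_comm|].
    now apply ex_series_Rscal. }
  assert (HSB : forall k, Series (fun n => B n * (/ e) ^ k) = Series B * (/ e) ^ k) by (intros; apply Series_scal_r).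
  assert (Hd : forall k, ex_series (fun n => d n k)) by (intros k; apply ex_series_Rle with (2 := HBk k); intros n; apply H).
  assert (HB0 : 0 <= Series B).
  { specialize (HSB 0%nat). simpl in HSB. rewrite Rmult_1_r in HSB. rewrite <- HSB.
    eapply Rle_trans; [apply Rabs_pos|]. apply (sum_n_abs_le (fun n => d n 0%nat) _ 0); [intros; apply H|apply (HBk 0%nat)]. }
  exists (fun k => Series (fun n => d n k)), e. split; [easy|]. split.
  - exists (Series B). intros k. rewrite Cmod_R.
    apply Rle_trans with (Series B * (/ e) ^ k * e ^ k).
    + apply Rmult_le_compat_r; [apply pow_le; lra|]. rewrite <- HSB. apply Series_abs_le; [intros; apply H|easy].
    + rewrite Rmult_assoc, <- Rpow_mult_distr, Rinv_l, pow1 by lra. lra.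
  - intros h Hh.
    assert (HM : ex_series (fun k => Series B * (Rabs h / e) ^ k)).
    { apply ex_series_Rscal. apply ex_series_geom. rewrite Rabs_pos_eq.
      - apply Rmult_lt_reg_r with e; [easy|]. unfold Rdiv. rewrite Rmult_assoc, Rinv_l; lra.
      - apply Rmult_le_pos; [apply Rabs_pos|]. left; now apply Rinv_0_lt_compat. }
    (* Tannery's theorem with [k] as summation index and the cut-off [N] as parameter. *)
    destruct (filterlim_Series eventually (fun N k => sum_n (fun n => d n k) N * h ^ k)
      (fun k => Series (fun n => d n k) * h ^ k) (fun k => Series B * (Rabs h / e) ^ k)) as [_ HL].
    + intros k. apply (filterlim_R_mult eventually); [|apply filterlim_const].
      exact (Series_correct _ (Hd k)).
    + exists 0%nat. intros N _ k. rewrite Rabs_mult, <- RPow_abs. unfold Rdiv. rewrite Rpow_mult_distr.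
      replace (Series B * (Rabs h ^ k * (/ e) ^ k)) with (Series B * (/ e) ^ k * Rabs h ^ k) by ring.
      apply Rmult_le_compat_r; [apply pow_le, Rabs_pos|]. rewrite <- HSB.
      apply sum_n_abs_le; [intros; apply H|easy].
    + easy.
    + assert (HU : is_series (fun n => Rpower (INR n + u) (- (s + h)) - Rpower (INR n + 1 - u) (- (s + h)))
         (Series (fun k => Series (fun n => d n k) * h ^ k))).
      { unfold is_series. apply filterlim_ext with (2 := HL). intros N.
        exact (is_series_unique _ _ (is_series_sum_n_Rpower_coef u s h N)). }
      exact (is_series_unique _ _ HU).
Qed.

(** Here both zeta series converge and can be subtracted termwise; [cpow_pos] is real at a real
    exponent, so the imaginary parts vanish. *)
Lemma hdiff_gt_1 (u s : R) (f g : C -> C) : 0 < u < 1 -> 1 < s ->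
  is_hurwitz_zeta u f -> is_hurwitz_zeta (1 - u) g ->
  (f (RtoC s) - g (RtoC s))%C = RtoC (hdiff u s).
Proof.
  intros Hu Hs [Hf _] [Hg _].
  specialize (Hf (RtoC s) Hs). specialize (Hg (RtoC s) Hs).
  apply is_series_Re_Im in Hf. apply is_series_Re_Im in Hg.
  destruct Hf as [Hf1 Hf2], Hg as [Hg1 Hg2].
  assert (HR : forall x, Re (cpow_pos x (- RtoC s)) = Rpower x (- s)).
  { intros x. unfold cpow_pos, Re. simpl. rewrite Ropp_0, Rmult_0_l, cos_0, Rmult_1_r. easy. }
  assert (HI : forall x, Im (cpow_pos x (- RtoC s)) = 0).
  { intros x. unfold cpow_pos, Im. simpl. rewrite Ropp_0, Rmult_0_l, sin_0, Rmult_0_r. easy. }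
  assert (Z : Series (fun _ : nat => 0) = 0).
  { rewrite (Series_ext _ (fun _ => 0 * 0)) by (intros; ring). rewrite Series_scal_l; ring. }
  assert (E1 : Im (f (RtoC s)) = 0).
  { rewrite <- (is_series_unique _ _ Hf2). rewrite (Series_ext _ (fun _ => 0)); [easy|intros; apply HI]. }
  assert (E2 : Im (g (RtoC s)) = 0).
  { rewrite <- (is_series_unique _ _ Hg2). rewrite (Series_ext _ (fun _ => 0)); [easy|intros; apply HI]. }
  assert (E3 : hdiff u s = Re (f (RtoC s)) - Re (g (RtoC s))).
  { unfold hdiff. rewrite <- (is_series_unique _ _ Hf1), <- (is_series_unique _ _ Hg1).
    rewrite <- Series_minus by (eexists; eassumption).
    apply Series_ext. intros n. rewrite !HR. f_equal. f_equal. ring. }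
  rewrite E3. unfold Re, Im in *. destruct (f (RtoC s)) as [f1 f2], (g (RtoC s)) as [g1 g2]. simpl in *.
  unfold Cminus, Cplus, Copp, RtoC. simpl. f_equal. lra.
Qed.

(** * The difference of two Hurwitz zeta functions *)

Lemma Cminus_neq_0 (w z : C) : w <> z -> (w - z <> 0)%C.
Proof.
  intros H E. apply H. replace w with (w - z + z)%C by ring. rewrite E. ring.
Qed.

Lemma CPSeries_tail (a : nat -> C) (r : R) (w : C) : geo_bounded a r -> Cmod w < r ->
  CPSeries a w = (a 0%nat + w * CPSeries (fun k => a (S k)) w)%C.
Proof.
  intros Ha Hw.
  assert (Hr : 0 < r) by (eapply Rle_lt_trans; [apply Cmod_ge_0|exact Hw]).
  unfold CPSeries. rewrite CSeries_incr_1 by now apply geo_bounded_summable with r.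
  rewrite <- CSeries_scal.
  - simpl. f_equal; [ring|]. apply CSeries_ext. intros k. ring.
  - apply geo_bounded_summable with r; [|easy]. now apply geo_bounded_incr.
Qed.

(** Prepending zeros. It brings two expansions with different pole orders to a common
    denominator. *)
Lemma CPSeries_shift (k : nat) (a : nat -> C) (r : R) : 0 < r -> geo_bounded a r ->
  exists b, geo_bounded b r /\ forall w, Cmod w < r -> CPSeries b w = (w ^ k * CPSeries a w)%C.
Proof.
  intros Hr Ha. induction k as [|k [b [Hb IH]]].
  - exists a. split; [easy|]. intros w _. simpl. ring.
  - set (b' := fun n => match n with O => RtoC 0 | S j => b j end).
    assert (Hb' : geo_bounded b' r).
    { destruct Hb as [M HM]. exists (M * r). intros [|j].
      - simpl. rewrite Cmod_0. specialize (HM 0%nat). simpl in HM.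
        assert (0 <= Cmod (b 0%nat)) by apply Cmod_ge_0.
        rewrite Rmult_0_l. apply Rmult_le_pos; lra.
      - simpl. specialize (HM j). replace (Cmod (b j) * (r * r ^ j)) with (Cmod (b j) * r ^ j * r) by ring.
        apply Rmult_le_compat_r; lra. }
    exists b'. split; [easy|]. intros w Hw. rewrite (CPSeries_tail b' r) by easy.
    change (fun k0 => b' (S k0)) with b. rewrite IH by easy. simpl. ring.
Qed.

Lemma CPSeries_unshift (k : nat) (a : nat -> C) (r : R) : 0 < r -> geo_bounded a r ->
  (forall j, (j < k)%nat -> a j = 0%C) ->
  exists b, geo_bounded b r /\ forall w, Cmod w < r -> CPSeries a w = (w ^ k * CPSeries b w)%C.
Proof.
  intros Hr. revert a. induction k as [|k IH]; intros a Ha H.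
  - exists a. split; [easy|]. intros w _. simpl. ring.
  - destruct (IH (fun j => a (S j))) as [b [Hb HE]].
    + now apply geo_bounded_incr.
    + intros j Hj. apply H. lia.
    + exists b. split; [easy|]. intros w Hw. rewrite (CPSeries_tail a r) by easy.
      rewrite HE, H by (easy || lia). simpl. ring.
Qed.

Lemma CPSeries_minus (a b : nat -> C) (r : R) (w : C) : geo_bounded a r -> geo_bounded b r -> Cmod w < r ->
  CPSeries (fun k => a k - b k)%C w = (CPSeries a w - CPSeries b w)%C.
Proof.
  intros Ha Hb Hw. unfold CPSeries. rewrite <- CSeries_minus by now apply geo_bounded_summable with r.
  apply CSeries_ext. intros k. ring.
Qed.

(** Agreement on a full disc around [w] provides agreement near each [w + h], as the inner
    derivative needs. The centre [z] may differ from [w]: points near 1 are handled by the expansion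
    at 1. *)
Lemma C_derive2_CPSeries (f : C -> C) (a : nat -> C) (z w : C) (r d : R) :
  geo_bounded a r -> Cmod (w - z)%C < r -> 0 < d ->
  (forall v, Cmod (v - w)%C < d -> f v = CPSeries a (v - z)%C) ->
  C_derive2 f w = CPSeries (CPS_derive (CPS_derive a)) (w - z)%C.
Proof.
  intros Ha Hw Hd Hf.
  assert (H0 := Cmod_ge_0 (w - z)%C).
  set (r' := (Cmod (w - z)%C + r) / 2).
  assert (Hr' : Cmod (w - z)%C < r') by (unfold r'; lra).
  apply (C_derive_CPSeries (C_derive f) (CPS_derive a) z w r' (Rmin (d / 2) (r - Cmod (w - z)%C))).
  - apply geo_bounded_derive with r; [easy|unfold r'; lra].
  - easy.
  - apply Rmin_glb_lt; lra.
  - intros h Hh.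
    assert (Rabs h < d / 2) by (eapply Rlt_le_trans; [exact Hh|apply Rmin_l]).
    assert (Rabs h < r - Cmod (w - z)%C) by (eapply Rlt_le_trans; [exact Hh|apply Rmin_r]).
    apply (C_derive_CPSeries f a z (w + RtoC h) r (d / 2)); [easy| |lra|].
    + replace (w + RtoC h - z)%C with (w - z + RtoC h)%C by ring.
      eapply Rle_lt_trans; [apply Cmod_triangle|]. rewrite Cmod_R. lra.
    + intros k Hk. apply Hf. replace (w + RtoC h + RtoC k - w)%C with (RtoC h + RtoC k)%C by ring.
      eapply Rle_lt_trans; [apply Cmod_triangle|]. rewrite !Cmod_R. lra.
Qed.

Lemma C_derive2_CPSeries_center (f : C -> C) (a : nat -> C) (z : C) (r : R) :
  0 < r -> geo_bounded a r -> (forall v, Cmod (v - z)%C < r -> f v = CPSeries a (v - z)%C) ->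
  C_derive2 f z = (2 * a 2%nat)%C.
Proof.
  intros Hr Ha Hf.
  assert (Hz : (z - z = 0)%C) by ring.
  rewrite (C_derive2_CPSeries f a z z r r) by (easy || (rewrite Hz, Cmod_0; lra)).
  rewrite Hz, (CPSeries_0 _ (r / 4)).
  - unfold CPS_derive. simpl INR. rewrite !RtoC_plus. ring.
  - lra.
  - apply geo_bounded_derive with (r / 2); [|lra]. apply geo_bounded_derive with r; [easy|lra].
Qed.

Lemma analytic_minus_CPSeries (f g : C -> C) (z : C) : analytic_at f z -> analytic_at g z ->
  exists a r, 0 < r /\ geo_bounded a r /\
    (forall w, Cmod (w - z)%C < r -> (f w - g w)%C = CPSeries a (w - z)%C) /\
    (C_derive2 f z - C_derive2 g z = 2 * a 2%nat)%C.
Proof.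
  intros Hf Hg. apply analytic_at_CPSeries in Hf. apply analytic_at_CPSeries in Hg.
  destruct Hf as [a [r [Hr [Ha Hf]]]], Hg as [b [s [Hs [Hb Hg]]]].
  assert (Hm : 0 < Rmin r s) by now apply Rmin_glb_lt.
  assert (Ha' := geo_bounded_radius_le _ _ (Rmin r s) (conj (Rlt_le _ _ Hm) (Rmin_l r s)) Ha).
  assert (Hb' := geo_bounded_radius_le _ _ (Rmin r s) (conj (Rlt_le _ _ Hm) (Rmin_r r s)) Hb).
  exists (fun k => a k - b k)%C, (Rmin r s). split; [easy|]. split; [|split].
  - apply geo_bounded_minus; [lra|easy|easy].
  - intros w Hw. rewrite (CPSeries_minus a b (Rmin r s)) by easy.
    rewrite Hf, Hg; [easy| |].
    + eapply Rlt_le_trans; [exact Hw|apply Rmin_r].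
    + eapply Rlt_le_trans; [exact Hw|apply Rmin_l].
  - rewrite (C_derive2_CPSeries_center f a z r), (C_derive2_CPSeries_center g b z s) by easy. ring.
Qed.

Lemma CPSeries_continuous_0 (a : nat -> C) (r : R) : 0 < r -> geo_bounded a r ->
  exists K e, 0 < e /\ forall h, Cmod h < e -> Cmod (CPSeries a h - a 0%nat)%C <= K * Cmod h.
Proof.
  intros Hr Ha. destruct (CPSeries_Taylor1 a r (r / 2) Ha ltac:(lra)) as [M HM].
  exists (Cmod (CPSeries (CPS_derive a) 0) + M * (r / 2)), (r / 2). split; [lra|]. intros h Hh.
  specialize (HM 0%C h). rewrite Cmod_0, Cplus_0_l, (CPSeries_0 a r) in HM by easy.
  specialize (HM ltac:(lra) ltac:(lra)).
  set (D := CPSeries (CPS_derive a) 0) in *. set (y := CPSeries a h) in *.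
  replace (y - a 0%nat)%C with ((y - a 0%nat - h * D) + h * D)%C by ring.
  eapply Rle_trans; [apply Cmod_triangle|]. rewrite Cmod_mult.
  assert (H0 := Cmod_ge_0 h).
  assert (Cmod h ^ 2 <= r / 2 * Cmod h) by (simpl; rewrite Rmult_1_r; apply Rmult_le_compat_r; lra).
  assert (0 <= M * Cmod h ^ 2) by (eapply Rle_trans; [apply Cmod_ge_0|exact HM]).
  (* The sign of [M] is unknown; a negative [M] is compatible with the estimate only when
     [h = 0]. *)
  destruct (Rle_lt_dec 0 M) as [HM0|HM0].
  - assert (M * Cmod h ^ 2 <= M * (r / 2 * Cmod h)) by (apply Rmult_le_compat_l; lra). lra.
  - assert (HC : 0 <= Cmod h ^ 2) by apply pow2_ge_0.
    assert (Cmod h ^ 2 = 0) by nra.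
    assert (Cmod h = 0) by nra. rewrite H3 in *. lra.
Qed.

Lemma hurwitz_diff_analytic_at (u s : R) (f g : C -> C) : 0 < u < 1 ->
  is_hurwitz_zeta u f -> is_hurwitz_zeta (1 - u) g -> s <> 1 ->
  exists a r, 0 < r /\ geo_bounded a r /\
    (forall w, Cmod (w - RtoC s)%C < r -> (f w - g w)%C = CPSeries a (w - RtoC s)%C) /\
    (C_derive2 f (RtoC s) - C_derive2 g (RtoC s) = 2 * a 2%nat)%C.
Proof.
  intros Hu [_ [Hf _]] [_ [Hg _]] Hs.
  assert (Hs' : RtoC s <> RtoC 1) by (intros E; apply Hs; now injection E).
  apply analytic_minus_CPSeries; [now apply Hf|now apply Hg].
Qed.

(* The real differences [hdiff u s] stay bounded as [s -> 1+], so the difference of the two zeta functions has a removable singularity at 1. *)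
Lemma hurwitz_diff_near_1 (u : R) (f g : C -> C) : 0 < u < 1 ->
  is_hurwitz_zeta u f -> is_hurwitz_zeta (1 - u) g ->
  exists c r, 0 < r /\ geo_bounded (fun k => RtoC (c k)) r /\
    (forall w, Cmod (w - 1)%C < r -> w <> RtoC 1 ->
       (f w - g w)%C = CPSeries (fun k => RtoC (c k)) (w - 1)%C) /\
    (forall h, Rabs h < r -> hdiff u (1 + h) = PSeries c h).
Proof.
  intros Hu Hf Hg.
  destruct (meromorphic_at_CPSeries f _ (proj2 (proj2 Hf))) as [k1 [a1 [r1 [Hr1 [Ha1 H1]]]]].
  destruct (meromorphic_at_CPSeries g _ (proj2 (proj2 Hg))) as [k2 [a2 [r2 [Hr2 [Ha2 H2]]]]].
  destruct (hdiff_analytic u 1 Hu Rlt_0_1) as [e [r3 [Hr3 [He H3]]]].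
  set (r := Rmin (Rmin r1 r2) r3).
  assert (Hr : 0 < r) by (unfold r; repeat apply Rmin_glb_lt; lra).
  assert (r <= r3) by apply Rmin_r.
  assert (Hr12 : r <= Rmin r1 r2) by apply Rmin_l.
  assert (r <= r1) by (eapply Rle_trans; [exact Hr12|apply Rmin_l]).
  assert (r <= r2) by (eapply Rle_trans; [exact Hr12|apply Rmin_r]).
  apply (geo_bounded_radius_le _ _ r) in Ha1, Ha2, He; try lra.
  destruct (CPSeries_shift k2 a1 r Hr Ha1) as [b1 [Hb1 E1]].
  (* The poles have orders at most [k1] and [k2]; multiplying by [(w - 1) ^ (k1 + k2)] clears
     both. *)
  destruct (CPSeries_shift k1 a2 r Hr Ha2) as [b2 [Hb2 E2]].
  set (b := fun k => (b1 k - b2 k)%C).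
  assert (Hb : geo_bounded b r) by (apply geo_bounded_minus; [lra|easy|easy]).
  set (k := (k1 + k2)%nat).
  assert (HF : forall w, Cmod (w - 1)%C < r -> w <> RtoC 1 -> ((w - 1) ^ k * (f w - g w))%C = CPSeries b (w - 1)%C).
  { intros w Hw Hw1. unfold b. rewrite (CPSeries_minus b1 b2 r), E1, E2 by easy.
    rewrite <- H1, <- H2 by (easy || lra). unfold k. rewrite Cpow_add_r. ring. }
  (* To the right of 1 the cleared difference is [h ^ k] times the real analytic expansion of
     [hdiff]. *)
  assert (Hreal : forall h, 0 < h < r -> CPSeries b (RtoC h) = RtoC (h ^ k * PSeries e h)).
  { intros h Hh. replace (RtoC h) with (RtoC (1 + h) - 1)%C by (rewrite RtoC_plus; ring).
    rewrite <- HF.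
    - rewrite (hdiff_gt_1 u) by (easy || lra). rewrite H3 by (rewrite Rabs_pos_eq; lra).
      rewrite RtoC_mult, <- Cpow_RtoC. f_equal. f_equal. rewrite RtoC_plus; ring.
    - replace (RtoC (1 + h) - 1)%C with (RtoC h) by (rewrite RtoC_plus; ring). rewrite Cmod_R, Rabs_pos_eq; lra.
    - intros E. injection E. lra. }
  destruct (PSeries_bounded e r (r / 2) He ltac:(lra)) as [M HM].
  (* Being [O(h ^ k)] from the right, the cleared difference has no term below order [k], so the
     pole cancels. *)
  assert (Hb0 : forall j, (j < k)%nat -> b j = 0%C).
  { intros j Hj. apply injective_projections; simpl.
    - apply (PSeries_order_right k (fun j => Re (b j)) r M (r / 2)); try lra; [apply geo_bounded_Re; [lra|easy]| |easy].
      intros h Hh. rewrite <- Re_CPSeries, Hreal by lra. unfold Re; simpl.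
      rewrite Rabs_mult, (Rabs_pos_eq (h ^ k)), Rmult_comm by (apply pow_le; lra).
      apply Rmult_le_compat_r; [apply pow_le; lra|]. apply HM. rewrite Rabs_pos_eq; lra.
    - apply (PSeries_zero_right (fun j => Im (b j)) r r); try lra; [apply geo_bounded_Im; [lra|easy]|].
      intros h Hh. rewrite <- Im_CPSeries, Hreal by lra. easy. }
  destruct (CPSeries_unshift k b r Hr Hb Hb0) as [c [Hc Ec]].
  assert (Hpow : forall w : C, w <> 0%C -> (w ^ k <> 0)%C).
  { intros w Hw E. apply (f_equal Cmod) in E. rewrite Cmod_pow, Cmod_0 in E.
    revert E. apply pow_nonzero, Rgt_not_eq. now apply Cmod_gt_0. }
  assert (Hce : forall h, 0 < h < r -> CPSeries c (RtoC h) = RtoC (PSeries e h)).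
  { intros h Hh. assert (Hh0 : RtoC h <> 0%C) by (intros E; injection E; lra).
    assert (E := Hreal h Hh). rewrite Ec in E by (rewrite Cmod_R, Rabs_pos_eq; lra).
    rewrite RtoC_mult, <- Cpow_RtoC in E.
    apply (f_equal (fun z => z / (RtoC h ^ k))%C) in E.
    replace (RtoC h ^ k * CPSeries c (RtoC h) / RtoC h ^ k)%C with (CPSeries c (RtoC h)) in E by (field; now apply Hpow).
    rewrite E. field. now apply Hpow. }
  (* The quotient series agrees with the real one on a right neighbourhood, hence coefficient by
     coefficient. *)
  assert (HcR : forall j, Re (c j) = e j).
  { apply (PSeries_eq_right _ _ r r); try easy; [apply geo_bounded_Re; [lra|easy]|].
    intros h Hh. now rewrite <- Re_CPSeries, Hce. }
  assert (HcI : forall j, Im (c j) = 0).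
  { apply (PSeries_zero_right _ r r); try easy; [apply geo_bounded_Im; [lra|easy]|].
    intros h Hh. now rewrite <- Im_CPSeries, Hce. }
  exists e, r. split; [easy|]. split; [easy|]. split.
  - intros w Hw Hw1.
    assert (Hw0 : (w - 1 <> 0)%C).
    { now apply Cminus_neq_0. }
    assert (E := HF w Hw Hw1). rewrite Ec in E by easy.
    apply (f_equal (fun z => z / ((w - 1) ^ k))%C) in E.
    replace ((w - 1) ^ k * CPSeries c (w - 1) / (w - 1) ^ k)%C with (CPSeries c (w - 1)%C) in E by (field; now apply Hpow).
    replace ((w - 1) ^ k * (f w - g w) / (w - 1) ^ k)%C with (f w - g w)%C in E by (field; now apply Hpow).
    rewrite E. apply CSeries_ext. intros j. f_equal.
    rewrite <- HcR. apply injective_projections; [easy|apply HcI].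
  - intros h Hh. apply H3. lra.
Qed.

(** The value of each zeta function at 1 is arbitrary, so the identity theorem is not run across 1:
    the expansion at 1 carries the equality to a left neighbourhood of 1, and analyticity on
    [(0, 1)] extends it down to 0. *)
Lemma hurwitz_diff_real (u s : R) (f g : C -> C) : 0 < u < 1 ->
  is_hurwitz_zeta u f -> is_hurwitz_zeta (1 - u) g -> 0 < s < 1 ->
  (f (RtoC s) - g (RtoC s))%C = RtoC (hdiff u s).
Proof.
  intros Hu Hf Hg Hs.
  destruct (hurwitz_diff_near_1 u f g Hu Hf Hg) as [c [r [Hr [Hc [HF HE]]]]].
  assert (Hnear : forall x, 1 - r < x < 1 -> (f (RtoC x) - g (RtoC x))%C = RtoC (hdiff u x)).
  { intros x Hx.
    assert (Ex : (RtoC x - 1)%C = RtoC (x - 1)) by now rewrite RtoC_minus.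
    rewrite HF, Ex.
    - replace (hdiff u x) with (hdiff u (1 + (x - 1))) by (f_equal; ring).
      rewrite HE by (rewrite Rabs_left; lra).
      apply injective_projections.
      + exact (Re_CPSeries _ _).
      + refine (eq_trans (Im_CPSeries _ _) _). unfold PSeries. simpl.
        rewrite (Series_ext _ (fun _ => 0 * 0)) by (intros; ring). rewrite Series_scal_l; ring.
    - rewrite Ex, Cmod_R, Rabs_left; lra.
    - intros E. injection E. lra. }
  assert (Han : forall x, 0 < x < 1 ->
     real_analytic_at (fun y => Re (f (RtoC y) - g (RtoC y))%C) x /\
     real_analytic_at (fun y => Im (f (RtoC y) - g (RtoC y))%C) x).
  { intros x Hx. destruct (hurwitz_diff_analytic_at u x f g Hu Hf Hg ltac:(lra)) as [a [d [Hd [Ha [E _]]]]].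
    assert (E' : forall h, Rabs h < d -> (f (RtoC (x + h)) - g (RtoC (x + h)))%C = CPSeries a (RtoC h)).
    { intros h Hh. rewrite E; replace (RtoC (x + h) - RtoC x)%C with (RtoC h) by (rewrite RtoC_plus; ring); [easy|].
      now rewrite Cmod_R. }
    split.
    - exists (fun k => Re (a k)), d. split; [easy|]. split; [apply geo_bounded_Re; [lra|easy]|].
      intros h Hh. rewrite E' by easy. apply Re_CPSeries.
    - exists (fun k => Im (a k)), d. split; [easy|]. split; [apply geo_bounded_Im; [lra|easy]|].
      intros h Hh. rewrite E' by easy. apply Im_CPSeries. }
  apply injective_projections.
  - apply Rminus_diag_uniq.
    apply (real_analytic_zero (fun y => Re (f (RtoC y) - g (RtoC y))%C - hdiff u y) 0 (1 - r) 1); try lra.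
    + intros x Hx. apply real_analytic_minus; [now apply Han|apply hdiff_analytic; lra].
    + intros x Hx. rewrite Hnear by easy. unfold Re; simpl. ring.
  - apply (real_analytic_zero (fun y => Im (f (RtoC y) - g (RtoC y))%C) 0 (1 - r) 1); try lra.
    + intros x Hx. now apply Han.
    + intros x Hx. now rewrite Hnear.
Qed.

(** * Second order expansions of the differences at 0 and at 1 *)

(* [g s = c0 + c1 s + c2 s^2 + o(s^2)] as [s -> 0+]; one-sided expansions suffice because the functions involved are known to be analytic. *)
Definition Taylor2 (g : R -> R) (c0 c1 c2 : R) : Prop :=
  filterlim (fun s => (g s - c0 - c1 * s - c2 * s ^ 2) / s ^ 2) (at_right 0) (locally 0).

Lemma at_right_0_lt (d : R) : 0 < d -> at_right 0 (fun s => 0 < s < d).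
Proof.
  intros Hd. exists (mkposreal d Hd). intros y Hy Hy0.
  assert (H : Rabs (y - 0) < d) by exact Hy. rewrite Rminus_0_r, Rabs_pos_eq in H; lra.
Qed.

Lemma filterlim_at_right_0_linear (M : R) : filterlim (fun s => M * s) (at_right 0) (locally 0).
Proof.
  apply (filterlim_R_spec (at_right 0)). intros eps He.
  apply filter_imp with (2 := at_right_0_lt (eps / (Rabs M + 1)) ltac:(apply Rdiv_lt_0_compat; [|assert (H := Rabs_pos M)]; lra)).
  intros s Hs. assert (H := Rabs_pos M). rewrite Rminus_0_r, Rabs_mult, (Rabs_pos_eq s) by lra.
  apply Rle_lt_trans with ((Rabs M + 1) * s).
  - apply Rmult_le_compat_r; lra.
  - replace eps with ((Rabs M + 1) * (eps / (Rabs M + 1))) by (field; lra).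
    apply Rmult_lt_compat_l; lra.
Qed.

Lemma Taylor2_PSeries (g : R -> R) (a : nat -> R) (r : R) : 0 < r ->
  geo_bounded (fun k => RtoC (a k)) r -> (forall s, 0 < s < r -> g s = PSeries a s) ->
  Taylor2 g (a 0%nat) (a 1%nat) (a 2%nat).
Proof.
  intros Hr Ha Hg. unfold Taylor2.
  assert (Ha1 := geo_bounded_incr _ _ Hr Ha). assert (Ha2 := geo_bounded_incr _ _ Hr Ha1).
  assert (Ha3 := geo_bounded_incr _ _ Hr Ha2).
  destruct (PSeries_bounded (fun k => a (S (S (S k)))) r (r / 2) Ha3 ltac:(lra)) as [M HM].
  apply (filterlim_squeeze0 (at_right 0) _ (fun s => M * s)); [|apply filterlim_at_right_0_linear].
  apply filter_imp with (2 := at_right_0_lt (r / 2) ltac:(lra)). intros s Hs.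
  assert (Habs : Rabs s < r) by (rewrite Rabs_pos_eq; lra).
  rewrite Hg, (PSeries_tail a r), (PSeries_tail (fun k => a (S k)) r), (PSeries_tail (fun k => a (S (S k))) r) by (easy || lra).
  specialize (HM s ltac:(rewrite Rabs_pos_eq; lra)).
  set (P := PSeries (fun k => a (S (S (S k)))) s) in *.
  replace ((_ - _ - _ - _) / s ^ 2 - 0) with (P * s) by (field; lra).
  rewrite Rabs_mult, (Rabs_pos_eq s) by lra. apply Rmult_le_compat_r; lra.
Qed.

(** The coefficients at 0 are real because the function is real on a right neighbourhood. [c0] and
    [c1] stay anonymous here; they are identified later from the slope of [hdiff] at 0. *)
Lemma hurwitz_diff_at_0 (u : R) (f g : C -> C) : 0 < u < 1 ->
  is_hurwitz_zeta u f -> is_hurwitz_zeta (1 - u) g ->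
  exists c0 c1 c2, (C_derive2 f 0 - C_derive2 g 0)%C = RtoC (2 * c2) /\ Taylor2 (hdiff u) c0 c1 c2.
Proof.
  intros Hu Hf Hg.
  destruct (hurwitz_diff_analytic_at u 0 f g Hu Hf Hg ltac:(lra)) as [a [r [Hr [Ha [E E2]]]]].
  set (d := Rmin r 1). assert (Hd : 0 < d) by (unfold d; apply Rmin_glb_lt; lra).
  assert (d <= r) by apply Rmin_l. assert (d <= 1) by apply Rmin_r.
  assert (HR : forall s : R, 0 < s < d -> CPSeries a (RtoC s) = RtoC (hdiff u s)).
  { intros s Hs. replace (RtoC s) with (RtoC s - RtoC 0)%C by ring.
    rewrite <- E.
    - apply hurwitz_diff_real; (easy || lra).
    - replace (RtoC s - RtoC 0)%C with (RtoC s) by ring. rewrite Cmod_R, Rabs_pos_eq; lra. }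
  assert (HI : forall j, Im (a j) = 0).
  { apply (PSeries_zero_right _ r d); try easy; [apply geo_bounded_Im; [lra|easy]|].
    intros h Hh. now rewrite <- Im_CPSeries, HR. }
  exists (Re (a 0%nat)), (Re (a 1%nat)), (Re (a 2%nat)). split.
  - rewrite E2. apply injective_projections; simpl.
    + unfold Re. ring.
    + specialize (HI 2%nat). unfold Im in HI. rewrite HI. ring.
  - apply (Taylor2_PSeries _ (fun k => Re (a k)) d); [easy| |].
    + apply geo_bounded_radius_le with r; [lra|]. apply geo_bounded_Re; [lra|easy].
    + intros s Hs. now rewrite <- Re_CPSeries, HR.
Qed.

(** The expansion is taken in [1 - s], the variable in which [hdiff] enters the functional equation;
    the sign changes leave the second coefficient alone. The same coefficient is then found as the
    limit of the second derivatives. *)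
Lemma hurwitz_diff_at_1 (u : R) (f g : C -> C) : 0 < u < 1 ->
  is_hurwitz_zeta u f -> is_hurwitz_zeta (1 - u) g ->
  exists c0 c1 c2, Taylor2 (fun s => hdiff u (1 - s)) c0 c1 c2 /\
    filterlim (fun s : C => (C_derive2 f s - C_derive2 g s)%C) (locally' (RtoC 1)) (locally (RtoC (2 * c2))).
Proof.
  intros Hu Hf Hg.
  destruct (hurwitz_diff_near_1 u f g Hu Hf Hg) as [c [r [Hr [Hc [HF HE]]]]].
  set (c' := fun k => (-1) ^ k * c k).
  assert (Hc' : geo_bounded (fun k => RtoC (c' k)) r).
  { apply geo_bounded_le with (3 := Hc); [lra|]. intros k. rewrite !Cmod_R. unfold c'.
    rewrite Rabs_mult, <- RPow_abs, (Rabs_left (-1)) by lra.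
    replace (- -1) with 1 by ring. rewrite pow1. lra. }
  exists (c' 0%nat), (c' 1%nat), (c' 2%nat). split.
  - apply (Taylor2_PSeries _ c' r); try easy. intros s Hs.
    replace (1 - s) with (1 + - s) by ring.
    rewrite HE by (rewrite Rabs_Ropp, Rabs_pos_eq; lra).
    unfold PSeries. apply Series_ext. intros k. unfold c'.
    replace (- s) with (-1 * s) by ring. rewrite Rpow_mult_distr. ring.
  - replace (RtoC (2 * c' 2%nat)) with (2 * RtoC (c 2%nat))%C.
    2:{ unfold c'. rewrite RtoC_mult. f_equal. f_equal. ring. }
    set (b := fun k => RtoC (c k)).
    assert (HD : geo_bounded (CPS_derive (CPS_derive b)) (r / 4)).
    { apply geo_bounded_derive with (r / 2); [|lra]. apply geo_bounded_derive with r; [easy|lra]. }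
    destruct (CPSeries_continuous_0 _ (r / 4) ltac:(lra) HD) as [K [e [He HK]]].
    assert (HD0 : CPS_derive (CPS_derive b) 0%nat = (2 * RtoC (c 2%nat))%C).
    { unfold CPS_derive, b. simpl INR. rewrite !RtoC_plus. ring. }
    rewrite HD0 in HK.
    assert (HK0 : 0 <= K).
    { specialize (HK (RtoC (e / 2))). rewrite Cmod_R, Rabs_pos_eq in HK by lra.
      specialize (HK ltac:(lra)). apply Rmult_le_reg_r with (e / 2); [lra|].
      rewrite Rmult_0_l. eapply Rle_trans; [apply Cmod_ge_0|exact HK]. }
    intros P [eps HP].
    set (d := Rmin (Rmin e r) (eps / (K + 1))).
    assert (Hd : 0 < d).
    { unfold d. repeat apply Rmin_glb_lt; try lra. apply Rdiv_lt_0_compat; [apply cond_pos|lra]. }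
    assert (HL := Cmod_locally (RtoC 1) d Hd).
    unfold filtermap, locally', within. apply filter_imp with (2 := HL). intros w Hw Hw1.
    assert (Hd1 : d <= Rmin e r) by apply Rmin_l.
    assert (d <= e) by (eapply Rle_trans; [exact Hd1|apply Rmin_l]).
    assert (d <= r) by (eapply Rle_trans; [exact Hd1|apply Rmin_r]).
    assert (d <= eps / (K + 1)) by apply Rmin_r.
    assert (HEq : (C_derive2 f w - C_derive2 g w)%C = CPSeries (CPS_derive (CPS_derive b)) (w - 1)%C).
    (* The expansion at [w] turns the difference of the second derivatives into the second
       derivative of the difference; only the difference has an expansion around 1. *)
    { destruct (analytic_minus_CPSeries f g w (proj1 (proj2 Hf) w Hw1) (proj1 (proj2 Hg) w Hw1)) as [a [t [Ht [Ha [E E2]]]]].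
      rewrite E2, <- (C_derive2_CPSeries_center (fun v => f v - g v)%C a w t) by easy.
      assert (Hpos : 0 < Cmod (w - 1)%C).
      { apply Cmod_gt_0. now apply Cminus_neq_0. }
      (* A disc around [w] of this radius stays inside the disc around 1 and avoids 1 itself. *)
      apply (C_derive2_CPSeries _ b 1 w r (Rmin (Cmod (w - 1)%C) (r - Cmod (w - 1)%C))); [easy|lra|apply Rmin_glb_lt; lra|].
      intros v Hv.
      assert (Cmod (v - w)%C < Cmod (w - 1)%C) by (eapply Rlt_le_trans; [exact Hv|apply Rmin_l]).
      assert (Cmod (v - w)%C < r - Cmod (w - 1)%C) by (eapply Rlt_le_trans; [exact Hv|apply Rmin_r]).
      apply HF.
      - replace (v - 1)%C with (v - w + (w - 1))%C by ring.
        eapply Rle_lt_trans; [apply Cmod_triangle|]. lra.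
      - intros E1. rewrite E1 in H2. replace (1 - w)%C with (- (w - 1))%C in H2 by ring.
        rewrite Cmod_opp in H2. lra. }
    apply HP. rewrite HEq.
    assert (HB : Cmod (CPSeries (CPS_derive (CPS_derive b)) (w - 1)%C - 2 * RtoC (c 2%nat))%C < eps).
    { eapply Rle_lt_trans; [apply HK; lra|].
      apply Rle_lt_trans with ((K + 1) * Cmod (w - 1)%C).
      - apply Rmult_le_compat_r; [apply Cmod_ge_0|lra].
      - replace (pos eps) with ((K + 1) * (eps / (K + 1))) by (field; lra). apply Rmult_lt_compat_l; lra. }
    split.
    + eapply Rle_lt_trans; [apply (Re_le_Cmod (_ - _)%C)|exact HB].
    + eapply Rle_lt_trans; [apply (Im_le_Cmod (_ - _)%C)|exact HB].
Qed.

(** * Improper integrals over the positive half-line *)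

Definition is_RInt_pos (f : R -> R) (l : R) : Prop :=
  is_RInt_gen f (at_right 0) (Rbar_locally p_infty) l.

Definition continuous_pos (f : R -> R) : Prop := forall x, 0 < x -> continuous f x.

Lemma continuous_pos_ex_RInt (f : R -> R) (a b : R) : continuous_pos f -> 0 < a -> 0 < b -> ex_RInt f a b.
Proof.
  intros Hf Ha Hb. apply (ex_RInt_continuous (V := R_CompleteNormedModule)).
  intros z [Hz _]. apply Hf. eapply Rlt_le_trans; [|exact Hz]. now apply Rmin_glb_lt.
Qed.

Lemma is_RInt_pos_intro (f : R -> R) (l : R) : continuous_pos f ->
  (forall eps, 0 < eps -> exists a0 b0, 0 < a0 /\ 0 < b0 /\
     forall a b, 0 < a < a0 -> b0 < b -> Rabs (RInt f a b - l) < eps) ->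
  is_RInt_pos f l.
Proof.
  intros Hf H P [eps HP]. destruct (H eps (cond_pos eps)) as [a0 [b0 [Ha0 [Hb0 Hab]]]].
  apply Filter_prod with (fun a => 0 < a < a0) (fun b => b0 < b).
  - now apply at_right_0_lt.
  - now exists b0.
  - intros a b Ha Hb. exists (RInt f a b). split.
    + apply (RInt_correct (V := R_CompleteNormedModule)). apply continuous_pos_ex_RInt; [easy|lra|simpl; lra].
    + apply HP. now apply Hab.
Qed.

Lemma is_RInt_pos_elim (f : R -> R) (l : R) : is_RInt_pos f l ->
  forall eps, 0 < eps -> exists a0 b0, 0 < a0 /\ 0 < b0 /\
     forall a b, 0 < a < a0 -> b0 < b -> Rabs (RInt f a b - l) < eps.
Proof.
  intros H eps He.
  assert (HB : locally l (fun y : R => Rabs (y - l) < eps)) by (exists (mkposreal _ He); intros y Hy; exact Hy).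
  destruct (H _ HB) as [Q S [d HQ] [M HS] HP].
  exists d, (Rmax M 1). split; [apply cond_pos|]. split; [eapply Rlt_le_trans; [apply Rlt_0_1|apply Rmax_r]|].
  intros a b Ha Hb. destruct (HP a b) as [y [Hy1 Hy2]].
  - apply HQ; [|lra]. change (Rabs (a - 0) < d). rewrite Rminus_0_r, Rabs_pos_eq; lra.
  - apply HS. eapply Rle_lt_trans; [apply Rmax_l|exact Hb].
  - simpl in Hy1. now rewrite (is_RInt_unique _ _ _ _ Hy1).
Qed.

Lemma is_RInt_pos_plus (f g : R -> R) (a b : R) :
  is_RInt_pos f a -> is_RInt_pos g b -> is_RInt_pos (fun t => f t + g t) (a + b).
Proof. intros Hf Hg. exact (is_RInt_gen_plus (V := R_NormedModule) f g a b Hf Hg). Qed.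

Lemma is_RInt_pos_scal (f : R -> R) (k a : R) :
  is_RInt_pos f a -> is_RInt_pos (fun t => k * f t) (k * a).
Proof. intros Hf. exact (is_RInt_gen_scal (V := R_NormedModule) f k a Hf). Qed.

Lemma is_RInt_pos_ext (f g : R -> R) (l : R) :
  (forall t, 0 < t -> f t = g t) -> is_RInt_pos f l -> is_RInt_pos g l.
Proof.
  intros H Hf. refine (is_RInt_gen_ext (V := R_NormedModule) f g l _ Hf).
  apply Filter_prod with (fun a => 0 < a < 1) (fun b => 0 < b).
  - apply at_right_0_lt. lra.
  - now exists 0.
  - intros a b Ha Hb x [Hx _]. apply H. eapply Rlt_trans; [|exact Hx]. simpl. apply Rmin_glb_lt; lra.
Qed.

Lemma is_RInt_pos_minus (f g : R -> R) (a b : R) :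
  is_RInt_pos f a -> is_RInt_pos g b -> is_RInt_pos (fun t => f t - g t) (a - b).
Proof.
  intros Hf Hg. replace (a - b) with (a + -1 * b) by ring.
  apply is_RInt_pos_ext with (fun t => f t + -1 * g t); [intros; ring|].
  apply is_RInt_pos_plus; [easy|]. now apply is_RInt_pos_scal.
Qed.

Lemma is_RInt_pos_sum_n (f : nat -> R -> R) (l : nat -> R) (N : nat) :
  (forall n, is_RInt_pos (f n) (l n)) -> is_RInt_pos (fun t => sum_n (fun n => f n t) N) (sum_n l N).
Proof.
  intros H. induction N as [|N IH].
  - rewrite sum_O. apply is_RInt_pos_ext with (2 := H 0%nat). intros; now rewrite sum_O.
  - rewrite sum_Sn. apply is_RInt_pos_ext with (2 := is_RInt_pos_plus _ _ _ _ IH (H (S N))).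
    intros; now rewrite sum_Sn.
Qed.

Lemma is_RInt_pos_scale (f : R -> R) (c l : R) : 0 < c ->
  is_RInt_pos f l -> is_RInt_pos (fun t => c * f (c * t)) l.
Proof.
  intros Hc H P HP. destruct (H P HP) as [Q S [d HQ] [M HS] HPQ].
  assert (Hd : 0 < d / c) by (apply Rdiv_lt_0_compat; [apply cond_pos|easy]).
  apply Filter_prod with (fun a => 0 < a < d / c) (fun b => M / c < b).
  - now apply at_right_0_lt.
  - now exists (M / c).
  - intros a b Ha Hb.
    assert (Hca : 0 < c * a) by (apply Rmult_lt_0_compat; lra).
    assert (Hca2 : c * a < d) by (replace (pos d) with (c * (d / c)) by (field; lra); apply Rmult_lt_compat_l; lra).
    assert (Hcb : M < c * b) by (replace M with (c * (M / c)) by (field; lra); apply Rmult_lt_compat_l; lra).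
    destruct (HPQ (c * a) (c * b)) as [y [Hy1 Hy2]].
    + apply HQ; [|easy]. change (Rabs (c * a - 0) < d). rewrite Rminus_0_r, Rabs_pos_eq; lra.
    + now apply HS.
    + exists y. split; [|easy]. simpl in *.
      apply (is_RInt_ext (V := R_NormedModule)) with (fun t => scal c (f (c * t + 0))).
      * intros x _. unfold scal; simpl; unfold mult; simpl. now rewrite Rplus_0_r.
      * apply (is_RInt_comp_lin (V := R_NormedModule)). now rewrite !Rplus_0_r.
Qed.

Lemma is_RInt_pos_unique (f : R -> R) (a b : R) : is_RInt_pos f a -> is_RInt_pos f b -> a = b.
Proof.
  intros Ha Hb. unfold is_RInt_pos in *.
  rewrite <- (is_RInt_gen_unique _ _ Ha). apply (is_RInt_gen_unique _ _ Hb).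
Qed.

Lemma is_RInt_pos_abs_le (f g : R -> R) (a b : R) :
  (forall t, 0 < t -> Rabs (f t) <= g t) -> is_RInt_pos f a -> is_RInt_pos g b -> Rabs a <= b.
Proof.
  intros H Hf Hg. apply (RInt_gen_norm (V := R_CompleteNormedModule) (Fa := at_right 0) (Fb := Rbar_locally p_infty) f g a b); try easy.
  - apply Filter_prod with (fun a => 0 < a < 1) (fun b => 1 < b).
    + apply at_right_0_lt. lra.
    + now exists 1.
    + intros x y Hx Hy. simpl. lra.
  - apply Filter_prod with (fun a => 0 < a < 1) (fun b => 1 < b).
    + apply at_right_0_lt. lra.
    + now exists 1.
    + intros x y Hx Hy z [Hz _]. simpl in Hz. apply H. lra.
Qed.

Lemma RInt_enlarge (f : R -> R) (a b a' b' : R) : continuous_pos f -> (forall t, 0 < t -> 0 <= f t) ->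
  0 < a' -> a' <= a -> a <= b -> b <= b' -> RInt f a b <= RInt f a' b'.
Proof.
  intros Hc Hf Ha' Ha Hab Hb.
  assert (E : forall x y, 0 < x -> 0 < y -> ex_RInt f x y) by (intros; now apply continuous_pos_ex_RInt).
  rewrite <- (RInt_Chasles (V := R_CompleteNormedModule) f a' a b') by (apply E; lra).
  rewrite <- (RInt_Chasles (V := R_CompleteNormedModule) f a b b') by (apply E; lra).
  assert (0 <= RInt f a' a) by (apply RInt_ge_0; [lra|apply E; lra|intros; apply Hf; lra]).
  assert (0 <= RInt f b b') by (apply RInt_ge_0; [lra|apply E; lra|intros; apply Hf; lra]).
  unfold plus; simpl. lra.
Qed.

Lemma is_RInt_pos_ge_RInt (f : R -> R) (l a b : R) : continuous_pos f -> (forall t, 0 < t -> 0 <= f t) ->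
  is_RInt_pos f l -> 0 < a -> a <= b -> RInt f a b <= l.
Proof.
  intros Hc Hf Hl Ha Hab. apply Rnot_lt_le. intros Hlt.
  destruct (is_RInt_pos_elim f l Hl (RInt f a b - l) ltac:(lra)) as [a0 [b0 [Ha0 [Hb0 H]]]].
  set (a' := Rmin a (a0 / 2)). set (b' := Rmax b (b0 + 1)).
  assert (0 < a') by (apply Rmin_glb_lt; lra).
  assert (a' <= a) by apply Rmin_l. assert (a' <= a0 / 2) by apply Rmin_r.
  assert (b <= b') by apply Rmax_l. assert (b0 + 1 <= b') by apply Rmax_r.
  specialize (H a' b' ltac:(lra) ltac:(lra)).
  assert (H5 := RInt_enlarge f a b a' b' Hc Hf ltac:(lra) ltac:(lra) Hab ltac:(lra)).
  apply Rabs_def2 in H. lra.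
Qed.

(** For a nonnegative integrand the integrals over [[c / (n + 1), c + n]] increase to a limit, and
    monotonicity squeezes every other large interval between two of these. *)
Lemma is_RInt_pos_of_bounded (f : R -> R) (c B : R) : 0 < c -> continuous_pos f -> (forall t, 0 < t -> 0 <= f t) ->
  (forall a b, 0 < a -> a <= c -> c <= b -> RInt f a b <= B) -> exists l, is_RInt_pos f l /\ 0 <= l <= B.
Proof.
  intros Hc Hcont Hf HB.
  set (u := fun n => RInt f (c / (INR n + 1)) (c + INR n)).
  assert (Hn : forall n, 0 < c / (INR n + 1) <= c).
  { intros n. assert (H := pos_INR n). split; [apply Rdiv_lt_0_compat; lra|].
    apply Rmult_le_reg_r with (INR n + 1); [lra|]. unfold Rdiv. rewrite Rmult_assoc, Rinv_l by lra.
    apply Rmult_le_compat_l; lra. }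
  assert (Hmono : forall n m, (n <= m)%nat -> c / (INR m + 1) <= c / (INR n + 1)).
  { intros n m Hnm. apply le_INR in Hnm. assert (H := pos_INR n). apply Rmult_le_compat_l; [lra|].
    apply Rinv_le_contravar; lra. }
  assert (Hinc : forall n, u n <= u (S n)).
  { intros n. assert (H := pos_INR n). apply RInt_enlarge; try easy.
    - apply Hn.
    - apply Hmono. lia.
    - specialize (Hn n). lra.
    - rewrite S_INR. lra. }
  destruct (ex_finite_lim_seq_incr u B Hinc) as [l Hl].
  { intros n. assert (H := pos_INR n). apply HB; try apply Hn. lra. }
  assert (Hul : forall n, u n <= l) by (intros n; now apply is_lim_seq_incr_compare).
  assert (HlB : l <= B).
  { apply (is_lim_seq_le u (fun _ => B) l B); [|easy|apply is_lim_seq_const].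
    intros n. assert (H := pos_INR n). apply HB; try apply Hn. lra. }
  exists l. split; [|split; [|easy]].
  - apply is_RInt_pos_intro; [easy|]. intros eps He.
    apply is_lim_seq_spec in Hl. destruct (Hl (mkposreal _ He)) as [N HN].
    specialize (HN N (Nat.le_refl N)). simpl in HN. apply Rabs_def2 in HN.
    exists (c / (INR N + 1)), (c + INR N). assert (HN0 := pos_INR N).
    split; [apply Hn|]. split; [lra|]. intros a b Ha Hb.
    assert (H1 : u N <= RInt f a b).
    { apply RInt_enlarge; try easy; try lra. specialize (Hn N). lra. }
    (* Chosen so that [c / (m + 1) <= a] and [b <= c + m]. *)
    destruct (INR_archimed 1 (Rmax (c / a) b) Rlt_0_1) as [m Hm]. rewrite Rmult_1_r in Hm.
    assert (c / a <= Rmax (c / a) b) by apply Rmax_l. assert (b <= Rmax (c / a) b) by apply Rmax_r.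
    assert (H2 : RInt f a b <= u m).
    { apply RInt_enlarge; try easy; try lra; [apply Hn| |].
      - assert (H4 := pos_INR m). apply Rmult_le_reg_r with (INR m + 1); [lra|].
        unfold Rdiv. rewrite Rmult_assoc, Rinv_l, Rmult_1_r by lra.
        apply Rle_trans with (a * (c / a)); [right; field; lra|]. apply Rmult_le_compat_l; lra.
      - specialize (Hn N). lra. }
    specialize (Hul m). apply Rabs_def1; lra.
  - apply Rle_trans with (2 := Hul 0%nat). apply RInt_ge_0.
    + simpl. unfold Rdiv. rewrite Rplus_0_l, Rinv_1. lra.
    + assert (H := pos_INR 0). apply continuous_pos_ex_RInt; [easy|apply Hn|lra].
    + intros t Ht. apply Hf. specialize (Hn 0%nat). lra.
Qed.

Lemma continuous_pos_plus (f g : R -> R) : continuous_pos f -> continuous_pos g -> continuous_pos (fun t => f t + g t).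
Proof. intros Hf Hg x Hx. apply (continuous_plus (V := R_NormedModule) f g); [now apply Hf|now apply Hg]. Qed.

Lemma continuous_pos_mult (f g : R -> R) : continuous_pos f -> continuous_pos g -> continuous_pos (fun t => f t * g t).
Proof. intros Hf Hg x Hx. apply (continuous_mult (K := R_AbsRing) f g); [now apply Hf|now apply Hg]. Qed.

Lemma continuous_pos_derive (f df : R -> R) : (forall x, 0 < x -> is_derive f x (df x)) -> continuous_pos f.
Proof.
  intros H x Hx. apply (ex_derive_continuous (K := R_AbsRing) (V := R_NormedModule)).
  exists (df x). now apply H.
Qed.

Lemma continuous_pos_Rpower (y : R) : continuous_pos (fun t => Rpower t y).
Proof. intros x Hx. now apply continuous_Rpower. Qed.

Lemma is_RInt_Rpower (y a b : R) : y <> 0 -> 0 < a -> 0 < b ->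
  is_RInt (fun t => Rpower t (y - 1)) a b ((Rpower b y - Rpower a y) / y).
Proof.
  intros Hy Ha Hb.
  assert (Hm : forall x, Rmin a b <= x -> 0 < x).
  { intros x Hx. eapply Rlt_le_trans; [|exact Hx]. now apply Rmin_glb_lt. }
  replace ((Rpower b y - Rpower a y) / y) with (minus (Rpower b y / y) (Rpower a y / y))
    by (unfold minus, plus, opp; simpl; field; easy).
  apply (is_RInt_derive (V := R_CompleteNormedModule) (fun t => Rpower t y / y)).
  - intros x [Hx _]. apply Hm in Hx.
    replace (Rpower x (y - 1)) with (/ y * (y * Rpower x (y - 1))) by (field; easy).
    apply (is_derive_ext (fun t => / y * Rpower t y)); [intros; apply Rmult_comm|].
    exact (is_derive_scal (fun t => Rpower t y) x (/ y) _ (is_derive_Rpower y x Hx)).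
  - intros x [Hx _]. apply Hm in Hx. now apply continuous_Rpower.
Qed.

(** [f + g] is nonnegative and at most [2 g], hence integrable; then [g] is subtracted. *)
Lemma is_RInt_pos_dominated (f g : R -> R) (m : R) : continuous_pos f -> continuous_pos g ->
  (forall t, 0 < t -> Rabs (f t) <= g t) -> is_RInt_pos g m ->
  exists l, is_RInt_pos f l /\ Rabs l <= m.
Proof.
  intros Hf Hg H Hm.
  assert (Hfg : continuous_pos (fun t => f t + g t)) by now apply continuous_pos_plus.
  assert (Hg0 : forall t, 0 < t -> 0 <= g t) by (intros t Ht; eapply Rle_trans; [apply Rabs_pos|now apply H]).
  assert (H2m : is_RInt_pos (fun t => 2 * g t) (2 * m)) by now apply is_RInt_pos_scal.
  destruct (is_RInt_pos_of_bounded (fun t => f t + g t) 1 (2 * m) Rlt_0_1 Hfg) as [l [Hl _]].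
  - intros t Ht. specialize (H t Ht). apply Rabs_le_between in H. lra.
  - intros a b Ha Ha1 Hb1.
    apply Rle_trans with (RInt (fun t => 2 * g t) a b).
    + apply RInt_le; [lra| | |].
      * apply continuous_pos_ex_RInt; [easy|lra|lra].
      * apply continuous_pos_ex_RInt; [|lra|lra]. apply continuous_pos_mult; [|easy]. intros x _. apply continuous_const.
      * intros t Ht. specialize (H t ltac:(lra)). apply Rabs_le_between in H. lra.
    + apply is_RInt_pos_ge_RInt; try easy; try lra.
      * apply continuous_pos_mult; [|easy]. intros x _. apply continuous_const.
      * intros t Ht. specialize (Hg0 t Ht). lra.
  - assert (Hfl : is_RInt_pos f (l - m)).
    { apply is_RInt_pos_ext with (fun t => f t + g t - g t); [intros; ring|]. now apply is_RInt_pos_minus. }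
    exists (l - m). split; [easy|]. now apply (is_RInt_pos_abs_le f g).
Qed.

(** Besides existence it gives an explicit bound with a free splitting point [c], which later
    estimates the remainder of an integrated series. *)
Lemma is_RInt_pos_two_powers (f : R -> R) (A B c a b : R) : continuous_pos f ->
  0 < a -> 0 < b -> 0 < c -> 0 <= A -> 0 <= B ->
  (forall t, 0 < t <= c -> Rabs (f t) <= A * Rpower t (a - 1)) ->
  (forall t, c <= t -> Rabs (f t) <= B * Rpower t (- b - 1)) ->
  exists l, is_RInt_pos f l /\ Rabs l <= A * Rpower c a / a + B * Rpower c (- b) / b.
Proof.
  intros Hf Ha Hb Hc HA HB H1 H2.
  assert (Habs : continuous_pos (fun t => Rabs (f t))).
  { intros x Hx. apply (continuous_comp f Rabs); [now apply Hf|]. apply continuous_Rabs. }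
  destruct (is_RInt_pos_of_bounded (fun t => Rabs (f t)) c (A * Rpower c a / a + B * Rpower c (- b) / b)) as [m [Hm Hm2]]; try easy.
  - intros. apply Rabs_pos.
  - intros x y Hx Hxc Hcy.
    assert (E : forall u v, 0 < u -> 0 < v -> ex_RInt (fun t => Rabs (f t)) u v) by (intros; now apply continuous_pos_ex_RInt).
    rewrite <- (RInt_Chasles (V := R_CompleteNormedModule) _ x c y) by (apply E; lra).
    assert (P1 : is_RInt (fun t => A * Rpower t (a - 1)) x c (A * ((Rpower c a - Rpower x a) / a))).
    { apply (is_RInt_scal (V := R_NormedModule)). apply is_RInt_Rpower; lra. }
    assert (P2 : is_RInt (fun t => B * Rpower t (- b - 1)) c y (B * ((Rpower y (- b) - Rpower c (- b)) / (- b)))).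
    { apply (is_RInt_scal (V := R_NormedModule)). apply is_RInt_Rpower; lra. }
    assert (Q1 : RInt (fun t => Rabs (f t)) x c <= A * ((Rpower c a - Rpower x a) / a)).
    { rewrite <- (is_RInt_unique _ _ _ _ P1). apply RInt_le; [lra|apply E; lra|eexists; exact P1|].
      intros t Ht. apply H1. lra. }
    assert (Q2 : RInt (fun t => Rabs (f t)) c y <= B * ((Rpower y (- b) - Rpower c (- b)) / (- b))).
    { rewrite <- (is_RInt_unique _ _ _ _ P2). apply RInt_le; [lra|apply E; lra|eexists; exact P2|].
      intros t Ht. apply H2. lra. }
    assert (R1 : A * ((Rpower c a - Rpower x a) / a) <= A * Rpower c a / a).
    { unfold Rdiv. rewrite <- Rmult_assoc. apply Rmult_le_compat_r; [left; now apply Rinv_0_lt_compat|].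
      apply Rmult_le_compat_l; [easy|]. assert (H := Rpower_pos x a). lra. }
    assert (R2 : B * ((Rpower y (- b) - Rpower c (- b)) / (- b)) <= B * Rpower c (- b) / b).
    { replace (B * ((Rpower y (- b) - Rpower c (- b)) / (- b))) with (B * (Rpower c (- b) - Rpower y (- b)) / b) by (field; lra).
      unfold Rdiv. apply Rmult_le_compat_r; [left; now apply Rinv_0_lt_compat|].
      apply Rmult_le_compat_l; [easy|]. assert (H := Rpower_pos y (- b)). lra. }
    unfold plus; simpl. lra.
  - destruct (is_RInt_pos_dominated f (fun t => Rabs (f t)) m) as [l [Hl1 Hl2]]; try easy.
    exists l. split; [easy|]. lra.
Qed.

Lemma is_RInt_pos_derive (F f : R -> R) (la lb : R) :
  (forall x, 0 < x -> is_derive F x (f x)) -> continuous_pos f ->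
  filterlim F (at_right 0) (locally la) -> filterlim F (Rbar_locally p_infty) (locally lb) ->
  is_RInt_pos f (lb - la).
Proof.
  intros HF Hf Hla Hlb. apply is_RInt_pos_intro; [easy|]. intros eps He.
  assert (H1 := proj1 (filterlim_R_spec (at_right 0) F la) Hla (eps / 2) ltac:(lra)).
  assert (H2 := proj1 (filterlim_R_spec (Rbar_locally p_infty) F lb) Hlb (eps / 2) ltac:(lra)).
  destruct H1 as [d H1]. destruct H2 as [M H2].
  exists d, (Rmax M 1). split; [apply cond_pos|]. split; [eapply Rlt_le_trans; [apply Rlt_0_1|apply Rmax_r]|].
  intros a b Ha Hb.
  assert (M < b) by (eapply Rle_lt_trans; [apply Rmax_l|exact Hb]).
  assert (1 < b) by (eapply Rle_lt_trans; [apply Rmax_r|exact Hb]).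
  assert (Hi : is_RInt f a b (minus (F b) (F a))).
  { apply (is_RInt_derive (V := R_CompleteNormedModule)); intros x [Hx _];
      (assert (0 < x) by (eapply Rlt_le_trans; [|exact Hx]; apply Rmin_glb_lt; lra)); [now apply HF|now apply Hf]. }
  rewrite (is_RInt_unique _ _ _ _ Hi). unfold minus, plus, opp; simpl.
  assert (A1 : Rabs (F a - la) < eps / 2).
  { apply H1; [|lra]. change (Rabs (a - 0) < d). rewrite Rminus_0_r, Rabs_pos_eq; lra. }
  assert (A2 := H2 b H).
  apply Rabs_def2 in A1. apply Rabs_def2 in A2. apply Rabs_def1; lra.
Qed.

(** * The Gamma function *)

Lemma exp_le_compat (x y : R) : x <= y -> exp x <= exp y.
Proof. intros [H| ->]; [left; now apply exp_increasing|apply Rle_refl]. Qed.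

Lemma Rpower_le_exp (x : R) : exists B, 0 < B /\ forall t, 1 <= t -> Rpower t x <= B * exp t.
Proof.
  destruct (INR_archimed 1 x Rlt_0_1) as [n Hn]. rewrite Rmult_1_r in Hn.
  exists (INR (Factorial.fact n)). split; [apply INR_fact_lt_0|]. intros t Ht.
  apply Rle_trans with (t ^ n).
  - rewrite <- Rpower_pow by lra. apply Rle_Rpower; lra.
  - assert (H := pow_fact_le_exp t n ltac:(lra)). assert (HF := INR_fact_lt_0 n).
    replace (t ^ n) with (INR (Factorial.fact n) * (t ^ n / INR (Factorial.fact n))) by (field; lra).
    apply Rmult_le_compat_l; lra.
Qed.

(** Beyond 1, [t ^ (x + 1) <= B exp t] leaves [B t ^ - 2], whatever [x] is. *)
Lemma Gamma_integrand_bounds (x : R) : exists B, 0 <= B /\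
  (forall t, 0 < t <= 1 -> Rabs (Rpower t (x - 1) * exp (- t)) <= 1 * Rpower t (x - 1)) /\
  (forall t, 1 <= t -> Rabs (Rpower t (x - 1) * exp (- t)) <= B * Rpower t (- 1 - 1)).
Proof.
  destruct (Rpower_le_exp (x + 1)) as [B [HB H]]. exists B. split; [lra|]. split.
  - intros t Ht. assert (Hr := Rpower_pos t (x - 1)). assert (He := exp_pos (- t)).
    rewrite Rabs_pos_eq by (apply Rmult_le_pos; lra). rewrite Rmult_1_l.
    rewrite <- (Rmult_1_r (Rpower t (x - 1))) at 2. apply Rmult_le_compat_l; [lra|].
    rewrite <- exp_0. apply exp_le_compat. lra.
  - intros t Ht. assert (Hr := Rpower_pos t (x - 1)). assert (He := exp_pos (- t)).
    rewrite Rabs_pos_eq by (apply Rmult_le_pos; lra).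
    replace (x - 1) with (x + 1 + (- 1 - 1)) by ring. rewrite Rpower_plus.
    specialize (H t Ht). assert (Hm := Rpower_pos t (-1 - 1)).
    replace (Rpower t (x + 1) * Rpower t (-1 - 1) * exp (- t)) with (Rpower t (x + 1) * exp (- t) * Rpower t (-1 - 1)) by ring.
    apply Rmult_le_compat_r; [lra|].
    replace B with (B * exp t * exp (- t)).
    + apply Rmult_le_compat_r; lra.
    + rewrite Rmult_assoc, <- exp_plus, Rplus_opp_r, exp_0. ring.
Qed.

Lemma continuous_pos_Gamma_integrand (x : R) : continuous_pos (fun t => Rpower t (x - 1) * exp (- t)).
Proof.
  apply (continuous_pos_mult (fun t => Rpower t (x - 1)) (fun t => exp (- t))); [apply continuous_pos_Rpower|].
  apply (continuous_pos_derive _ (fun t => - exp (- t))). intros y _. auto_derive; [easy|]. ring.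
Qed.

Lemma is_RInt_pos_Gamma (x : R) : 0 < x ->
  is_RInt_pos (fun t => Rpower t (x - 1) * exp (- t)) (Gamma x).
Proof.
  intros Hx. destruct (Gamma_integrand_bounds x) as [B [HB [H1 H2]]].
  destruct (is_RInt_pos_two_powers _ 1 B 1 x 1 (continuous_pos_Gamma_integrand x) Hx Rlt_0_1 Rlt_0_1 Rle_0_1 HB H1 H2) as [l [Hl _]].
  unfold Gamma. assert (E := is_RInt_gen_unique _ _ Hl). cbv beta in E. rewrite E. exact Hl.
Qed.

Lemma Gamma_pos (x : R) : 0 < x -> 0 < Gamma x.
Proof.
  intros Hx. apply Rlt_le_trans with (RInt (fun t => Rpower t (x - 1) * exp (- t)) 1 2).
  - apply RInt_gt_0; [lra| |].
    + intros t _. apply Rmult_lt_0_compat; apply exp_pos.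
    + intros t Ht. apply (continuous_pos_Gamma_integrand x). lra.
  - apply is_RInt_pos_ge_RInt; try lra.
    + apply continuous_pos_Gamma_integrand.
    + intros t _. apply Rmult_le_pos; left; apply exp_pos.
    + now apply is_RInt_pos_Gamma.
Qed.

Lemma filterlim_Rpower_0 (x : R) : 0 < x -> filterlim (fun t => Rpower t x) (at_right 0) (locally 0).
Proof.
  intros Hx. apply (filterlim_R_spec (at_right 0)). intros eps He.
  apply filter_imp with (2 := at_right_0_lt (Rpower eps (/ x)) (Rpower_pos _ _)).
  intros t Ht. rewrite Rminus_0_r, Rabs_pos_eq by apply Rlt_le, Rpower_pos.
  replace eps with (Rpower (Rpower eps (/ x)) x).
  - now apply Rlt_Rpower_l.
  - rewrite Rpower_mult, Rinv_l, Rpower_1; lra.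
Qed.

(** Integration by parts: the integral of the derivative of [t ^ x exp (- t)] is 0, since this
    function tends to 0 at both ends. *)
Lemma Gamma_S (x : R) : 0 < x -> Gamma (x + 1) = x * Gamma x.
Proof.
  intros Hx.
  assert (HG := is_RInt_pos_Gamma x Hx). assert (HG1 := is_RInt_pos_Gamma (x + 1) ltac:(lra)).
  assert (HD : is_RInt_pos (fun t => x * (Rpower t (x - 1) * exp (- t)) - Rpower t (x + 1 - 1) * exp (- t)) (0 - 0)).
  { apply (is_RInt_pos_derive (fun t => Rpower t x * exp (- t))).
    - intros t Ht. replace (x + 1 - 1) with x by ring.
      assert (He : is_derive (fun t => exp (- t)) t (- exp (- t))) by (auto_derive; [easy|ring]).
      evar_last.
      { exact (is_derive_mult (fun t => Rpower t x) (fun t => exp (- t)) t _ _ (is_derive_Rpower x t Ht) He (fun n m => Rmult_comm n m)). }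
      unfold plus, mult; simpl. ring.
    - intros t Ht.
      apply (continuous_minus (V := R_NormedModule) (fun t => x * (Rpower t (x - 1) * exp (- t))) (fun t => Rpower t (x + 1 - 1) * exp (- t))).
      + apply (continuous_scal_r (V := R_NormedModule) x (fun t => Rpower t (x - 1) * exp (- t))). now apply continuous_pos_Gamma_integrand.
      + now apply continuous_pos_Gamma_integrand.
    - apply (filterlim_squeeze0 (at_right 0) _ (fun t => Rpower t x)).
      + apply filter_imp with (2 := at_right_0_lt 1 Rlt_0_1). intros t Ht.
        assert (Hr := Rpower_pos t x). assert (He := exp_pos (- t)).
        rewrite Rminus_0_r, Rabs_pos_eq by (apply Rmult_le_pos; lra).
        rewrite <- (Rmult_1_r (Rpower t x)) at 2. apply Rmult_le_compat_l; [lra|].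
        rewrite <- exp_0. apply exp_le_compat. lra.
      + now apply filterlim_Rpower_0.
    - destruct (Rpower_le_exp (x + 1)) as [B [HB HP]].
      apply (filterlim_squeeze0 (Rbar_locally p_infty) _ (fun t => B * Rpower t (- (1)))).
      + exists 1. intros t Ht. specialize (HP t ltac:(lra)). rewrite Rpower_plus, Rpower_1 in HP by lra.
        assert (Hr := Rpower_pos t x). assert (He := exp_pos (- t)).
        rewrite Rminus_0_r, Rabs_pos_eq by (apply Rmult_le_pos; lra).
        rewrite Rpower_Ropp, Rpower_1 by lra.
        apply Rmult_le_reg_r with t; [lra|]. rewrite (Rmult_assoc B), Rinv_l, Rmult_1_r by lra.
        replace B with (B * exp t * exp (- t)) by (rewrite Rmult_assoc, <- exp_plus, Rplus_opp_r, exp_0; ring).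
        replace (Rpower t x * exp (- t) * t) with (Rpower t x * t * exp (- t)) by ring.
        apply Rmult_le_compat_r; lra.
      + replace 0 with (B * 0) at 1 by ring. apply (filterlim_R_mult (Rbar_locally p_infty)); [apply filterlim_const|].
        exact (is_lim_Rpower_neg 1 Rlt_0_1). }
  assert (HD' := is_RInt_pos_minus _ _ _ _ (is_RInt_pos_scal _ x _ HG) HG1).
  assert (E := is_RInt_pos_unique _ _ _ HD HD'). lra.
Qed.

Lemma Gamma_1 : Gamma 1 = 1.
Proof.
  assert (HG := is_RInt_pos_Gamma 1 Rlt_0_1).
  assert (HD : is_RInt_pos (fun t => exp (- t)) (0 - - exp (- 0))).
  { apply (is_RInt_pos_derive (fun t => - exp (- t))).
    - intros t Ht. auto_derive; [easy|]. ring.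
    - apply (continuous_pos_derive _ (fun t => - exp (- t))). intros y _. auto_derive; [easy|]. ring.
    - assert (HC : continuous (fun t => - exp (- t)) 0).
      { apply (ex_derive_continuous (K := R_AbsRing) (V := R_NormedModule)). auto_derive. easy. }
      intros P HP. destruct (HC P HP) as [d Hd]. exists d. intros y Hy _. now apply Hd.
    - replace 0 with (- 0) by ring. apply (filterlim_R_opp (Rbar_locally p_infty)).
      apply (is_lim_comp exp (fun t => - t) p_infty (Finite 0) m_infty).
      + apply is_lim_exp_m.
      + apply (is_lim_opp (fun t => t) p_infty p_infty). apply is_lim_id.
      + now exists 0. }
  rewrite Ropp_0, exp_0 in HD. replace (0 - - (1)) with 1 in HD by ring.
  apply (is_RInt_pos_unique _ _ _ HG). apply is_RInt_pos_ext with (2 := HD).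
  intros t Ht. rewrite Rminus_diag, Rpower_O by easy. ring.
Qed.

(** Convexity of [exp] between 0 and [a], obtained from its tangent at [v a], which is the
    inequality [1 + y <= exp y] used twice. *)
Lemma exp_weighted_le (v a : R) : 0 <= v <= 1 -> exp (v * a) <= 1 - v + v * exp a.
Proof.
  intros Hv. assert (H1 := exp_ineq1_le (a * (1 - v))). assert (H2 := exp_ineq1_le (- (v * a))).
  assert (He := exp_pos (v * a)).
  replace (exp a) with (exp (a * (1 - v)) * exp (v * a)) by (rewrite <- exp_plus; f_equal; ring).
  replace (1 - v) with ((1 - v) * (exp (- (v * a)) * exp (v * a))) at 1
    by (rewrite <- exp_plus; replace (- (v * a) + v * a) with 0 by ring; rewrite exp_0; ring).
  rewrite <- (Rmult_1_l (exp (v * a))) at 1.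
  replace ((1 - v) * (exp (- (v * a)) * exp (v * a)) + v * (exp (a * (1 - v)) * exp (v * a)))
    with (((1 - v) * exp (- (v * a)) + v * exp (a * (1 - v))) * exp (v * a)) by ring.
  apply Rmult_le_compat_r; [lra|].
  assert ((1 - v) * (1 + - (v * a)) <= (1 - v) * exp (- (v * a))) by (apply Rmult_le_compat_l; lra).
  assert (v * (1 + a * (1 - v)) <= v * exp (a * (1 - v))) by (apply Rmult_le_compat_l; lra).
  lra.
Qed.

(* Integrate Young's inequality [t^v <= (1 - v) x^v + v x^(v - 1) t] against the Gamma density. *)
Lemma Gamma_plus_le (x v : R) : 0 < x -> 0 <= v <= 1 -> Gamma (x + v) <= Rpower x v * Gamma x.
Proof.
  intros Hx Hv.
  assert (HG := is_RInt_pos_Gamma x Hx). assert (HG1 := is_RInt_pos_Gamma (x + 1) ltac:(lra)).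
  assert (HGv := is_RInt_pos_Gamma (x + v) ltac:(lra)).
  assert (HS := is_RInt_pos_plus _ _ _ _ (is_RInt_pos_scal _ ((1 - v) * Rpower x v) _ HG)
                  (is_RInt_pos_scal _ (v * Rpower x v / x) _ HG1)).
  eapply Rle_trans; [apply Rle_abs|]. eapply Rle_trans.
  - apply (is_RInt_pos_abs_le _ _ _ _) with (2 := HGv) (3 := HS). intros t Ht. cbv beta.
    assert (Hr := Rpower_pos t (x + v - 1)). assert (He := exp_pos (- t)).
    rewrite Rabs_pos_eq by (apply Rmult_le_pos; lra).
    replace (x + v - 1) with (v + (x - 1)) by ring. rewrite Rpower_plus.
    replace (x + 1 - 1) with (1 + (x - 1)) by ring. rewrite Rpower_plus, Rpower_1 by easy.
    assert (Hr' := Rpower_pos t (x - 1)). set (T := Rpower t (x - 1)) in *.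
    assert (HY : Rpower t v <= Rpower x v * (1 - v + v * (t / x))).
    { assert (Htx : 0 < t / x) by now apply Rdiv_lt_0_compat.
      assert (HW := exp_weighted_le v (ln (t / x)) Hv). rewrite exp_ln in HW by easy.
      replace t with (x * (t / x)) at 1 by (field; lra). rewrite <- Rpower_mult_distr by easy.
      apply Rmult_le_compat_l; [left; apply Rpower_pos|exact HW]. }
    replace ((1 - v) * Rpower x v * (T * exp (- t)) + v * Rpower x v / x * (t * T * exp (- t)))
      with (Rpower x v * (1 - v + v * (t / x)) * (T * exp (- t))) by (field; lra).
    rewrite Rmult_assoc. apply Rmult_le_compat_r; [apply Rmult_le_pos; lra|easy].
  - rewrite Gamma_S by easy. right. field. lra.
Qed.

Lemma ln_Gamma_S (x : R) : 0 < x -> ln (Gamma (x + 1)) = ln (Gamma x) + ln x.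
Proof.
  intros Hx. rewrite Gamma_S, ln_mult by (easy || now apply Gamma_pos). ring.
Qed.

(** The upper bound is [Gamma_plus_le] at [(x, v)]. The lower bound is the same inequality at
    [(x + v, 1 - v)], which lands on [x + 1]; replacing [ln (x + v)] by [ln x] costs at most
    [1 / x]. *)
Lemma ln_Gamma_plus_bounds (x v : R) : 0 < x -> 0 <= v <= 1 ->
  - / x <= ln (Gamma (x + v)) - ln (Gamma x) - v * ln x <= 0.
Proof.
  intros Hx Hv. assert (G0 := Gamma_pos x Hx). assert (Gv := Gamma_pos (x + v) ltac:(lra)).
  assert (G1 := Gamma_pos (x + 1) ltac:(lra)). split.
  - assert (H := Gamma_plus_le (x + v) (1 - v) ltac:(lra) ltac:(lra)).
    replace (x + v + (1 - v)) with (x + 1) in H by ring.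
    apply ln_le in H; [|easy]. rewrite ln_Gamma_S, ln_mult, ln_Rpower in H by (easy || apply Rpower_pos).
    assert (Hl : ln (x + v) - ln x <= v / x).
    { rewrite <- ln_div by lra. replace ((x + v) / x) with (1 + v / x) by (field; lra).
      assert (Hvx : 0 <= v / x) by (apply Rdiv_le_0_compat; lra).
      rewrite <- (ln_exp (v / x)) at 2. apply ln_le; [lra|]. apply exp_ineq1_le. }
    assert (Hp : 0 < / x) by now apply Rinv_0_lt_compat.
    assert ((1 - v) * (ln (x + v) - ln x) <= / x).
    { apply Rle_trans with ((1 - v) * (v / x)); [apply Rmult_le_compat_l; lra|].
      unfold Rdiv. rewrite <- Rmult_assoc. rewrite <- (Rmult_1_l (/ x)) at 2. apply Rmult_le_compat_r; nra. }
    lra.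
  - assert (H := Gamma_plus_le x v Hx Hv). apply ln_le in H; [|easy].
    rewrite ln_mult, ln_Rpower in H by (easy || apply Rpower_pos). lra.
Qed.

Lemma ln_Gamma_sum (x : R) (N : nat) : 0 < x ->
  ln (Gamma (INR (S N) + x)) = ln (Gamma x) + sum_n (fun n => ln (INR n + x)) N.
Proof.
  intros Hx. induction N as [|N IH].
  - rewrite sum_O. simpl INR. rewrite (Rplus_comm 1 x), ln_Gamma_S by easy. f_equal. f_equal. ring.
  - rewrite sum_Sn. replace (INR (S (S N)) + x) with (INR (S N) + x + 1) by (rewrite (S_INR (S N)); ring).
    rewrite ln_Gamma_S, IH; [unfold plus; simpl; ring|]. assert (H := pos_INR (S N)). lra.
Qed.

(** The logarithmic form of Gauss's limit for Gamma. *)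
Lemma is_lim_seq_ln_Gamma (v : R) : 0 <= v <= 1 ->
  is_lim_seq (fun N => ln (Gamma (INR (S N) + v)) - ln (Gamma (INR (S N))) - v * ln (INR (S N))) 0.
Proof.
  intros Hv. apply (filterlim_squeeze0 eventually _ (fun N => / INR (S N))).
  - exists 0%nat. intros N _. rewrite Rminus_0_r.
    assert (HN : 0 < INR (S N)) by (apply lt_0_INR; lia).
    assert (H := ln_Gamma_plus_bounds (INR (S N)) v HN Hv).
    apply Rabs_le. lra.
  - assert (H : is_lim_seq (fun n => / INR n) 0).
    { apply (is_lim_seq_inv _ p_infty); [apply is_lim_seq_INR|easy]. }
    exact (proj1 (is_lim_seq_incr_1 _ _) H).
Qed.

(** * First and second order expansions at zero *)

(** Restates an equality in the carrier of an algebraic structure as one in [R], the form expected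
    by [ring] and [lra]. *)
Ltac eq_in_R := match goal with |- @eq _ ?a ?b => change (@eq R a b) end.

Lemma filterlim_Rpower_slope (x : R) : filterlim (fun s => (Rpower x (- s) - 1) / s) (at_right 0) (locally (- ln x)).
Proof.
  assert (H : is_derive (fun s => Rpower x (- s)) 0 (- ln x)).
  { unfold Rpower. auto_derive; [easy|]. rewrite Ropp_0, Rmult_0_l, exp_0. ring. }
  apply is_derive_Reals in H. apply (filterlim_R_spec (at_right 0)). intros eps He.
  destruct (H eps He) as [d Hd]. apply filter_imp with (2 := at_right_0_lt d (cond_pos d)).
  intros s Hs. specialize (Hd s ltac:(lra) ltac:(rewrite Rabs_pos_eq; lra)).
  rewrite Rplus_0_l in Hd. replace (Rpower x (- 0)) with 1 in Hd; [easy|].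
  unfold Rpower. now rewrite Ropp_0, Rmult_0_l, exp_0.
Qed.

Lemma Rpower_diff_MVT (s a b m : R) : 0 < m -> m <= a -> m <= b ->
  exists c, Rmin a b <= c <= Rmax a b /\ Rpower a (- s) - Rpower b (- s) = s * Rpower c (- s - 1) * (b - a).
Proof.
  intros Hm Ha Hb. assert (H : m <= Rmin a b) by now apply Rmin_glb.
  destruct (MVT_gen (fun x => Rpower x (- s)) a b (fun x => - s * Rpower x (- s - 1))) as [c [Hc E]].
  - intros x Hx. apply is_derive_Rpower. lra.
  - intros x Hx. apply continuity_pt_filterlim, continuous_Rpower. lra.
  - exists c. split; [easy|]. lra.
Qed.

(* The telescoping correction [(n + 1)^-s - (n + 2)^-s], whose sum over [n] is 1 for every [s], makes the terms [O(s / n^2)] uniformly in [s]. *)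
Lemma hdiff_slope_term_bound (u m s : R) (n : nat) : 0 < m -> m <= u -> m <= 1 - u -> 0 < s < 1 ->
  Rabs ((Rpower (INR n + u) (- s) - Rpower (INR n + 1 - u) (- s)
    - (1 - 2 * u) * (Rpower (INR n + 1) (- s) - Rpower (INR n + 2) (- s))) / s)
  <= 4 / m * Rpower (INR n + m) (- 1 - 1).
Proof.
  intros Hm Hmu Hmu' Hs. assert (Hn := pos_INR n).
  destruct (Rpower_diff_MVT s (INR n + u) (INR n + 1 - u) (INR n + m)) as [x [Hx Ex]]; try lra.
  destruct (Rpower_diff_MVT s (INR n + 1) (INR n + 2) (INR n + m)) as [y [Hy Ey]]; try lra.
  rewrite Ex, Ey.
  (* Both differences carry the same factor [s (1 - 2u)], so after division by [s] a difference of
     two powers [- s - 1] remains, to which the mean value theorem applies once more. *)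
  replace ((s * Rpower x (- s - 1) * (INR n + 1 - u - (INR n + u)) -
     (1 - 2 * u) * (s * Rpower y (- s - 1) * (INR n + 2 - (INR n + 1)))) / s)
    with ((1 - 2 * u) * (Rpower x (- s - 1) - Rpower y (- s - 1))) by (field; lra).
  assert (Hx1 : INR n + m <= x).
  { eapply Rle_trans; [|apply Hx]. apply Rmin_glb; lra. }
  assert (Hx2 : x <= INR n + 1).
  { eapply Rle_trans; [apply Hx|]. apply Rmax_lub; lra. }
  rewrite Rmin_left, Rmax_right in Hy by lra.
  assert (HK : Rabs (Rpower x (- s - 1) - Rpower y (- s - 1)) <= 2 / m * Rpower (INR n + m) (- 1 - 1) * Rabs (x - y)).
  { apply (MVT_ge (fun x => Rpower x (- s - 1)) (fun x => (- s - 1) * Rpower x (- s - 1 - 1)) (INR n + m)); try lra.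
    - intros z Hz. apply is_derive_Rpower. lra.
    - intros z Hz. rewrite Rabs_mult, (Rabs_pos_eq (Rpower _ _)) by apply Rlt_le, Rpower_pos.
      rewrite (Rabs_left (- s - 1)) by lra.
      replace (- s - 1 - 1) with (- (1) + (- (s + 1))) by ring.
      assert (Hz1 : Rpower z (- (1) + - (s + 1)) <= Rpower (INR n + m) (- (1) + - (s + 1))).
      (* The factor [(n + m) ^ - s] is at most [m ^ - s <= 1 / m], since [m <= 1] and [s < 1]; this
         is the [1 / m] in the bound. *)
      { replace (- (1) + - (s + 1)) with (- (s + 2)) by ring. apply Rpower_antitone; lra. }
      assert (Hz2 : Rpower (INR n + m) (- (1) + - (s + 1)) <= / m * Rpower (INR n + m) (- 1 - 1)).
      { replace (- (1) + - (s + 1)) with (- s + (- 1 - 1)) by ring. rewrite Rpower_plus.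
        apply Rmult_le_compat_r; [left; apply Rpower_pos|].
        apply Rle_trans with (Rpower m (- s)); [apply Rpower_antitone; lra|].
        rewrite <- (Rpower_1 m) at 2 by easy. rewrite <- Rpower_Ropp.
        rewrite !Rpower_Ropp, Rpower_1 by easy. apply Rinv_le_contravar; [easy|].
        rewrite <- (Rpower_1 m) at 1 by easy. unfold Rpower. apply exp_le_compat.
        assert (ln m <= 0) by (rewrite <- ln_1; apply ln_le; lra). nra. }
      assert (Hpz := Rpower_pos z (- (1) + - (s + 1))).
      replace (2 / m * Rpower (INR n + m) (-1 - 1)) with (2 * (/ m * Rpower (INR n + m) (-1 - 1))) by (field; lra).
      nra. }
  rewrite Rabs_mult.
  assert (H1 : Rabs (1 - 2 * u) <= 1) by (apply Rabs_le; lra).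
  assert (H2 : Rabs (x - y) <= 2) by (apply Rabs_le; lra).
  assert (H3 := Rabs_pos (1 - 2 * u)). assert (H4 := Rabs_pos (Rpower x (- s - 1) - Rpower y (- s - 1))).
  assert (H5 : 0 <= 2 / m * Rpower (INR n + m) (- 1 - 1)).
  { apply Rmult_le_pos; [apply Rdiv_le_0_compat; lra|left; apply Rpower_pos]. }
  apply Rle_trans with (1 * (2 / m * Rpower (INR n + m) (- 1 - 1) * 2)).
  - apply Rmult_le_compat; try easy. eapply Rle_trans; [exact HK|]. now apply Rmult_le_compat_l.
  - right. field. lra.
Qed.

Lemma is_lim_seq_ln_succ : is_lim_seq (fun N => ln (INR N + 2) - ln (INR N + 1)) 0.
Proof.
  apply (filterlim_squeeze0 eventually _ (fun N => / INR (S N))).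
  - exists 0%nat. intros N _. rewrite Rminus_0_r, S_INR.
    assert (HN := pos_INR N). rewrite <- ln_div by lra.
    assert (Hi : 0 < / (INR N + 1)) by (apply Rinv_0_lt_compat; lra).
    replace ((INR N + 2) / (INR N + 1)) with (1 + / (INR N + 1)) by (field; lra).
    rewrite Rabs_pos_eq by (rewrite <- ln_1; apply ln_le; lra).
    rewrite <- (ln_exp (/ (INR N + 1))) at 2. apply ln_le; [lra|]. apply exp_ineq1_le.
  - assert (H : is_lim_seq (fun n => / INR n) 0).
    { apply (is_lim_seq_inv _ p_infty); [apply is_lim_seq_INR|easy]. }
    exact (proj1 (is_lim_seq_incr_1 _ _) H).
Qed.

(** By [ln_Gamma_sum] the partial sums are values of [ln Gamma] at [N + 1 + u] and [N + 2 - u], up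
    to the constant claimed. Gauss's limit makes their difference asymptotic to
    [(1 - 2u) ln (N + 1)], which the telescoped logarithms compensate. *)
Lemma is_series_hdiff_slope (u : R) : 0 < u < 1 ->
  is_series (fun n => ln (INR n + 1 - u) - ln (INR n + u) - (1 - 2 * u) * (ln (INR n + 2) - ln (INR n + 1)))
    (ln (Gamma u) - ln (Gamma (1 - u))).
Proof.
  intros Hu. unfold is_series.
  assert (H1 := is_lim_seq_ln_Gamma u ltac:(lra)). assert (H2 := is_lim_seq_ln_Gamma (1 - u) ltac:(lra)).
  assert (H3 := filterlim_R_mult eventually (fun _ => 1 - 2 * u) _ (1 - 2 * u) 0 (filterlim_const _) is_lim_seq_ln_succ).
  assert (H := filterlim_R_minus eventually _ _ _ _ (filterlim_R_minus eventually _ _ _ _ H2 H1) H3).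
  assert (H' := filterlim_R_plus eventually _ _ _ _ H (filterlim_const (ln (Gamma u) - ln (Gamma (1 - u))))).
  replace (0 - 0 - (1 - 2 * u) * 0 + (ln (Gamma u) - ln (Gamma (1 - u)))) with (ln (Gamma u) - ln (Gamma (1 - u))) in H' by ring.
  apply filterlim_ext with (2 := H'). intros N. cbv beta.
  rewrite !ln_Gamma_sum by lra. rewrite S_INR.
  induction N as [|N IH].
  - rewrite !sum_O. simpl INR. replace (0 + 1 - u) with (0 + (1 - u)) by ring.
    replace (0 + 1) with 1 by ring. rewrite ln_1. ring.
  - rewrite !sum_Sn, <- IH, !S_INR. unfold plus; simpl.
    replace (INR N + 1 + 1 - u) with (INR N + 1 + (1 - u)) by ring.
    replace (INR N + 1 + 2) with (INR N + 3) by ring. replace (INR N + 1 + 1) with (INR N + 2) by ring. ring.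
Qed.

(** Termwise derivation at [s = 0] of the corrected series, by Tannery's theorem; the correction
    itself sums to the constant [1 - 2u]. *)
Lemma hdiff_slope_0 (u : R) : 0 < u < 1 ->
  filterlim (fun s => (hdiff u s - (1 - 2 * u)) / s) (at_right 0) (locally (ln (Gamma u) - ln (Gamma (1 - u)))).
Proof.
  intros Hu. set (m := Rmin u (1 - u)).
  assert (Hm : 0 < m) by (apply Rmin_glb_lt; lra).
  set (T := fun s n => (Rpower (INR n + u) (- s) - Rpower (INR n + 1 - u) (- s)
    - (1 - 2 * u) * (Rpower (INR n + 1) (- s) - Rpower (INR n + 2) (- s))) / s).
  set (b := fun n => ln (INR n + 1 - u) - ln (INR n + u) - (1 - 2 * u) * (ln (INR n + 2) - ln (INR n + 1))).
  destruct (filterlim_Series (at_right 0) T b (fun n => 4 / m * Rpower (INR n + m) (- 1 - 1))) as [_ H].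
  - intros n.
    assert (L := fun x => filterlim_Rpower_slope x).
    assert (H1 := filterlim_R_minus (at_right 0) _ _ _ _ (L (INR n + u)) (L (INR n + 1 - u))).
    assert (H2 := filterlim_R_minus (at_right 0) _ _ _ _ (L (INR n + 1)) (L (INR n + 2))).
    assert (H3 := filterlim_R_mult (at_right 0) (fun _ => 1 - 2 * u) _ _ _ (filterlim_const _) H2).
    assert (H4 := filterlim_R_minus (at_right 0) _ _ _ _ H1 H3).
    replace (b n) with (- ln (INR n + u) - - ln (INR n + 1 - u) - (1 - 2 * u) * (- ln (INR n + 1) - - ln (INR n + 2)))
      by (unfold b; ring).
    apply filterlim_ext with (2 := H4). intros s. unfold T, Rdiv. ring.
  - apply filter_imp with (2 := at_right_0_lt 1 Rlt_0_1). intros s Hs n.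
    apply hdiff_slope_term_bound; [easy|apply Rmin_l|apply Rmin_r|easy].
  - apply ex_series_Rscal. exact (ex_series_Rpower m 1 Hm Rlt_0_1).
  - unfold b in H. rewrite (is_series_unique _ _ (is_series_hdiff_slope u Hu)) in H.
    apply filterlim_ext_loc with (2 := H).
    apply filter_imp with (2 := at_right_0_lt 1 Rlt_0_1). intros s Hs.
    (* Telescoping from [1 ^ - s = 1] down to 0. *)
    assert (S1 : is_series (fun n => Rpower (INR n + 1) (- s) - Rpower (INR n + 2) (- s)) 1).
    { assert (HT := is_series_telescope _ _ (is_lim_seq_Rpower_neg 1 s ltac:(lra))). cbv beta in HT.
      replace (Rpower (INR 0 + 1) (- s) - 0) with 1 in HT.
      2:{ simpl. unfold Rpower. rewrite Rplus_0_l, ln_1, Rmult_0_r, exp_0. ring. }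
      apply is_series_ext with (2 := HT). intros n. rewrite S_INR.
      replace (INR n + 1 + 1) with (INR n + 2) by ring. reflexivity. }
    unfold T, hdiff, Rdiv. rewrite Series_scal_r. f_equal.
    rewrite Series_minus.
    + rewrite Series_scal_l, (is_series_unique _ _ S1). ring.
    + apply hdiff_ex_series; lra.
    + apply ex_series_Rscal. now exists 1.
Qed.

(** * Euler's constant and the logarithm of Gamma near 1 *)

(** [ln (1 + x) - x + x ^ 2 / 2] has derivative [x ^ 2 / (1 + x)], which lies between 0 and
    [x ^ 2]. *)
Lemma ln_1p_Taylor (x : R) : 0 <= x -> 0 <= x - ln (1 + x) <= x ^ 2 / 2 /\ Rabs (x - ln (1 + x) - x ^ 2 / 2) <= x ^ 3.
Proof.
  intros Hx.
  assert (Hl : ln (1 + x) <= x) by (rewrite <- (ln_exp x) at 2; apply ln_le; [lra|apply exp_ineq1_le]).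
  destruct (MVT_gen (fun x => ln (1 + x) - x + x ^ 2 / 2) 0 x (fun x => x ^ 2 / (1 + x))) as [c [Hc E]].
  - intros y Hy. rewrite Rmin_left in Hy by easy. auto_derive; [lra|]. field. lra.
  - intros y Hy. rewrite Rmin_left in Hy by easy. apply continuity_pt_filterlim.
    apply (ex_derive_continuous (K := R_AbsRing) (V := R_NormedModule) (fun x => ln (1 + x) - x + x ^ 2 / 2)).
    auto_derive. lra.
  - rewrite Rmin_left, Rmax_right in Hc by easy.
    rewrite Rplus_0_r, ln_1, Rminus_0_r in E.
    assert (Hq : 0 <= c ^ 2 / (1 + c) <= x ^ 2).
    { split; [apply Rdiv_le_0_compat; [apply pow2_ge_0|lra]|].
      apply Rle_trans with (c ^ 2); [|apply pow_incr; lra].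
      apply Rmult_le_reg_r with (1 + c); [lra|]. unfold Rdiv. rewrite Rmult_assoc, Rinv_l by lra.
      assert (0 <= c ^ 2) by apply pow2_ge_0. nra. }
    assert (0 <= c ^ 2 / (1 + c) * x) by (apply Rmult_le_pos; lra).
    assert (c ^ 2 / (1 + c) * x <= x ^ 2 * x) by (apply Rmult_le_compat_r; lra).
    simpl in E. split; [lra|]. apply Rabs_le. simpl in *. lra.
Qed.

Lemma ex_series_inv_sqr : ex_series (fun n => (/ (INR n + 1)) ^ 2).
Proof.
  apply (ex_series_ext (V := R_NormedModule)) with (2 := ex_series_Rpower 1 1 Rlt_0_1 Rlt_0_1).
  intros n. assert (Hn := pos_INR n). replace (- (1) - 1) with (- INR 2) by (simpl; ring).
  rewrite Rpower_Ropp, Rpower_pow, pow_inv by lra. reflexivity.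
Qed.

Lemma ex_series_euler (s : R) : 0 <= s -> ex_series (fun n => s * / (INR n + 1) - ln (1 + s * / (INR n + 1))).
Proof.
  intros Hs. apply ex_series_Rle with (fun n => s ^ 2 / 2 * (/ (INR n + 1)) ^ 2); [|apply ex_series_Rscal, ex_series_inv_sqr].
  intros n. assert (Hn := pos_INR n).
  assert (Hx : 0 <= s * / (INR n + 1)) by (apply Rmult_le_pos; [easy|left; apply Rinv_0_lt_compat; lra]).
  destruct (ln_1p_Taylor _ Hx) as [H _]. rewrite Rabs_pos_eq by apply H.
  replace (s ^ 2 / 2 * (/ (INR n + 1)) ^ 2) with ((s * / (INR n + 1)) ^ 2 / 2) by (field; lra). apply H.
Qed.

Lemma ln_1p_inv (n : nat) (s : R) : 0 <= s -> ln (1 + s * / (INR n + 1)) = ln (INR n + 1 + s) - ln (INR n + 1).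
Proof.
  intros Hs. assert (Hn := pos_INR n). rewrite <- ln_div by lra. f_equal. field. lra.
Qed.

(** A value of [Lim_seq] does not assert convergence; that is supplied by the series of
    [1 / (n + 1) - ln (1 + 1 / (n + 1))], whose partial sums are exactly this sequence. The indices
    are shifted so that the sum starts at 0. *)
Lemma is_lim_seq_euler_gamma :
  is_lim_seq (fun N => sum_n (fun k => / (INR k + 1)) N - ln (INR N + 2)) euler_gamma.
Proof.
  assert (H := Series_correct _ (ex_series_euler 1 Rle_0_1)).
  set (l := Series (fun n => 1 * / (INR n + 1) - ln (1 + 1 * / (INR n + 1)))) in *.
  assert (H1 : is_lim_seq (fun N => sum_n (fun k => / (INR k + 1)) N - ln (INR N + 2)) l).
  { apply filterlim_ext with (2 := H). intros N. eq_in_R. induction N as [|N IH].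
    - rewrite !sum_O. rewrite ln_1p_inv by lra. simpl INR. replace (0 + 1) with 1 by ring. rewrite ln_1.
      replace (1 + 1) with (0 + 2) by ring. ring.
    - rewrite !sum_Sn, IH, ln_1p_inv, S_INR by lra. unfold plus; simpl.
      replace (INR N + 1 + 1) with (INR N + 2) by ring. replace (INR N + 2 + 1) with (INR N + 1 + 2) by ring. ring. }
  assert (H2 : is_lim_seq (fun n => sum_n_m (fun k => / INR k) 1 n - ln (INR n)) l).
  { apply is_lim_seq_incr_1.
    assert (H3 := filterlim_R_plus eventually _ _ _ _ H1 is_lim_seq_ln_succ). rewrite Rplus_0_r in H3.
    apply filterlim_ext with (2 := H3). intros N. cbv beta. rewrite S_INR.
    rewrite <- (sum_n_m_S (fun k => / INR k) 0 N).
    unfold sum_n. rewrite (sum_n_m_ext (fun n => / INR (S n)) (fun k => / (INR k + 1))); [ring|].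
    intros k. now rewrite S_INR. }
  unfold euler_gamma. rewrite (is_lim_seq_unique _ _ H2). exact H1.
Qed.

(** The logarithm of Weierstrass's product, derived from Gauss's limit. *)
Lemma ln_Gamma_1p (s : R) : 0 <= s <= 1 ->
  ln (Gamma (1 + s)) = - euler_gamma * s + Series (fun n => s * / (INR n + 1) - ln (1 + s * / (INR n + 1))).
Proof.
  intros Hs. assert (HS := Series_correct _ (ex_series_euler s ltac:(lra))).
  set (l := Series _) in *.
  change (is_lim_seq (fun N => sum_n (fun n => s * / (INR n + 1) - ln (1 + s * / (INR n + 1))) N) l) in HS.
  assert (H1 := proj1 (is_lim_seq_incr_1 _ _) (is_lim_seq_ln_Gamma s Hs)).
  assert (H2 := filterlim_R_mult eventually (fun _ => s) _ _ _ (filterlim_const _) is_lim_seq_euler_gamma).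
  assert (H3 := filterlim_R_minus eventually _ _ _ _ (filterlim_R_plus eventually _ _ _ _ H1 HS) H2).
  (* The combination of the three sequences is constant in [N], so its value equals the combined
     limit. *)
  assert (H4 : is_lim_seq (fun _ => ln (Gamma (1 + s))) (0 + l - s * euler_gamma)).
  { apply filterlim_ext with (2 := H3). intros N. cbv beta.
    replace (INR (S (S N)) + s) with (INR (S N) + (1 + s)) by (rewrite (S_INR (S N)); ring).
    replace (Gamma (INR (S (S N)))) with (Gamma (INR (S N) + 1)) by (now rewrite (S_INR (S N))).
    rewrite !ln_Gamma_sum, Gamma_1, ln_1 by lra.
    rewrite !S_INR. replace (INR N + 1 + 1) with (INR N + 2) by ring.
    assert (E : sum_n (fun n => ln (INR n + (1 + s))) N - sum_n (fun n => ln (INR n + 1)) N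
      + sum_n (fun n => s * / (INR n + 1) - ln (1 + s * / (INR n + 1))) N - s * sum_n (fun k => / (INR k + 1)) N = 0).
    { clear - Hs. induction N as [|N IH].
      - rewrite !sum_O, ln_1p_inv by lra. replace (INR 0 + (1 + s)) with (INR 0 + 1 + s) by ring. ring.
      - rewrite !sum_Sn, ln_1p_inv by lra. unfold plus in *; simpl (AbelianMonoid.plus _ _).
        replace (INR (S N) + (1 + s)) with (INR (S N) + 1 + s) by ring. simpl in *. lra. }
    eq_in_R. lra. }
  apply is_lim_seq_unique in H4. rewrite Lim_seq_const in H4. injection H4. intros ->. ring.
Qed.

(** * Partial fractions *)

(** The upper index is excluded, unlike in [sum_n], so sums over [2 ^ m] or [n * q] indices split
    into blocks without shifts, and the empty sum is available. *)
Fixpoint rsum (f : nat -> R) (n : nat) : R :=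
  match n with O => 0 | S k => rsum f k + f k end.

Lemma rsum_ext (f g : nat -> R) (n : nat) : (forall k, (k < n)%nat -> f k = g k) -> rsum f n = rsum g n.
Proof.
  induction n as [|n IH]; intros H; simpl; [easy|]. rewrite IH, H by (intros; apply H; lia) || lia; easy.
Qed.

Lemma rsum_plus (f g : nat -> R) (n : nat) : rsum (fun k => f k + g k) n = rsum f n + rsum g n.
Proof. induction n as [|n IH]; simpl; [ring|]. rewrite IH. ring. Qed.

Lemma rsum_scal (c : R) (f : nat -> R) (n : nat) : rsum (fun k => c * f k) n = c * rsum f n.
Proof. induction n as [|n IH]; simpl; [ring|]. rewrite IH. ring. Qed.

Lemma rsum_split (f : nat -> R) (n m : nat) : rsum f (n + m) = rsum f n + rsum (fun k => f (n + k)%nat) m.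
Proof.
  induction m as [|m IH]; simpl; [rewrite Nat.add_0_r; ring|].
  rewrite Nat.add_succ_r. simpl. rewrite IH. ring.
Qed.

Lemma rsum_rev (f : nat -> R) (n : nat) : rsum f n = rsum (fun k => f (n - S k)%nat) n.
Proof.
  revert f. induction n as [|n IH]; intros f; [easy|].
  transitivity (rsum (fun k => f (S n - S k)%nat) (1 + n)); [|easy].
  rewrite (rsum_split (fun k => f (S n - S k)%nat) 1 n).
  change (rsum f n + f n = 0 + f (n - 0)%nat + rsum (fun k => f (n - S k)%nat) n).
  rewrite IH, Nat.sub_0_r. ring.
Qed.

(** Pairs each index with its mirror image; this folds the expansion of the kernel. *)
Lemma rsum_double (f : nat -> R) (n : nat) : rsum f (n + n) = rsum (fun k => f k + f (n + n - S k)%nat) n.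
Proof.
  rewrite rsum_split, rsum_plus. f_equal. rewrite rsum_rev. apply rsum_ext. intros k Hk. f_equal. lia.
Qed.

(** Writes a finite sum as a series with truncated terms, so that Tannery's theorem covers a growing
    number of terms. *)
Lemma Series_rsum (f : nat -> R) (n : nat) : Series (fun k => if (k <? n)%nat then f k else 0) = rsum f n.
Proof.
  apply is_series_unique. revert f. induction n as [|n IH]; intros f.
  - apply (is_series_ext (V := R_NormedModule) (fun _ => 0)); [easy|].
    assert (H := is_series_telescope (fun _ => 0) 0 (is_lim_seq_const 0)). rewrite Rminus_0_r in H.
    apply is_series_ext with (2 := H). intros; apply Rminus_diag.
  - replace (rsum f (S n)) with (rsum (fun k => f (S k)) n + f 0%nat).
    + apply (is_series_decr_1 (V := R_NormedModule)).
      match goal with |- is_series _ ?l => replace l with (rsum (fun k => f (S k)) n) end.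
      * apply IH.
      * unfold plus, opp; simpl. ring.
    + transitivity (rsum f (1 + n)); [|easy]. rewrite (rsum_split f 1 n). simpl. ring.
Qed.

(** * The kernel and its partial fractions *)

(* The imaginary part of [1 / (exp (t - i x) - 1)], that is, the sum of [sin (m x) exp (- m t)] over [m >= 1]. *)
Definition hK (x t : R) : R := sin x / (2 * (cosh t - cos x)).

(** The sum of squares makes positivity and lower bounds visible, and reduces limits at the origin
    to first order slopes. *)
Lemma cosh_minus_cos (x t : R) : cosh t - cos x = 2 * (sinh (t / 2) ^ 2 + sin (x / 2) ^ 2).
Proof.
  assert (E1 : cos x = 1 - 2 * sin (x / 2) ^ 2).
  { replace x with (2 * (x / 2)) at 1 by field. rewrite cos_2a_sin. ring. }
  assert (E2 : cosh t = 1 + 2 * sinh (t / 2) ^ 2).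
  { unfold cosh, sinh.
    replace (exp t) with (exp (t / 2) * exp (t / 2)) by (rewrite <- exp_plus; f_equal; field).
    replace (exp (- t)) with (exp (- (t / 2)) * exp (- (t / 2))) by (rewrite <- exp_plus; f_equal; field).
    assert (E : exp (t / 2) * exp (- (t / 2)) = 1) by (rewrite <- exp_plus, Rplus_opp_r; apply exp_0).
    set (a := exp (t / 2)) in *. set (b := exp (- (t / 2))) in *.
    replace (1 + 2 * ((a - b) / 2) ^ 2) with ((a * a + b * b) / 2 + (1 - a * b)) by field.
    rewrite E. field. }
  rewrite E1, E2. ring.
Qed.

Lemma sin_half_pos (x : R) : 0 < x < 2 * PI -> 0 < sin (x / 2).
Proof. intros H. apply sin_gt_0; lra. Qed.

Lemma cosh_minus_cos_pos (x t : R) : 0 < x < 2 * PI -> 0 < cosh t - cos x.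
Proof.
  intros H. rewrite cosh_minus_cos. assert (H1 := sin_half_pos x H).
  assert (0 < sin (x / 2) ^ 2) by now apply pow_lt.
  assert (0 <= sinh (t / 2) ^ 2) by apply pow2_ge_0. lra.
Qed.

Lemma cosh_double (t : R) : cosh t = 2 * cosh (t / 2) ^ 2 - 1.
Proof.
  unfold cosh.
  replace (exp t) with (exp (t / 2) * exp (t / 2)) by (rewrite <- exp_plus; f_equal; field).
  replace (exp (- t)) with (exp (- (t / 2)) * exp (- (t / 2))) by (rewrite <- exp_plus; f_equal; field).
  assert (E : exp (t / 2) * exp (- (t / 2)) = 1) by (rewrite <- exp_plus, Rplus_opp_r; apply exp_0).
  set (a := exp (t / 2)) in *. set (b := exp (- (t / 2))) in *.
  replace (2 * ((a + b) / 2) ^ 2 - 1) with ((a * a + b * b) / 2 + (a * b - 1)) by field.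
  rewrite E. field.
Qed.

(** With [c = cosh (t / 2)] and [d = cos (x / 2)] one has [cosh t - cos x = 2 (c - d) (c + d)]. The
    identity is the resulting partial fraction; [PI - x / 2] has the same sine and the opposite
    cosine. *)
Lemma hK_duplication (x t : R) : 0 < x < 2 * PI ->
  hK x t = / 2 * (hK (x / 2) (t / 2) - hK ((2 * PI - x) / 2) (t / 2)).
Proof.
  intros Hx. unfold hK.
  assert (H1 := cosh_minus_cos_pos (x / 2) (t / 2) ltac:(lra)).
  assert (H2 := cosh_minus_cos_pos ((2 * PI - x) / 2) (t / 2) ltac:(lra)).
  replace ((2 * PI - x) / 2) with (PI - x / 2) in * by field.
  rewrite sin_PI_x, cos_pi_minus in *.
  replace (sin x) with (2 * sin (x / 2) * cos (x / 2)) by (rewrite <- sin_2a; f_equal; field).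
  assert (Ec : cos x = 2 * cos (x / 2) * cos (x / 2) - 1) by (rewrite <- cos_2a_cos; f_equal; field).
  assert (Eh := cosh_double t). rewrite Ec, Eh in *.
  set (c := cosh (t / 2)) in *. set (d := cos (x / 2)) in *. field.
  repeat split; nra.
Qed.

(* Iterate the duplication formula, folding the [2 ^ S m] arguments [(x + 2 PI j) / 2 ^ S m] onto [(0, PI)] by [hK (2 PI - x) t = - hK x t]. *)
Lemma hK_finite_expansion (x t : R) (m : nat) : 0 < x < 2 * PI ->
  hK x t = rsum (fun j => / 2 ^ S m * (hK ((2 * PI * INR j + x) / 2 ^ S m) (t / 2 ^ S m)
                                  - hK ((2 * PI * (INR j + 1) - x) / 2 ^ S m) (t / 2 ^ S m))) (2 ^ m).
Proof.
  intros Hx. induction m as [|m IH].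
  - change (2 ^ 0)%nat with 1%nat. cbn [rsum]. change (INR 0) with 0.
    replace (2 ^ 1) with 2 by ring. replace (2 * PI * 0 + x) with x by ring.
    replace (2 * PI * (0 + 1) - x) with (2 * PI - x) by ring. rewrite Rplus_0_l. now apply hK_duplication.
  - rewrite IH. replace (2 ^ S m)%nat with (2 ^ m + 2 ^ m)%nat by (simpl; lia).
    (* Duplication splits the old term [j] into four kernels, which are those of the new terms [j]
       and [2 ^ (m + 1) - 1 - j]. *)
    rewrite rsum_double. apply rsum_ext. intros j Hj.
    assert (Hpow : INR (2 ^ m) = 2 ^ m) by (rewrite pow_INR; reflexivity).
    assert (Hj' : INR j + 1 <= 2 ^ m) by (rewrite <- Hpow, <- S_INR; apply le_INR; lia).
    assert (Hj0 := pos_INR j).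
    assert (Hi : INR (2 ^ m + 2 ^ m - S j) = 2 * 2 ^ m - INR j - 1).
    { rewrite minus_INR, plus_INR, Hpow, S_INR by lia. ring. }
    rewrite Hi. set (P := 2 ^ m) in *. assert (HP : 0 < P) by (apply pow_lt; lra).
    replace (2 ^ S (S m)) with (4 * P) by (unfold P; simpl; ring).
    replace (2 ^ S m) with (2 * P) by (unfold P; simpl; ring).
    assert (HPj : PI * (INR j + 1) <= PI * P) by (apply Rmult_le_compat_l; lra).
    assert (HPj0 : 0 <= PI * INR j) by (apply Rmult_le_pos; lra).
    assert (B : forall y, 0 < y < 4 * (PI * P) -> 0 < y / (2 * P) < 2 * PI).
    { intros y Hy. split; [apply Rdiv_lt_0_compat; lra|].
      apply Rmult_lt_reg_r with (2 * P); [lra|]. unfold Rdiv. rewrite Rmult_assoc, Rinv_l; lra. }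
    rewrite (hK_duplication ((2 * PI * INR j + x) / (2 * P))) by (apply B; lra).
    rewrite (hK_duplication ((2 * PI * (INR j + 1) - x) / (2 * P))) by (apply B; lra).
    replace ((2 * PI * INR j + x) / (2 * P) / 2) with ((2 * PI * INR j + x) / (4 * P)) by (field; lra).
    replace ((2 * PI * (INR j + 1) - x) / (2 * P) / 2) with ((2 * PI * (INR j + 1) - x) / (4 * P)) by (field; lra).
    replace ((2 * PI - (2 * PI * INR j + x) / (2 * P)) / 2)
      with ((2 * PI * (2 * P - INR j - 1 + 1) - x) / (4 * P)) by (field; lra).
    replace ((2 * PI - (2 * PI * (INR j + 1) - x) / (2 * P)) / 2)
      with ((2 * PI * (2 * P - INR j - 1) + x) / (4 * P)) by (field; lra).
    replace (t / (2 * P) / 2) with (t / (4 * P)) by (field; lra). field. lra.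
Qed.

(** Up to [PI / 3] the derivative is at least 1/2; beyond, [sin y >= 1/2] while
    [y / 4 <= PI / 8]. *)
Lemma sin_lower_quarter (y : R) : 0 <= y <= PI / 2 -> y / 4 <= sin y.
Proof.
  intros Hy. assert (HP4 := PI_4).
  destruct (Rle_lt_dec y (PI / 3)) as [H|H].
  - destruct (MVT_gen sin 0 y cos) as [c [Hc E]].
    + intros; apply is_derive_sin.
    + intros; apply continuity_pt_filterlim. apply continuous_sin.
    + rewrite Rmin_left, Rmax_right in Hc by lra. rewrite sin_0 in E.
      assert (cos (PI / 3) <= cos c) by (apply cos_decr_1; lra). rewrite cos_PI3 in *. nra.
  - assert (sin (PI / 6) <= sin y) by (apply sin_incr_1; lra). rewrite sin_PI6 in *. lra.
Qed.

Lemma is_derive_hK (x t : R) : 0 < cosh t - cos x ->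
  is_derive (fun x => hK x t) x ((cosh t * cos x - 1) / (2 * (cosh t - cos x) ^ 2)).
Proof.
  intros H. unfold hK. auto_derive; [lra|].
  assert (E : sin x * sin x = 1 - cos x * cos x) by (assert (E := sin2_cos2 x); unfold Rsqr in E; lra).
  match goal with |- _ = ?r => replace r with ((cosh t * cos x - (sin x * sin x + cos x * cos x)) / (2 * (cosh t - cos x) ^ 2)) end.
  - field. lra.
  - rewrite E. f_equal. ring.
Qed.

(** Since [|cosh t cos c - 1| <= cosh t - cos c], the derivative in [x] is at most [1 / (2 D)] with
    [D = cosh t - cos c], and [D >= w ^ 2 / 32] for every [t]. The restriction to arguments at most
    [PI] makes the sine bound applicable. *)
Lemma hK_Lipschitz (x y w t : R) : 0 < w -> w <= x -> w <= y -> x <= PI -> y <= PI ->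
  Rabs (hK x t - hK y t) <= 16 / w ^ 2 * Rabs (x - y).
Proof.
  intros Hw Hx Hy HxP HyP.
  assert (Hmin : w <= Rmin y x) by now apply Rmin_glb.
  assert (Hmax : Rmax y x <= PI) by now apply Rmax_lub.
  destruct (MVT_gen (fun x => hK x t) y x (fun x => (cosh t * cos x - 1) / (2 * (cosh t - cos x) ^ 2))) as [c [Hc E]].
  - intros z Hz. apply is_derive_hK, cosh_minus_cos_pos. lra.
  - intros z Hz. apply continuity_pt_filterlim.
    apply (ex_derive_continuous (K := R_AbsRing) (V := R_NormedModule) (fun x => hK x t)).
    eexists. apply is_derive_hK, cosh_minus_cos_pos. lra.
  - rewrite E, Rabs_mult. apply Rmult_le_compat_r; [apply Rabs_pos|].
    assert (Hd : w ^ 2 / 32 <= cosh t - cos c).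
    { rewrite cosh_minus_cos. assert (H1 := sin_lower_quarter (c / 2) ltac:(lra)).
      assert ((w / 8) ^ 2 <= sin (c / 2) ^ 2) by (apply pow_incr; lra). nra. }
    assert (Hcosh : 1 <= cosh t).
    { assert (H2 : 0 <= sinh (t / 2) ^ 2) by apply pow2_ge_0.
      assert (E1 := cosh_minus_cos 0 t). rewrite cos_0 in E1. nra. }
    assert (Hcos := COS_bound c).
    assert (Hnum : Rabs (cosh t * cos c - 1) <= cosh t - cos c) by (apply Rabs_le; nra).
    unfold Rdiv. rewrite Rabs_mult, Rabs_inv, (Rabs_pos_eq (2 * _)) by (apply Rmult_le_pos; [lra|apply pow2_ge_0]).
    set (D := cosh t - cos c) in *.
    assert (Hw2 : 0 < w ^ 2) by now apply pow_lt.
    apply Rle_trans with (D * / (2 * D ^ 2)).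
    + apply Rmult_le_compat_r; [|easy]. left. apply Rinv_0_lt_compat. nra.
    + replace (D * / (2 * D ^ 2)) with (/ (2 * D)) by (field; lra).
      replace (16 * / w ^ 2) with (/ (w ^ 2 / 16)) by (field; lra).
      apply Rinv_le_contravar; lra.
Qed.

Lemma filterlim_slope_0 (f : R -> R) (l : R) : f 0 = 0 -> is_derive f 0 l ->
  filterlim (fun e => f e / e) (at_right 0) (locally l).
Proof.
  intros Hf H. apply is_derive_Reals in H. apply (filterlim_R_spec (at_right 0)). intros eps He.
  destruct (H eps He) as [d Hd]. apply filter_imp with (2 := at_right_0_lt d (cond_pos d)).
  intros s Hs. specialize (Hd s ltac:(lra) ltac:(rewrite Rabs_pos_eq; lra)).
  now rewrite Rplus_0_l, Hf, Rminus_0_r in Hd.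
Qed.

(** The real part of [1 / (x + i t)]; it arises as the scaling limit of [hK] at the origin. *)
Definition cauchy_kernel (x t : R) : R := x / (x ^ 2 + t ^ 2).

Lemma filterlim_R_inv {T : Type} (F : (T -> Prop) -> Prop) {FF : Filter F} (f : T -> R) (l : R) : l <> 0 ->
  filterlim f F (locally l) -> filterlim (fun t => / f t) F (locally (/ l)).
Proof.
  intros Hl Hf. apply (filterlim_comp _ _ _ f Rinv _ (locally l)); [easy|].
  apply continuity_pt_filterlim. apply continuity_pt_inv; [apply continuity_pt_id|easy].
Qed.

Lemma filterlim_hK_small (x t : R) : 0 < x ->
  filterlim (fun e => e * hK (e * x) (e * t)) (at_right 0) (locally (cauchy_kernel x t)).
Proof.
  intros Hx.
  assert (L1 : filterlim (fun e => sin (e * x) / e) (at_right 0) (locally x)).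
  { apply (filterlim_slope_0 (fun e => sin (e * x))); [now rewrite Rmult_0_l, sin_0|].
    auto_derive; [easy|]. rewrite Rmult_0_l, cos_0. ring. }
  assert (L2 : filterlim (fun e => sin (e * x / 2) / e) (at_right 0) (locally (x / 2))).
  { apply (filterlim_slope_0 (fun e => sin (e * x / 2))); [unfold Rdiv; now rewrite !Rmult_0_l, sin_0|].
    auto_derive; [easy|]. rewrite !Rmult_0_l, cos_0. field. }
  assert (L3 : filterlim (fun e => sinh (e * t / 2) / e) (at_right 0) (locally (t / 2))).
  { apply (filterlim_slope_0 (fun e => sinh (e * t / 2))); [unfold Rdiv; now rewrite !Rmult_0_l, sinh_0|].
    unfold sinh. auto_derive; [easy|]. unfold Rdiv. rewrite !Rmult_0_l, Ropp_0, exp_0. field. }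
  assert (L4 := filterlim_R_plus (at_right 0) _ _ _ _ (filterlim_R_mult (at_right 0) _ _ _ _ L3 L3) (filterlim_R_mult (at_right 0) _ _ _ _ L2 L2)).
  assert (Hden : t / 2 * (t / 2) + x / 2 * (x / 2) <> 0) by nra.
  assert (L5 := filterlim_R_inv (at_right 0) _ _ Hden L4).
  assert (L6 := filterlim_R_mult (at_right 0) _ _ _ _ L1 L5).
  assert (L7 := filterlim_R_mult (at_right 0) (fun _ => / 4) _ _ _ (filterlim_const _) L6).
  replace (cauchy_kernel x t) with (/ 4 * (x * / (t / 2 * (t / 2) + x / 2 * (x / 2)))).
  2:{ unfold cauchy_kernel. field. nra. }
  apply filterlim_ext_loc with (2 := L7).
  assert (Hd : 0 < 2 * PI / x) by (apply Rdiv_lt_0_compat; [assert (H := PI_RGT_0)|]; lra).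
  apply filter_imp with (2 := at_right_0_lt (2 * PI / x) Hd).
  intros e He.
  assert (Hex : 0 < e * x < 2 * PI).
  { split; [apply Rmult_lt_0_compat; lra|]. replace (2 * PI) with (2 * PI / x * x) by (field; lra). apply Rmult_lt_compat_r; lra. }
  unfold hK. rewrite cosh_minus_cos.
  assert (Hs := sin_half_pos _ Hex).
  field. repeat split; try lra; nra.
Qed.

Lemma is_lim_seq_inv_pow2 : filterlim (fun m => / 2 ^ S m) eventually (at_right 0).
Proof.
  intros P [d Hd].
  assert (H : is_lim_seq (fun m => (/ 2) ^ m) 0) by (apply is_lim_seq_geom; rewrite Rabs_pos_eq; lra).
  apply is_lim_seq_incr_1 in H. apply is_lim_seq_spec in H. destruct (H d) as [N HN]. exists N. intros n Hn.
  specialize (HN n Hn). rewrite pow_inv in HN. apply Hd; [exact HN|]. apply Rinv_0_lt_compat, pow_lt. lra.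
Qed.

(** The limit of the finite expansions as [m] grows: each term is a rescaled kernel tending to the
    Cauchy kernel, and the Lipschitz bound supplies a majorant of order [1 / j ^ 2]. *)
Lemma is_series_hK (x t : R) : 0 < x < 2 * PI ->
  is_series (fun n => cauchy_kernel (2 * PI * INR n + x) t - cauchy_kernel (2 * PI * (INR n + 1) - x) t) (hK x t).
Proof.
  intros Hx.
  set (w0 := Rmin x (2 * PI - x)).
  assert (Hw0 : 0 < w0) by (apply Rmin_glb_lt; lra).
  assert (Hw1 : w0 <= x) by apply Rmin_l. assert (Hw2 : w0 <= 2 * PI - x) by apply Rmin_r.
  set (D := fun e j => e * (hK (e * (2 * PI * INR j + x)) (e * t) - hK (e * (2 * PI * (INR j + 1) - x)) (e * t))).
  set (b := fun n => cauchy_kernel (2 * PI * INR n + x) t - cauchy_kernel (2 * PI * (INR n + 1) - x) t).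
  assert (HPj : forall j, 0 <= 2 * PI * INR j) by (intros j; apply Rmult_le_pos; [lra|apply pos_INR]).
  destruct (filterlim_Series eventually (fun m j => if (j <? 2 ^ m)%nat then D (/ 2 ^ S m) j else 0) b
    (fun j => 32 * PI / (2 * PI) ^ 2 * Rpower (INR j + w0 / (2 * PI)) (- (1) - 1))) as [Hex H].
  - intros j. specialize (HPj j).
    assert (L := filterlim_R_minus (at_right 0) _ _ _ _ (filterlim_hK_small (2 * PI * INR j + x) t ltac:(lra))
       (filterlim_hK_small (2 * PI * (INR j + 1) - x) t ltac:(lra))).
    assert (L' := filterlim_comp _ _ _ _ _ _ _ _ is_lim_seq_inv_pow2 L).
    apply filterlim_ext_loc with (2 := L').
    exists j. intros m Hm. unfold D.
    assert (Hlt : (j < 2 ^ m)%nat) by (apply Nat.le_lt_trans with m; [easy|apply Nat.pow_gt_lin_r; lia]).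
    apply Nat.ltb_lt in Hlt. rewrite Hlt. ring.
  - exists 0%nat. intros m _ j. assert (Hj0 := HPj j). assert (HjR := pos_INR j).
    (* A common lower bound for the two arguments of the term [j], before rescaling. *)
    set (w := 2 * PI * INR j + w0).
    assert (HR : 32 * PI / (2 * PI) ^ 2 * Rpower (INR j + w0 / (2 * PI)) (- (1) - 1) = 32 * PI / w ^ 2).
    { assert (Hq : 0 < w0 / (2 * PI)) by (apply Rdiv_lt_0_compat; lra).
      replace (- (1) - 1) with (- INR 2) by (simpl; ring). rewrite Rpower_Ropp, Rpower_pow by lra.
      replace w with (2 * PI * (INR j + w0 / (2 * PI))) by (unfold w; field; lra). field. split; [|lra].
      replace (INR j * (2 * PI) + w0) with (2 * PI * (INR j + w0 / (2 * PI))) by (field; lra). nra. }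
    rewrite HR. assert (Hw : 0 < w) by (unfold w; lra).
    destruct (Nat.ltb_spec j (2 ^ m)) as [Hlt|_].
    + set (e := / 2 ^ S m). assert (He : 0 < e) by (apply Rinv_0_lt_compat, pow_lt; lra).
      (* Here [j < 2 ^ m] matters: folding has brought every argument into the range of the
         Lipschitz bound. *)
      assert (HeP : e * (2 * PI * (INR j + 1)) <= PI).
      { assert (Hj' : INR j + 1 <= 2 ^ m).
        { replace (2 ^ m) with (INR (2 ^ m)) by (rewrite pow_INR; reflexivity). rewrite <- S_INR. apply le_INR. lia. }
        apply Rle_trans with (e * (2 * PI * 2 ^ m)).
        - apply Rmult_le_compat_l; [lra|]. apply Rmult_le_compat_l; lra.
        - right. unfold e. simpl. field. apply pow_nonzero. lra. }
      assert (HL := hK_Lipschitz (e * (2 * PI * INR j + x)) (e * (2 * PI * (INR j + 1) - x)) (e * w) (e * t)).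
      assert (Hxw : w <= 2 * PI * INR j + x) by (unfold w; lra).
      assert (Hyw : w <= 2 * PI * (INR j + 1) - x) by (unfold w; lra).
      specialize (HL ltac:(apply Rmult_lt_0_compat; lra) ltac:(apply Rmult_le_compat_l; lra) ltac:(apply Rmult_le_compat_l; lra)).
      specialize (HL ltac:(apply Rle_trans with (2 := HeP); apply Rmult_le_compat_l; lra)
                     ltac:(apply Rle_trans with (2 := HeP); apply Rmult_le_compat_l; lra)).
      unfold D. rewrite Rabs_mult, (Rabs_pos_eq e) by lra.
      rewrite <- Rmult_minus_distr_l, Rabs_mult, (Rabs_pos_eq e) in HL by lra.
      assert (Hxy : Rabs (2 * PI * INR j + x - (2 * PI * (INR j + 1) - x)) <= 2 * PI) by (apply Rabs_le; lra).
      apply Rle_trans with (e * (16 / (e * w) ^ 2 * (e * (2 * PI)))).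
      * apply Rmult_le_compat_l; [lra|]. eapply Rle_trans; [exact HL|].
        apply Rmult_le_compat_l; [apply Rdiv_le_0_compat; [lra|apply pow_lt, Rmult_lt_0_compat; lra]|].
        apply Rmult_le_compat_l; lra.
      * right. field. lra.
    + rewrite Rabs_R0. apply Rdiv_le_0_compat; [lra|now apply pow_lt].
  - apply ex_series_Rscal. apply ex_series_Rpower; [apply Rdiv_lt_0_compat; lra|lra].
  - assert (HC : Series b = hK x t).
    { assert (U : is_lim_seq (fun _ => hK x t) (Series b)).
      { apply filterlim_ext with (2 := H). intros m. rewrite Series_rsum.
        rewrite (hK_finite_expansion x t m Hx). apply rsum_ext. intros j _. unfold D, Rdiv.
        rewrite !(Rmult_comm (/ 2 ^ S m) (_ + _)), !(Rmult_comm (/ 2 ^ S m) (_ - _)), (Rmult_comm (/ 2 ^ S m) t).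
        reflexivity. }
      apply is_lim_seq_unique in U. rewrite Lim_seq_const in U. now injection U. }
    rewrite <- HC. now apply Series_correct.
Qed.

(** * The two Mellin transforms of the kernel *)

Lemma continuous_pos_cauchy_kernel (x : R) : 0 < x -> continuous_pos (cauchy_kernel x).
Proof.
  intros Hx t Ht. apply (ex_derive_continuous (K := R_AbsRing) (V := R_NormedModule)).
  unfold cauchy_kernel. auto_derive. nra.
Qed.

Lemma Rpower_minus_2 (t s : R) : 0 < t -> Rpower t (s - 1) * / t ^ 2 = Rpower t (- (2 - s) - 1).
Proof.
  intros Ht. rewrite <- Rpower_pow, <- Rpower_Ropp, <- Rpower_plus by easy. f_equal. simpl. ring.
Qed.

(* Equal to [PI / (2 sin (PI s / 2))], but only its expansion at [s = 0] is needed. *)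
Definition cauchy_mellin (s : R) : R :=
  RInt_gen (fun t => Rpower t (s - 1) * cauchy_kernel 1 t) (at_right 0) (Rbar_locally p_infty).

Lemma is_RInt_pos_mellin_of_bounds (f : R -> R) (s A B : R) : 0 < s < 1 -> continuous_pos f ->
  0 <= A -> 0 <= B -> (forall t, 0 < t -> Rabs (f t) <= A) -> (forall t, 0 < t -> Rabs (f t) <= B * / t ^ 2) ->
  exists l, is_RInt_pos (fun t => Rpower t (s - 1) * f t) l.
Proof.
  intros Hs Hf HA HB H1 H2.
  destruct (is_RInt_pos_two_powers (fun t => Rpower t (s - 1) * f t) A B 1 s (2 - s)) as [l [Hl _]]; try lra.
  - apply continuous_pos_mult; [apply continuous_pos_Rpower|easy].
  - intros t Ht. assert (Hr := Rpower_pos t (s - 1)).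
    rewrite Rabs_mult, (Rabs_pos_eq (Rpower _ _)), Rmult_comm by lra. apply Rmult_le_compat_r; [lra|]. apply H1; lra.
  - intros t Ht. assert (Hr := Rpower_pos t (s - 1)).
    rewrite Rabs_mult, (Rabs_pos_eq (Rpower _ _)) by lra. rewrite <- Rpower_minus_2 by lra.
    replace (B * (Rpower t (s - 1) * / t ^ 2)) with (Rpower t (s - 1) * (B * / t ^ 2)) by ring.
    apply Rmult_le_compat_l; [lra|]. apply H2; lra.
  - now exists l.
Qed.

Lemma is_RInt_pos_cauchy_mellin (s : R) : 0 < s < 1 ->
  is_RInt_pos (fun t => Rpower t (s - 1) * cauchy_kernel 1 t) (cauchy_mellin s).
Proof.
  intros Hs.
  destruct (is_RInt_pos_mellin_of_bounds (cauchy_kernel 1) s 1 1) as [l Hl]; try lra.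
  - apply continuous_pos_cauchy_kernel. lra.
  - intros t Ht. unfold cauchy_kernel, Rdiv. assert (0 <= t ^ 2) by apply pow2_ge_0.
    rewrite Rmult_1_l, Rabs_pos_eq by (left; apply Rinv_0_lt_compat; lra).
    apply Rle_trans with (/ 1); [apply Rinv_le_contravar|]; lra.
  - intros t Ht. unfold cauchy_kernel, Rdiv. assert (0 < t ^ 2) by now apply pow_lt.
    rewrite !Rmult_1_l, Rabs_pos_eq by (left; apply Rinv_0_lt_compat; lra). apply Rinv_le_contravar; lra.
  - unfold cauchy_mellin. assert (E := is_RInt_gen_unique _ _ Hl). rewrite E. exact Hl.
Qed.

(** Substitution of [t / x] for [t], under which the kernel is homogeneous of degree -1. *)
Lemma is_RInt_pos_cauchy_kernel (s x : R) : 0 < s < 1 -> 0 < x ->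
  is_RInt_pos (fun t => Rpower t (s - 1) * cauchy_kernel x t) (Rpower x (s - 1) * cauchy_mellin s).
Proof.
  intros Hs Hx. assert (Hi : 0 < / x) by now apply Rinv_0_lt_compat.
  assert (H := is_RInt_pos_scal _ (Rpower x (s - 1)) _ (is_RInt_pos_scale _ _ _ Hi (is_RInt_pos_cauchy_mellin s Hs))).
  apply is_RInt_pos_ext with (2 := H). intros t Ht. cbv beta.
  rewrite <- Rpower_mult_distr by easy.
  assert (E : Rpower x (s - 1) * Rpower (/ x) (s - 1) = 1).
  { rewrite Rpower_mult_distr, Rinv_r by lra. unfold Rpower. now rewrite ln_1, Rmult_0_r, exp_0. }
  replace (Rpower x (s - 1) * (/ x * (Rpower (/ x) (s - 1) * Rpower t (s - 1) * cauchy_kernel 1 (/ x * t))))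
    with ((Rpower x (s - 1) * Rpower (/ x) (s - 1)) * (Rpower t (s - 1) * (/ x * cauchy_kernel 1 (/ x * t)))) by ring.
  rewrite E, Rmult_1_l. f_equal. unfold cauchy_kernel. field.
  repeat split; try lra; nra.
Qed.

Lemma hK_bounded (x t : R) : 0 < x < 2 * PI -> Rabs (hK x t) <= / (4 * sin (x / 2) ^ 2).
Proof.
  intros Hx. unfold hK. rewrite cosh_minus_cos.
  assert (H1 : 0 < sin (x / 2) ^ 2) by now apply pow_lt, sin_half_pos.
  assert (H2 : 0 <= sinh (t / 2) ^ 2) by apply pow2_ge_0.
  unfold Rdiv at 1. rewrite Rabs_mult, Rabs_inv, (Rabs_pos_eq (2 * _)) by lra.
  rewrite <- (Rmult_1_l (/ (4 * _))). apply Rmult_le_compat.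
  - apply Rabs_pos.
  - left. apply Rinv_0_lt_compat. lra.
  - apply Rabs_le. assert (H := SIN_bound x). lra.
  - apply Rinv_le_contravar; lra.
Qed.

(** Quadratic decay suffices for the Mellin integral and follows from [sinh (t / 2) >= t / 4]. *)
Lemma hK_decay (x t : R) : 0 < x < 2 * PI -> 0 < t -> Rabs (hK x t) <= 4 * / t ^ 2.
Proof.
  intros Hx Ht. unfold hK. rewrite cosh_minus_cos.
  assert (H1 : 0 < sin (x / 2) ^ 2) by now apply pow_lt, sin_half_pos.
  assert (Hs : t / 4 <= sinh (t / 2)).
  { unfold sinh. assert (E := exp_ineq1_le (t / 2)).
    assert (exp (- (t / 2)) <= 1) by (rewrite <- exp_0; apply exp_le_compat; lra). lra. }
  assert (H2 : (t / 4) ^ 2 <= sinh (t / 2) ^ 2) by (apply pow_incr; lra).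
  assert (H3 : 0 < t ^ 2) by now apply pow_lt.
  replace ((t / 4) ^ 2) with (t ^ 2 / 16) in H2 by field.
  unfold Rdiv at 1. rewrite Rabs_mult, Rabs_inv, (Rabs_pos_eq (2 * _)) by lra.
  replace (4 * / t ^ 2) with (1 * / (t ^ 2 / 4)) by (field; lra). apply Rmult_le_compat.
  - apply Rabs_pos.
  - left. apply Rinv_0_lt_compat. lra.
  - apply Rabs_le. assert (H := SIN_bound x). lra.
  - apply Rinv_le_contravar; lra.
Qed.

Lemma continuous_pos_hK (x : R) : 0 < x < 2 * PI -> continuous_pos (hK x).
Proof.
  intros Hx t Ht. apply (ex_derive_continuous (K := R_AbsRing) (V := R_NormedModule)).
  assert (H := cosh_minus_cos_pos x t Hx). unfold hK, cosh in *. auto_derive. lra.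
Qed.

Definition hK_mellin (x s : R) : R :=
  RInt_gen (fun t => Rpower t (s - 1) * hK x t) (at_right 0) (Rbar_locally p_infty).

Lemma is_RInt_pos_hK_mellin (x s : R) : 0 < x < 2 * PI -> 0 < s < 1 ->
  is_RInt_pos (fun t => Rpower t (s - 1) * hK x t) (hK_mellin x s).
Proof.
  intros Hx Hs.
  destruct (is_RInt_pos_mellin_of_bounds (hK x) s (/ (4 * sin (x / 2) ^ 2)) 4) as [l Hl]; try lra.
  - now apply continuous_pos_hK.
  - left. apply Rinv_0_lt_compat. assert (0 < sin (x / 2) ^ 2) by now apply pow_lt, sin_half_pos. lra.
  - intros t _. now apply hK_bounded.
  - intros t Ht. now apply hK_decay.
  - unfold hK_mellin. assert (E := is_RInt_gen_unique _ _ Hl). rewrite E. exact Hl.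
Qed.

(** The difference is [x - y] times a quotient bounded by [1 / (w ^ 2 + t ^ 2)], because [x y] is at
    most the larger of the two squares. Passing to [(w + t) ^ 2] prepares a comparison with a
    telescoping series. *)
Lemma cauchy_kernel_diff_le (x y w t : R) : 0 < w -> w <= x -> w <= y -> Rabs (x - y) <= 2 * PI -> 0 < t ->
  Rabs (cauchy_kernel x t - cauchy_kernel y t) <= 4 * PI / (w + t) ^ 2.
Proof.
  intros Hw Hx Hy Hxy Ht. unfold cauchy_kernel.
  assert (P : forall z, w <= z -> 0 < z ^ 2 + t ^ 2).
  { intros z Hz. assert (0 < t ^ 2) by now apply pow_lt. assert (0 <= z ^ 2) by apply pow2_ge_0. lra. }
  assert (Px := P x Hx). assert (Py := P y Hy). assert (Pw := P w (Rle_refl w)).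
  replace (x / (x ^ 2 + t ^ 2) - y / (y ^ 2 + t ^ 2))
    with ((x - y) * ((t ^ 2 - x * y) / ((x ^ 2 + t ^ 2) * (y ^ 2 + t ^ 2)))) by (field; lra).
  rewrite Rabs_mult.
  assert (HQ : Rabs ((t ^ 2 - x * y) / ((x ^ 2 + t ^ 2) * (y ^ 2 + t ^ 2))) <= / (w ^ 2 + t ^ 2)).
  { unfold Rdiv. rewrite Rabs_mult, Rabs_inv, (Rabs_pos_eq (_ * _)) by (apply Rmult_le_pos; lra).
    apply Rmult_le_reg_r with ((x ^ 2 + t ^ 2) * (y ^ 2 + t ^ 2)); [now apply Rmult_lt_0_compat|].
    rewrite Rmult_assoc, Rinv_l, Rmult_1_r by (apply Rgt_not_eq; now apply Rmult_lt_0_compat).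
    apply Rmult_le_reg_l with (w ^ 2 + t ^ 2); [lra|].
    rewrite <- !Rmult_assoc, Rinv_r, Rmult_1_l by lra.
    assert (Habs : Rabs (t ^ 2 - x * y) <= t ^ 2 + x * y) by (apply Rabs_le; nra).
    apply Rle_trans with ((w ^ 2 + t ^ 2) * (t ^ 2 + x * y)); [apply Rmult_le_compat_l; lra|].
    destruct (Rle_lt_dec x y) as [L|L].
    - apply Rmult_le_compat; try nra.
    - rewrite (Rmult_comm (x ^ 2 + t ^ 2)). apply Rmult_le_compat; try nra. }
  apply Rle_trans with (2 * PI * / (w ^ 2 + t ^ 2)).
  - apply Rmult_le_compat; try easy; apply Rabs_pos.
  - assert (HPI := PI_RGT_0). replace (4 * PI / (w + t) ^ 2) with (2 * PI * / ((w + t) ^ 2 / 2)).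
    + apply Rmult_le_compat_l; [lra|].
      assert (0 < (w + t) ^ 2) by (apply pow_lt; lra). assert (0 <= (w - t) ^ 2) by apply pow2_ge_0.
      apply Rinv_le_contravar; [lra|]. nra.
    + field. lra.
Qed.

(** With [z = 2 PI n + t], each tail term is at most [4 PI / z ^ 2], hence at most
    [2 / (z - 2 PI) - 2 / z], and these differences telescope. *)
Lemma hK_partial_remainder (x t : R) (N : nat) : 0 < x < 2 * PI -> 0 < t -> (0 < N)%nat ->
  Rabs (hK x t - sum_n (fun n => cauchy_kernel (2 * PI * INR n + x) t - cauchy_kernel (2 * PI * (INR n + 1) - x) t) N)
    <= 2 / (2 * PI * INR N + t).
Proof.
  intros Hx Ht HN. assert (H := is_series_hK x t Hx).
  set (b := fun n => cauchy_kernel (2 * PI * INR n + x) t - cauchy_kernel (2 * PI * (INR n + 1) - x) t) in *.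
  change (is_series b (hK x t)) in H.
  rewrite <- (is_series_unique _ _ H), (Series_incr_n b (S N)) by (lia || (eexists; exact H)).
  simpl Init.Nat.pred. rewrite <- sum_n_Reals.
  replace (sum_n b N + Series (fun k => b (S N + k)%nat) - sum_n b N) with (Series (fun k => b (S N + k)%nat)) by ring.
  assert (HN1 : 1 <= INR N) by (apply (le_INR 1); lia).
  set (v := fun k => 2 / (2 * PI * INR (N + k) + t)).
  assert (Hpos : forall k, 0 < 2 * PI * INR (N + k) + t).
  { intros k. assert (H0 := pos_INR (N + k)). assert (0 <= 2 * PI * INR (N + k)) by (apply Rmult_le_pos; lra). lra. }
  assert (Hv : is_lim_seq v 0).
  { assert (HL : is_lim_seq (fun k => INR k + 1) p_infty) by apply is_lim_seq_INR_plus.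
    apply (filterlim_squeeze0 eventually _ (fun k => 2 * / (INR k + 1))).
    - exists 0%nat. intros k _. rewrite Rminus_0_r. unfold v, Rdiv.
      assert (H0 := pos_INR k).
      rewrite Rabs_pos_eq by (apply Rmult_le_pos; [lra|left; now apply Rinv_0_lt_compat]).
      apply Rmult_le_compat_l; [lra|]. apply Rinv_le_contravar; [lra|]. rewrite plus_INR.
      assert (HP1 : 1 <= 2 * PI) by (assert (HX := PI2_1); lra).
      assert (1 * (INR N + INR k) <= 2 * PI * (INR N + INR k)) by (apply Rmult_le_compat_r; lra). lra.
    - replace 0 with (2 * 0) at 1 by ring. apply (filterlim_R_mult eventually); [apply filterlim_const|].
      exact (is_lim_seq_inv _ _ HL ltac:(discriminate)). }
  assert (HT := is_series_telescope v 0 Hv).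
  replace (2 / (2 * PI * INR N + t)) with (Series (fun k => v k - v (S k))).
  2:{ rewrite (is_series_unique _ _ HT). unfold v. rewrite Nat.add_0_r. ring. }
  apply Series_abs_le; [|eexists; exact HT].
  intros k. unfold b. set (n := INR (S N + k)).
  assert (Hn : n = INR (N + k) + 1) by (unfold n; rewrite <- S_INR; f_equal).
  assert (Hp := Hpos k). assert (H0 := pos_INR (N + k)).
  assert (Hw : 0 < 2 * PI * n) by (rewrite Hn; apply Rmult_lt_0_compat; lra).
  eapply Rle_trans; [apply (cauchy_kernel_diff_le _ _ (2 * PI * n))|]; try lra.
  - apply Rabs_le. lra.
  - unfold v. replace (N + S k)%nat with (S N + k)%nat by lia. fold n.
    replace (2 * PI * INR (N + k) + t) with (2 * PI * n + t - 2 * PI) in * by (rewrite Hn; ring).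
    set (z := 2 * PI * n + t) in *.
    replace (2 / (z - 2 * PI) - 2 / z) with (4 * PI * / ((z - 2 * PI) * z)) by (field; lra).
    unfold Rdiv. apply Rmult_le_compat_l; [lra|]. apply Rinv_le_contravar; nra.
Qed.

(** Termwise integration: with [c = 2 PI N], the remainder of the kernel is at most [2 / c] before
    [c] and [2 / t] after it. Splitting the integral at [c] leaves [O(c ^ (s - 1))], which tends to
    0 because [s < 1]. *)
Lemma is_series_hK_mellin (x s : R) : 0 < x < 2 * PI -> 0 < s < 1 ->
  is_series (fun n => Rpower (2 * PI * INR n + x) (s - 1) * cauchy_mellin s
                - Rpower (2 * PI * (INR n + 1) - x) (s - 1) * cauchy_mellin s) (hK_mellin x s).
Proof.
  intros Hx Hs.
  set (l := fun n => Rpower (2 * PI * INR n + x) (s - 1) * cauchy_mellin s - Rpower (2 * PI * (INR n + 1) - x) (s - 1) * cauchy_mellin s).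
  set (b := fun n t => cauchy_kernel (2 * PI * INR n + x) t - cauchy_kernel (2 * PI * (INR n + 1) - x) t).
  assert (Hpos : forall n, 0 < 2 * PI * INR n + x /\ 0 < 2 * PI * (INR n + 1) - x).
  { intros n. assert (H := pos_INR n). assert (0 <= 2 * PI * INR n) by (apply Rmult_le_pos; lra). lra. }
  assert (Hb : forall n, is_RInt_pos (fun t => Rpower t (s - 1) * b n t) (l n)).
  { intros n. destruct (Hpos n) as [Hp1 Hp2].
    apply is_RInt_pos_ext with (2 := is_RInt_pos_minus _ _ _ _ (is_RInt_pos_cauchy_kernel s _ Hs Hp1) (is_RInt_pos_cauchy_kernel s _ Hs Hp2)).
    intros t _. unfold b. ring. }
  assert (Hbc : forall n, continuous_pos (b n)).
  { intros n t Ht. destruct (Hpos n) as [Hp1 Hp2].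
    apply (continuous_minus (V := R_NormedModule) (cauchy_kernel _) (cauchy_kernel _)); now apply continuous_pos_cauchy_kernel. }
  assert (HR : forall N, is_RInt_pos (fun t => Rpower t (s - 1) * (hK x t - sum_n (fun n => b n t) N)) (hK_mellin x s - sum_n l N)).
  { intros N. apply is_RInt_pos_ext with (2 := is_RInt_pos_minus _ _ _ _ (is_RInt_pos_hK_mellin x s Hx Hs) (is_RInt_pos_sum_n _ _ N Hb)).
    intros t _. cbv beta. rewrite Rmult_minus_distr_l. f_equal.
    exact (sum_n_mult_l (K := R_Ring) (Rpower t (s - 1)) (fun n => b n t) N). }
  apply (filterlim_squeeze0 eventually _ (fun N => (2 / s + 2 / (1 - s)) * (Rpower (2 * PI) (s - 1) * Rpower (INR N + 0) (- (1 - s))))).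
  - exists 1%nat. intros N HN. assert (HN1 : 1 <= INR N) by (apply (le_INR 1); lia).
    set (c := 2 * PI * INR N). assert (Hc : 0 < c) by (apply Rmult_lt_0_compat; lra).
    destruct (is_RInt_pos_two_powers (fun t => Rpower t (s - 1) * (hK x t - sum_n (fun n => b n t) N)) (2 / c) 2 c s (1 - s)) as [r [Hr1 Hr2]]; try lra.
    + apply continuous_pos_mult; [apply continuous_pos_Rpower|].
      intros t Ht. apply (continuous_minus (V := R_NormedModule) (hK x) (fun t => sum_n (fun n => b n t) N)); [now apply continuous_pos_hK|].
      clear - Hbc Ht. induction N as [|N IH].
      * apply (continuous_ext (b 0%nat)); [intros; now rewrite sum_O|now apply Hbc].
      * apply (continuous_ext (fun t => sum_n (fun n => b n t) N + b (S N) t)); [intros; now rewrite sum_Sn|].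
        apply (continuous_plus (V := R_NormedModule) (fun t => sum_n (fun n => b n t) N)); [easy|now apply Hbc].
    + apply Rdiv_le_0_compat; lra.
    + intros t Ht. assert (Hr := Rpower_pos t (s - 1)).
      rewrite Rabs_mult, (Rabs_pos_eq (Rpower _ _)), Rmult_comm by lra. apply Rmult_le_compat_r; [lra|].
      eapply Rle_trans; [apply hK_partial_remainder; (easy || lia)|]. fold c.
      unfold Rdiv. apply Rmult_le_compat_l; [lra|]. apply Rinv_le_contravar; lra.
    + intros t Ht. assert (Hr := Rpower_pos t (s - 1)).
      rewrite Rabs_mult, (Rabs_pos_eq (Rpower _ _)) by lra.
      replace (- (1 - s) - 1) with ((s - 1) + - (1)) by ring. rewrite Rpower_plus, Rpower_Ropp, Rpower_1 by lra.
      replace (2 * (Rpower t (s - 1) * / t)) with (Rpower t (s - 1) * (2 / t)) by (unfold Rdiv; ring).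
      apply Rmult_le_compat_l; [lra|].
      eapply Rle_trans; [apply hK_partial_remainder; (easy || lra || lia)|]. fold c.
      unfold Rdiv. apply Rmult_le_compat_l; [lra|]. apply Rinv_le_contravar; lra.
    + assert (E := is_RInt_pos_unique _ _ _ Hr1 (HR N)). rewrite E, Rabs_minus_sym in Hr2.
      eapply Rle_trans; [exact Hr2|]. right.
      assert (Ec : Rpower c s = c * Rpower c (s - 1)).
      { rewrite <- (Rpower_1 c) at 2 by easy. rewrite <- Rpower_plus. f_equal. ring. }
      rewrite Ec. replace (- (1 - s)) with (s - 1) by ring. rewrite Rplus_0_r, Rpower_mult_distr by lra. fold c.
      field. lra.
  - replace 0 with ((2 / s + 2 / (1 - s)) * (Rpower (2 * PI) (s - 1) * 0)) at 1 by ring.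
    apply (filterlim_R_mult eventually); [apply filterlim_const|].
    apply (filterlim_R_mult eventually); [apply filterlim_const|].
    apply is_lim_seq_Rpower_neg. lra.
Qed.

(** The partial fraction side: at [x = 2 PI a] a common power of [2 PI] leaves the series of
    [hdiff a] at [1 - s]. *)
Lemma hK_mellin_hdiff (a s : R) : 0 < a < 1 -> 0 < s < 1 ->
  hK_mellin (2 * PI * a) s = cauchy_mellin s * Rpower (2 * PI) (s - 1) * hdiff a (1 - s).
Proof.
  intros Ha Hs. assert (HPI := PI_RGT_0).
  assert (Hx : 0 < 2 * PI * a < 2 * PI).
  { split; [apply Rmult_lt_0_compat; lra|]. rewrite <- (Rmult_1_r (2 * PI)) at 2. apply Rmult_lt_compat_l; lra. }
  rewrite <- (is_series_unique _ _ (is_series_hK_mellin _ s Hx Hs)).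
  unfold hdiff. rewrite <- Series_scal_l. apply Series_ext. intros n. assert (Hn := pos_INR n).
  replace (- (1 - s)) with (s - 1) by ring.
  replace (2 * PI * INR n + 2 * PI * a) with (2 * PI * (INR n + a)) by ring.
  replace (2 * PI * (INR n + 1) - 2 * PI * a) with (2 * PI * (INR n + 1 - a)) by ring.
  rewrite <- !Rpower_mult_distr by lra. ring.
Qed.

(** * The sine expansion of the kernel and its Mellin transform *)

Lemma rsum_sin_exp (x t : R) (N : nat) :
  rsum (fun m => sin (INR (S m) * x) * exp (- (INR (S m) * t))) N * (2 * (cosh t - cos x))
  = sin x - exp (- (INR N * t)) * (sin (INR (S N) * x) - exp (- t) * sin (INR N * x)).
Proof.
  induction N as [|N IH].
  - cbn [rsum]. change (INR 0) with 0. change (INR 1) with 1.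
    rewrite !Rmult_0_l, Ropp_0, exp_0, sin_0, !Rmult_1_l. ring.
  - cbn [rsum]. rewrite Rmult_plus_distr_r, IH.
    replace (INR (S (S N)) * x) with (INR (S N) * x + x) by (rewrite (S_INR (S N)); ring).
    replace (INR N * x) with (INR (S N) * x - x) by (rewrite (S_INR N); ring).
    replace (exp (- (INR N * t))) with (exp (- (INR (S N) * t)) * exp t)
      by (rewrite <- exp_plus; f_equal; rewrite (S_INR N); ring).
    rewrite sin_plus, sin_minus. unfold cosh.
    assert (E : exp t * exp (- t) = 1) by (rewrite <- exp_plus, Rplus_opp_r; apply exp_0).
    set (u := exp (- (INR (S N) * t))) in *. set (y := INR (S N) * x).
    set (A := exp t) in *. set (B := exp (- t)) in *.
    replace (u * A * (sin y - B * (sin y * cos x - cos y * sin x)))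
      with (u * (A * sin y - (A * B) * (sin y * cos x - cos y * sin x))) by ring.
    rewrite E. field.
Qed.

(** When [N x] is a multiple of [2 PI] the boundary term is itself a multiple of the kernel, so the
    truncation error is explicit. *)
Lemma rsum_sin_exp_period (x t : R) (N : nat) : 0 < x < 2 * PI -> sin (INR N * x) = 0 -> cos (INR N * x) = 1 ->
  rsum (fun m => sin (INR (S m) * x) * exp (- (INR (S m) * t))) N = hK x t - exp (- (INR N * t)) * hK x t.
Proof.
  intros Hx H1 H2. assert (H := rsum_sin_exp x t N). assert (Hp := cosh_minus_cos_pos x t Hx).
  replace (INR (S N) * x) with (INR N * x + x) in H by (rewrite S_INR; ring).
  rewrite sin_plus, H1, H2 in H. unfold hK.
  apply Rmult_eq_reg_r with (2 * (cosh t - cos x)); [|lra]. rewrite H. field. lra.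
Qed.

Lemma is_RInt_pos_rsum (f : nat -> R -> R) (l : nat -> R) (N : nat) :
  (forall n, is_RInt_pos (f n) (l n)) -> is_RInt_pos (f 0%nat) (l 0%nat) ->
  is_RInt_pos (fun t => rsum (fun n => f n t) (S N)) (rsum l (S N)).
Proof.
  intros H _. induction N as [|N IH].
  - apply is_RInt_pos_ext with (f 0%nat); [intros; simpl; ring|]. simpl. now rewrite Rplus_0_l.
  - apply is_RInt_pos_ext with (2 := is_RInt_pos_plus _ _ _ _ IH (H (S N))). reflexivity.
Qed.

Lemma is_RInt_pos_Gamma_scale (s m : R) : 0 < s -> 0 < m ->
  is_RInt_pos (fun t => Rpower t (s - 1) * exp (- (m * t))) (Rpower m (- s) * Gamma s).
Proof.
  intros Hs Hm.
  assert (H := is_RInt_pos_scal _ (Rpower m (- s)) _ (is_RInt_pos_scale _ m _ Hm (is_RInt_pos_Gamma s Hs))).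
  apply is_RInt_pos_ext with (2 := H). intros t Ht. cbv beta.
  rewrite <- Rpower_mult_distr by easy.
  assert (E : Rpower m (- s) * (m * Rpower m (s - 1)) = 1).
  { rewrite <- (Rpower_1 m) at 2 by easy. rewrite <- !Rpower_plus. replace (- s + (1 + (s - 1))) with 0 by ring. now apply Rpower_O. }
  replace (Rpower m (- s) * (m * (Rpower m (s - 1) * Rpower t (s - 1) * exp (- (m * t)))))
    with (Rpower m (- s) * (m * Rpower m (s - 1)) * (Rpower t (s - 1) * exp (- (m * t)))) by ring.
  rewrite E. ring.
Qed.

(** The truncation error is [exp (- N t) hK x t]; bounding [hK] by its supremum leaves the Gamma
    integral of [exp (- N t)], of size [N ^ - s]. *)
Lemma hK_mellin_partial (x s : R) (N : nat) : 0 < x < 2 * PI -> 0 < s < 1 -> (0 < N)%nat ->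
  sin (INR N * x) = 0 -> cos (INR N * x) = 1 ->
  Rabs (rsum (fun m => sin (INR (S m) * x) * Rpower (INR (S m)) (- s)) N * Gamma s - hK_mellin x s)
    <= / (4 * sin (x / 2) ^ 2) * Gamma s * Rpower (INR N) (- s).
Proof.
  intros Hx Hs HN H1 H2. destruct N as [|N]; [lia|].
  set (l := fun m => sin (INR (S m) * x) * (Rpower (INR (S m)) (- s) * Gamma s)).
  assert (HSm : forall m, 0 < INR (S m)) by (intros; apply lt_0_INR; lia).
  assert (Hl : forall m, is_RInt_pos (fun t => sin (INR (S m) * x) * (Rpower t (s - 1) * exp (- (INR (S m) * t)))) (l m)).
  { intros m. apply is_RInt_pos_scal. apply is_RInt_pos_Gamma_scale; [lra|apply HSm]. }
  assert (HI := is_RInt_pos_rsum _ _ N Hl (Hl 0%nat)).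
  assert (HD := is_RInt_pos_minus _ _ _ _ HI (is_RInt_pos_hK_mellin x s Hx Hs)).
  replace (rsum (fun m => sin (INR (S m) * x) * Rpower (INR (S m)) (- s)) (S N) * Gamma s) with (rsum l (S N)).
  2:{ rewrite Rmult_comm, <- rsum_scal. apply rsum_ext. intros k _. unfold l. ring. }
  set (Cx := / (4 * sin (x / 2) ^ 2)).
  assert (HC := is_RInt_pos_scal _ Cx _ (is_RInt_pos_Gamma_scale s (INR (S N)) ltac:(lra) (HSm N))).
  replace (Cx * Gamma s * Rpower (INR (S N)) (- s)) with (Cx * (Rpower (INR (S N)) (- s) * Gamma s)) by ring.
  apply (is_RInt_pos_abs_le _ _ _ _) with (2 := HD) (3 := HC). intros t Ht. cbv beta.
  assert (E : rsum (fun n => sin (INR (S n) * x) * (Rpower t (s - 1) * exp (- (INR (S n) * t)))) (S N)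
    = Rpower t (s - 1) * (hK x t - exp (- (INR (S N) * t)) * hK x t)).
  { rewrite <- rsum_sin_exp_period by easy. rewrite <- rsum_scal. apply rsum_ext. intros k _. ring. }
  rewrite E. assert (Hr := Rpower_pos t (s - 1)). assert (He := exp_pos (- (INR (S N) * t))).
  replace (Rpower t (s - 1) * (hK x t - exp (- (INR (S N) * t)) * hK x t) - Rpower t (s - 1) * hK x t)
    with (- (Rpower t (s - 1) * exp (- (INR (S N) * t)) * hK x t)) by ring.
  rewrite Rabs_Ropp, Rabs_mult, (Rabs_pos_eq (_ * _)), Rmult_comm by (apply Rmult_le_pos; lra).
  apply Rmult_le_compat_r; [apply Rmult_le_pos; lra|]. now apply hK_bounded.
Qed.

Lemma rsum_mul (f : nat -> R) (q n : nat) : rsum f (n * q) = rsum (fun i => rsum (fun j => f (i * q + j)%nat) q) n.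
Proof.
  induction n as [|n IH]; [easy|]. cbn [rsum]. rewrite <- IH, <- rsum_split. f_equal. simpl. lia.
Qed.

Lemma rsum_exchange (f : nat -> nat -> R) (n m : nat) :
  rsum (fun i => rsum (fun j => f i j) m) n = rsum (fun j => rsum (fun i => f i j) n) m.
Proof.
  induction n as [|n IH]; simpl.
  - induction m as [|m IHm]; simpl; [easy|]. rewrite <- IHm. ring.
  - rewrite IH, rsum_plus. easy.
Qed.

Lemma sin_periodic (k : nat) (p : nat) (x : R) : sin (x + 2 * PI * INR (k * p)) = sin x.
Proof. rewrite <- (sin_period x (k * p)). f_equal. ring. Qed.

Lemma filterlim_rsum (f : nat -> nat -> R) (l : nat -> R) (m : nat) :
  (forall j, (j < m)%nat -> is_lim_seq (fun n => f n j) (l j)) ->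
  is_lim_seq (fun n => rsum (f n) m) (rsum l m).
Proof.
  induction m as [|m IH]; intros H; simpl; [apply is_lim_seq_const|].
  apply (filterlim_R_plus eventually); [apply IH; intros; apply H; lia|apply H; lia].
Qed.

Lemma is_lim_seq_rsum_Series (f : nat -> R) : ex_series f -> is_lim_seq (rsum f) (Series f).
Proof.
  intros H. apply is_lim_seq_incr_1. apply (filterlim_ext (sum_n f)).
  - intros n. induction n as [|n IH]; [rewrite sum_O; simpl; ring|]. rewrite sum_Sn, IH. reflexivity.
  - exact (Series_correct _ H).
Qed.

Definition sine_coef (p q j : nat) : R := sin (2 * PI * INR j * INR p / INR q).

Lemma frac_bounds (q j : nat) : (0 < j)%nat -> (j < q)%nat -> 0 < INR j / INR q < 1.
Proof.
  intros H0 H1. assert (Hq : 0 < INR q) by (apply lt_0_INR; lia). split.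
  - apply Rdiv_lt_0_compat; [now apply lt_0_INR|easy].
  - apply Rmult_lt_reg_r with (INR q); [easy|]. unfold Rdiv. rewrite Rmult_assoc, Rinv_l by lra.
    rewrite Rmult_1_l, Rmult_1_r. now apply lt_INR.
Qed.

Lemma sine_coef_period (p q i j : nat) : (0 < q)%nat ->
  sin (INR (i * q + j) * (2 * PI * (INR p / INR q))) = sine_coef p q j.
Proof.
  intros Hq0.   assert (Hq : 0 < INR q) by (apply lt_0_INR; lia). unfold sine_coef. rewrite <- (sin_periodic i p (2 * PI * INR j * INR p / INR q)). f_equal.
  rewrite plus_INR, !mult_INR. field. lra.
Qed.

Lemma sine_coef_reflect (p q j : nat) : (0 < q)%nat -> (j <= q)%nat -> sine_coef p q (q - j) = - sine_coef p q j.
Proof.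
  intros Hq0 Hj. assert (Hq : 0 < INR q) by (apply lt_0_INR; lia). unfold sine_coef. rewrite minus_INR by easy.
  rewrite <- sin_neg, <- (sin_periodic 1 p (- _)). f_equal. rewrite Nat.mul_1_l. field. lra.
Qed.

Lemma sine_coef_last (p q : nat) : (0 < q)%nat -> sine_coef p q q = 0.
Proof.
  intros Hq0.   assert (Hq : 0 < INR q) by (apply lt_0_INR; lia). unfold sine_coef. rewrite <- sin_0, <- (sin_periodic 1 p 0), Nat.mul_1_l. f_equal. field. lra.
Qed.

(** Average of the sum with its reflection [j -> q - j]; every sum over [j] in the theorem passes
    through this form. *)
Lemma rsum_sine_coef_antisym (p q : nat) (g : nat -> R) : (0 < q)%nat ->
  rsum (fun j => sine_coef p q (S j) * g (S j)) q
  = / 2 * rsum (fun j => sine_coef p q (S j) * (g (S j) - g (q - S j)%nat)) (q - 1).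
Proof.
  (* The term [j = q] has coefficient 0 and is dropped, since its partner would be the index 0. *)
  intros Hq0. transitivity (rsum (fun j => sine_coef p q (S j) * g (S j)) (q - 1)).
  { match goal with |- rsum ?f q = _ => replace (rsum f q) with (rsum f (S (q - 1))) by (f_equal; lia) end.
    cbn [rsum]. replace (S (q - 1)) with q by lia. rewrite sine_coef_last by easy. ring. }
  transitivity (/ 2 * (rsum (fun j => sine_coef p q (S j) * g (S j)) (q - 1) + rsum (fun j => sine_coef p q (S j) * g (S j)) (q - 1))); [field|].
  rewrite (rsum_rev (fun j => sine_coef p q (S j) * g (S j))) at 2. rewrite <- rsum_plus. f_equal.
  apply rsum_ext. intros j Hj.
  replace (S (q - 1 - S j)) with (q - S j)%nat by lia. rewrite sine_coef_reflect by lia. ring.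
Qed.

(** One period of the sine Dirichlet series: pulling out [q ^ - s] and pairing [j] with [q - j]
    turns block [i] into the terms of index [i] of the series [hdiff]. *)
Lemma dirichlet_block (p q : nat) (s : R) (i : nat) : (0 < q)%nat ->
  rsum (fun j => sin (INR (S (i * q + j)) * (2 * PI * (INR p / INR q))) * Rpower (INR (S (i * q + j))) (- s)) q
  = rsum (fun j => / 2 * Rpower (INR q) (- s) * sine_coef p q (S j) *
       (Rpower (INR i + INR (S j) / INR q) (- s) - Rpower (INR i + 1 - INR (S j) / INR q) (- s))) (q - 1).
Proof.
  intros Hq0.
  assert (Hq : 0 < INR q) by (apply lt_0_INR; lia).
  set (g := fun j => Rpower (INR (i * q + j)) (- s)).
  assert (Hsc : forall u, 0 < u -> Rpower (INR q) (- s) * Rpower (INR i + u / INR q) (- s) = Rpower (INR i * INR q + u) (- s)).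
  { intros u Hu. assert (Hi := pos_INR i). assert (0 < u / INR q) by now apply Rdiv_lt_0_compat.
    rewrite Rpower_mult_distr by lra. f_equal. field. lra. }
  transitivity (rsum (fun j => sine_coef p q (S j) * g (S j)) q).
  { apply rsum_ext. intros j _. unfold g. now rewrite <- Nat.add_succ_r, sine_coef_period by easy. }
  rewrite rsum_sine_coef_antisym, <- rsum_scal by easy. apply rsum_ext. intros j Hj.
  assert (HSj : 0 < INR (S j)) by (apply lt_0_INR; lia).
  assert (HSq : INR (S j) < INR q) by (apply lt_INR; lia).
  replace (g (S j)) with (Rpower (INR q) (- s) * Rpower (INR i + INR (S j) / INR q) (- s)).
  2:{ rewrite Hsc by easy. unfold g. now rewrite plus_INR, mult_INR. }
  replace (g (q - S j)%nat) with (Rpower (INR q) (- s) * Rpower (INR i + 1 - INR (S j) / INR q) (- s)).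
  2:{ replace (INR i + 1 - INR (S j) / INR q) with (INR i + (INR q - INR (S j)) / INR q) by (field; lra).
      rewrite Hsc by lra. unfold g. now rewrite plus_INR, mult_INR, minus_INR by lia. }
  ring.
Qed.

(** Partial sums are taken only at multiples of [q]: there the truncation error is explicit, and
    complete blocks regroup into differences whose series converge for every [s > 0]. *)
Lemma hK_mellin_Gamma (p q : nat) (s : R) : (0 < p)%nat -> (p < q)%nat -> 0 < s < 1 ->
  hK_mellin (2 * PI * (INR p / INR q)) s
  = Gamma s * (/ 2 * Rpower (INR q) (- s) * rsum (fun j => sine_coef p q (S j) * hdiff (INR (S j) / INR q) s) (q - 1)).
Proof.
  intros Hp Hpq Hs. assert (Hq : 0 < INR q) by (apply lt_0_INR; lia). assert (HPI := PI_RGT_0). assert (Ha := frac_bounds q p Hp Hpq).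
  assert (Hx : 0 < 2 * PI * (INR p / INR q) < 2 * PI).
  { split; [apply Rmult_lt_0_compat; lra|]. rewrite <- (Rmult_1_r (2 * PI)) at 2. apply Rmult_lt_compat_l; lra. }
  set (D := fun N => rsum (fun m => sin (INR (S m) * (2 * PI * (INR p / INR q))) * Rpower (INR (S m)) (- s)) N).
  assert (L1 : is_lim_seq (fun n => D (S n * q)%nat * Gamma s) (hK_mellin (2 * PI * (INR p / INR q)) s)).
  { set (K := / (4 * sin (2 * PI * (INR p / INR q) / 2) ^ 2) * Gamma s).
    assert (HK : 0 < K).
    { apply Rmult_lt_0_compat; [|apply Gamma_pos; lra]. apply Rinv_0_lt_compat.
      assert (0 < sin (2 * PI * (INR p / INR q) / 2) ^ 2) by now apply pow_lt, sin_half_pos. lra. }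
    apply (filterlim_squeeze0 eventually _ (fun n => K * Rpower (INR n + 1) (- s))).
    - exists 0%nat. intros n _. eapply Rle_trans.
      + apply hK_mellin_partial; try easy; [nia| |].
        * replace (S n * q)%nat with (S n * q + 0)%nat by lia. rewrite sine_coef_period by lia. unfold sine_coef. simpl (INR 0).
          replace (2 * PI * 0 * INR p / INR q) with 0 by (field; lra). apply sin_0.
        * replace (INR (S n * q) * (2 * PI * (INR p / INR q))) with (0 + 2 * INR (S n * p) * PI)
            by (rewrite !mult_INR; field; lra). rewrite cos_period. apply cos_0.
      + fold K. apply Rmult_le_compat_l; [lra|]. assert (Hn := pos_INR n). apply Rpower_antitone; [|lra].
        split; [lra|]. rewrite <- S_INR. apply le_INR. nia.
    - replace 0 with (K * 0) at 1 by ring. apply (filterlim_R_mult eventually); [apply filterlim_const|].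
      apply is_lim_seq_Rpower_neg. lra. }
  set (F := fun i j => / 2 * Rpower (INR q) (- s) * sine_coef p q (S j) *
       (Rpower (INR i + INR (S j) / INR q) (- s) - Rpower (INR i + 1 - INR (S j) / INR q) (- s))).
  assert (ED : forall n, D (n * q)%nat = rsum (fun j => rsum (fun i => F i j) n) (q - 1)).
  { intros n. unfold D. rewrite rsum_mul.
    rewrite <- (rsum_exchange F). apply rsum_ext. intros i _. apply dirichlet_block. lia. }
  assert (L2 : is_lim_seq (fun n => D (S n * q)%nat * Gamma s)
    (rsum (fun j => / 2 * Rpower (INR q) (- s) * sine_coef p q (S j) * hdiff (INR (S j) / INR q) s) (q - 1) * Gamma s)).
  { apply (filterlim_R_mult eventually); [|apply filterlim_const].
    apply (filterlim_ext (fun n => rsum (fun j => rsum (fun i => F i j) (S n)) (q - 1))); [intros; now rewrite ED|].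
    apply filterlim_rsum. intros j Hj.
    assert (Hu : 0 < INR (S j) / INR q < 1) by (apply frac_bounds; lia).
    apply (is_lim_seq_incr_1 (fun n => rsum (fun i => F i j) n)).
    unfold hdiff. rewrite <- Series_scal_l. apply is_lim_seq_rsum_Series.
    apply ex_series_Rscal. apply hdiff_ex_series; [easy|lra]. }
  apply is_lim_seq_unique in L1. apply is_lim_seq_unique in L2. rewrite L1 in L2. apply (f_equal real) in L2. cbn [real] in L2. rewrite L2.
  rewrite Rmult_comm. f_equal. rewrite <- rsum_scal. apply rsum_ext. intros; ring.
Qed.

(** Two evaluations of one Mellin transform; classically, Hurwitz's formula at a rational
    argument. *)
Lemma hdiff_functional_equation (p q : nat) (s : R) : (0 < p)%nat -> (p < q)%nat -> 0 < s < 1 ->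
  cauchy_mellin s * Rpower (2 * PI) (s - 1) * hdiff (INR p / INR q) (1 - s)
  = Gamma s * (/ 2 * Rpower (INR q) (- s) * rsum (fun j => sine_coef p q (S j) * hdiff (INR (S j) / INR q) s) (q - 1)).
Proof.
  intros Hp Hpq Hs. rewrite <- hK_mellin_hdiff by (easy || now apply frac_bounds). now apply hK_mellin_Gamma.
Qed.

(** * The expansion of the Mellin transform of the Cauchy kernel *)

(** This is [zeta(2)], kept symbolic until its value is needed. *)
Definition inv_sqr_sum : R := Series (fun n => (/ (INR n + 1)) ^ 2).

Lemma filterlim_id_at_right_0 : filterlim (fun s : R => s) (at_right 0) (locally 0).
Proof. apply filterlim_ext with (2 := filterlim_at_right_0_linear 1). intros; apply Rmult_1_l. Qed.

(** The derivative of [sin y - y cos y - y ^ 3 / 3] is [y (sin y - y)], so the mean value theorem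
    gives the error after a cubic bound on [sin y - y]. *)
Lemma sin_minus_x_cos (y : R) : 0 < y <= 1 -> Rabs ((sin y - y * cos y) / y ^ 3 - / 3) <= y.
Proof.
  intros Hy.
  destruct (MVT_gen (fun y => sin y - y * cos y - y ^ 3 / 3) 0 y (fun y => y * (sin y - y))) as [c [Hc E]].
  - intros x _. auto_derive; [easy|]. field.
  - intros x _. apply continuity_pt_filterlim.
    apply (ex_derive_continuous (K := R_AbsRing) (V := R_NormedModule) (fun y => sin y - y * cos y - y ^ 3 / 3)).
    auto_derive. easy.
  - rewrite Rmin_left, Rmax_right in Hc by lra. rewrite sin_0 in E.
    replace ((sin y - y * cos y) / y ^ 3 - / 3) with ((c * (sin c - c)) * y / y ^ 3).
    2:{ replace (c * (sin c - c) * y) with (sin y - y * cos y - y ^ 3 / 3) by lra. field. lra. }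

    assert (HC : Rabs (sin c - c) <= y ^ 3).
    { destruct (MVT_gen (fun x => x - sin x) 0 c (fun x => 1 - cos x)) as [d [Hd E2]].
      - intros x _. auto_derive; [easy|]. ring.
      - intros x _. apply continuity_pt_filterlim.
        apply (ex_derive_continuous (K := R_AbsRing) (V := R_NormedModule) (fun x => x - sin x)). auto_derive. easy.
      - rewrite Rmin_left, Rmax_right in Hd by lra. rewrite sin_0 in E2.
        assert (H1 : 1 - cos d = 2 * sin (d / 2) ^ 2).
        { replace d with (2 * (d / 2)) at 1 by field. rewrite cos_2a_sin. ring. }
        assert (H2 : 0 <= sin (d / 2) <= d / 2).
        { split; [apply sin_ge_0; assert (H := PI2_1); lra|].
          destruct (Req_dec (d / 2) 0) as [->|H]; [rewrite sin_0; lra|left; apply sin_lt_x; lra]. }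
        assert (H4 : 0 <= sin (d / 2) ^ 2) by apply pow2_ge_0.
        rewrite Rabs_minus_sym. replace (c - sin c) with ((1 - cos d) * c) by lra.
        rewrite H1, Rabs_pos_eq by (apply Rmult_le_pos; lra).
        replace (y ^ 3) with (y ^ 2 * y) by ring. apply Rmult_le_compat; lra || nra. }
    assert (Hy3 : 0 < y ^ 3) by (apply pow_lt; lra).
    unfold Rdiv. rewrite Rabs_mult, Rabs_inv, (Rabs_pos_eq (y ^ 3)) by lra.
    rewrite !Rabs_mult, (Rabs_pos_eq c), (Rabs_pos_eq y) by lra.
    apply Rmult_le_reg_r with (y ^ 3); [easy|]. rewrite Rmult_assoc, Rinv_l, Rmult_1_r by lra.
    assert (H0 := Rabs_pos (sin c - c)).
    apply Rle_trans with (1 * y ^ 3 * y); [|lra].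
    apply Rmult_le_compat_r; [lra|]. apply Rmult_le_compat; lra.
Qed.

(* At [t = 0] the kernel is [cot (x / 2) / 2]. *)
Lemma cot_expansion (x : R) : 0 < x <= 1 ->
  (/ x - hK x 0) / x = Series (fun n => 2 / ((2 * PI * (INR n + 1)) ^ 2 - x ^ 2)).
Proof.
  intros Hx. assert (HPI : 2 < PI) by (assert (H := PI2_1); lra).
  assert (H := is_series_hK x 0 ltac:(lra)).
  assert (Hn1 : forall n, PI * 1 <= PI * (INR n + 1)) by (intros n; assert (H0 := pos_INR n); apply Rmult_le_compat_l; lra).
  (* [1 / x] as a telescoping series: subtracting the expansion of the kernel leaves in each term
     the difference of [1 / (2 PI (n + 1) - x)] and [1 / (2 PI (n + 1) + x)]. *)
  assert (HT : is_series (fun n => / (2 * PI * INR n + x) - / (2 * PI * INR (S n) + x)) (/ x)).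
  { assert (HL : is_lim_seq (fun n => / (2 * PI * INR n + x)) 0).
    { apply (filterlim_squeeze0 eventually _ (fun n => / INR n)).
      - exists 1%nat. intros n Hn. assert (Hn' : 1 <= INR n) by (apply (le_INR 1); lia).
        assert (1 * INR n <= PI * INR n) by (apply Rmult_le_compat_r; lra).
        rewrite Rminus_0_r, Rabs_pos_eq by (left; apply Rinv_0_lt_compat; lra).
        apply Rinv_le_contravar; lra.
      - apply (is_lim_seq_inv _ p_infty); [apply is_lim_seq_INR|easy]. }
    assert (HT := is_series_telescope _ _ HL). cbv beta in HT. change (INR 0) with 0 in HT.
    now rewrite Rmult_0_r, Rplus_0_l, Rminus_0_r in HT. }
  assert (HD := is_series_minus _ _ _ _ HT H).
  apply is_series_scal_r with (c := / x) in HD.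
  symmetry. apply is_series_unique. apply is_series_ext with (2 := HD). intros n. specialize (Hn1 n). eq_in_R.
  unfold plus, opp, cauchy_kernel; simpl. rewrite !Rmult_0_l, !Rplus_0_r, !Rmult_1_r.
  change (match n with 0%nat => 1 | S _ => INR n + 1 end) with (INR (S n)). rewrite S_INR.
  field. repeat split; try lra. nra.
Qed.

(** Two limits of the same quotient as [x] tends to 0: the series gives [zeta(2) / (2 PI ^ 2)], the
    closed form of the cotangent gives 1/12. *)
Lemma inv_sqr_sum_eq : inv_sqr_sum = PI ^ 2 / 6.
Proof.
  assert (HPI : 2 < PI) by (assert (H := PI2_1); lra).
  destruct (filterlim_Series (at_right 0) (fun x n => 2 / ((2 * PI * (INR n + 1)) ^ 2 - x ^ 2))
    (fun n => / (2 * PI ^ 2) * (/ (INR n + 1)) ^ 2) (fun n => 2 * (/ (INR n + 1)) ^ 2)) as [_ H].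
  - intros n. assert (Hn := pos_INR n).
    assert (L1 := filterlim_R_mult (at_right 0) _ _ _ _ filterlim_id_at_right_0 filterlim_id_at_right_0).
    assert (L2 := filterlim_R_minus (at_right 0) (fun _ => (2 * PI * (INR n + 1)) ^ 2) _ _ _ (filterlim_const _) L1).
    assert (Hne : (2 * PI * (INR n + 1)) ^ 2 - 0 * 0 <> 0).
    { rewrite Rmult_0_l, Rminus_0_r. apply pow_nonzero. nra. }
    assert (L3 := filterlim_R_mult (at_right 0) (fun _ => 2) _ _ _ (filterlim_const _) (filterlim_R_inv (at_right 0) _ _ Hne L2)).
    replace (/ (2 * PI ^ 2) * (/ (INR n + 1)) ^ 2) with (2 * / ((2 * PI * (INR n + 1)) ^ 2 - 0 * 0)) by (field; lra).
    apply filterlim_ext with (2 := L3). intros t. unfold Rdiv. f_equal. f_equal. ring.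
  - apply filter_imp with (2 := at_right_0_lt 1 Rlt_0_1). intros x Hx n. assert (Hn := pos_INR n).
    set (m := INR n + 1) in *. assert (Hm : 1 <= m) by (unfold m; lra).
    assert (Hm2 : 1 <= m ^ 2) by (rewrite <- (pow1 2); apply pow_incr; lra).
    assert (HP2 : 4 <= PI ^ 2) by (replace 4 with (2 ^ 2) by ring; apply pow_incr; lra).
    assert (HD : m ^ 2 <= (2 * PI * m) ^ 2 - x ^ 2).
    { replace ((2 * PI * m) ^ 2) with (4 * PI ^ 2 * m ^ 2) by ring. nra. }
    unfold Rdiv. rewrite Rabs_pos_eq by (apply Rmult_le_pos; [lra|left; apply Rinv_0_lt_compat; lra]).
    apply Rmult_le_compat_l; [lra|]. rewrite pow_inv. apply Rinv_le_contravar; lra.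
  - apply ex_series_Rscal, ex_series_inv_sqr.
  (* The quotient equals one eighth of [(sin y - y cos y) / y ^ 3] times [x / sin y] with
     [y = x / 2], hence the limit [1/8 * 1/3 * 2]. *)
  - assert (L : filterlim (fun x => (/ x - hK x 0) / x) (at_right 0) (locally (/ 12))).
    { assert (LS : filterlim (fun x => sin (x / 2) / x) (at_right 0) (locally (/ 2))).
      { apply (filterlim_slope_0 (fun x => sin (x / 2))); [unfold Rdiv; now rewrite Rmult_0_l, sin_0|].
        auto_derive; [easy|]. unfold Rdiv. rewrite !Rmult_0_l, cos_0. field. }
      assert (LN : filterlim (fun x => (sin (x / 2) - x / 2 * cos (x / 2)) / (x / 2) ^ 3) (at_right 0) (locally (/ 3))).
      { apply (filterlim_squeeze0 (at_right 0) _ (fun x => / 2 * x)); [|apply filterlim_at_right_0_linear].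
        apply filter_imp with (2 := at_right_0_lt 1 Rlt_0_1). intros x Hx.
        replace (/ 2 * x) with (x / 2) by field. apply sin_minus_x_cos. lra. }
      assert (LI := filterlim_R_inv (at_right 0) _ _ (Rinv_neq_0_compat 2 ltac:(lra)) LS).
      assert (L := filterlim_R_mult (at_right 0) (fun _ => / 8) _ _ _ (filterlim_const _) (filterlim_R_mult (at_right 0) _ _ _ _ LN LI)).
      replace (/ 12) with (/ 8 * (/ 3 * / / 2)) by field.
      apply filterlim_ext_loc with (2 := L).
      apply filter_imp with (2 := at_right_0_lt 1 Rlt_0_1). intros x Hx.
      assert (Hs := sin_half_pos x ltac:(lra)).
      unfold hK. rewrite cosh_minus_cos. replace (0 / 2) with 0 by field. rewrite sinh_0.
      replace (sin x) with (2 * sin (x / 2) * cos (x / 2)) by (rewrite <- sin_2a; f_equal; field).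
      field. repeat split; lra || nra. }
    assert (HZ : Series (fun n => / (2 * PI ^ 2) * (/ (INR n + 1)) ^ 2) = / 12).
    { apply (filterlim_locally_unique (F := at_right 0) (fun x => (/ x - hK x 0) / x)); [|exact L].
      apply filterlim_ext_loc with (2 := H). apply filter_imp with (2 := at_right_0_lt 1 Rlt_0_1).
      intros x Hx. symmetry. apply cot_expansion. lra. }
    rewrite Series_scal_l in HZ. fold inv_sqr_sum in HZ.
    apply Rmult_eq_reg_l with (/ (2 * PI ^ 2)).
    + rewrite HZ. field. lra.
    + apply Rinv_neq_0_compat. assert (0 < PI ^ 2) by (apply pow_lt; lra). lra.
Qed.

(** * The alternating series for the Mellin transform of the Cauchy kernel *)

Lemma is_derive_rsum (f df : nat -> R -> R) (N : nat) (t : R) :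
  (forall k, is_derive (f k) t (df k t)) ->
  is_derive (fun t => rsum (fun k => f k t) N) t (rsum (fun k => df k t) N).
Proof.
  intros H. induction N as [|N IH]; simpl.
  - apply (is_derive_const (K := R_AbsRing) (V := R_NormedModule)).
  - exact (is_derive_plus (K := R_AbsRing) (V := R_NormedModule) _ _ _ _ _ IH (H N)).
Qed.

Lemma is_derive_rsum_Rpower (c y : nat -> R) (N : nat) (t : R) : 0 < t -> (forall k, y k <> 0) ->
  is_derive (fun t => rsum (fun k => c k / y k * Rpower t (y k)) N) t (rsum (fun k => c k * Rpower t (y k - 1)) N).
Proof.
  intros Ht Hy. apply (is_derive_rsum (fun k t => c k / y k * Rpower t (y k)) (fun k t => c k * Rpower t (y k - 1))).
  intros k. replace (c k * Rpower t (y k - 1)) with (c k / y k * (y k * Rpower t (y k - 1))) by (field; apply Hy).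
  exact (is_derive_scal (fun t => Rpower t (y k)) t (c k / y k) _ (is_derive_Rpower (y k) t Ht)).
Qed.

Lemma continuous_pos_rsum (f : nat -> R -> R) (N : nat) : (forall k, continuous_pos (f k)) ->
  continuous_pos (fun t => rsum (fun k => f k t) N).
Proof.
  intros H. induction N as [|N IH]; simpl.
  - intros t _. apply continuous_const.
  - now apply continuous_pos_plus.
Qed.

Lemma RInt_primitive_approx (f P dP : R -> R) (a b y : R) : 0 < a -> a <= b -> y <> 0 ->
  continuous_pos f -> continuous_pos dP -> (forall t, 0 < t -> is_derive P t (dP t)) ->
  (forall t, a <= t <= b -> Rabs (f t - dP t) <= Rpower t (y - 1)) ->
  Rabs (RInt f a b - (P b - P a)) <= (Rpower b y - Rpower a y) / y.
Proof.
  intros Ha Hab Hy Hf HdP HP H.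
  assert (I1 : is_RInt dP a b (minus (P b) (P a))).
  { apply (is_RInt_derive (V := R_CompleteNormedModule)); intros x Hx; rewrite Rmin_left in Hx by easy; [apply HP|apply HdP]; lra. }
  assert (I2 := RInt_correct (V := R_CompleteNormedModule) _ _ _ (continuous_pos_ex_RInt f a b Hf Ha ltac:(lra))).
  assert (I3 := is_RInt_minus (V := R_NormedModule) _ _ _ _ _ _ I2 I1).
  assert (I4 := is_RInt_Rpower y a b Hy Ha ltac:(lra)).
  exact (norm_RInt_le (V := R_NormedModule) _ _ _ _ _ _ Hab H I3 I4).
Qed.

Lemma rsum_geom_alt (r : R) (N : nat) : 0 <= r -> rsum (fun k => (-1) ^ k * r ^ k) N = (1 - (-1) ^ N * r ^ N) / (1 + r).
Proof.
  intros Hr. induction N as [|N IH]; simpl; [field; lra|]. rewrite IH. field. lra.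
Qed.

(* Expand [1 / (1 + t^2)] in powers of [t] on [(0, 1]] and in powers of [1 / t] on [[1, oo)]. *)
Lemma cauchy_mellin_partial (s : R) (N : nat) : 0 < s < 1 ->
  Rabs (cauchy_mellin s - rsum (fun k => (-1) ^ k * (/ (2 * INR k + s) + / (2 * INR k + 2 - s))) N)
    <= / (2 * INR N + s) + / (2 * INR N + 2 - s).
Proof.
  intros Hs. set (f := fun t => Rpower t (s - 1) * cauchy_kernel 1 t).
  assert (Hf : continuous_pos f).
  { apply continuous_pos_mult; [apply continuous_pos_Rpower|apply continuous_pos_cauchy_kernel; lra]. }
  set (y1 := fun k => 2 * INR k + s). set (y2 := fun k => s - 2 * INR k - 2).
  assert (Hy1 : forall k, 0 < y1 k) by (intros k; assert (H := pos_INR k); unfold y1; lra).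
  assert (Hy2 : forall k, y2 k < 0) by (intros k; assert (H := pos_INR k); unfold y2; lra).
  set (c := fun k => (-1) ^ k).
  set (P := fun t => rsum (fun k => c k / y1 k * Rpower t (y1 k)) N).
  set (Q := fun t => rsum (fun k => c k / y2 k * Rpower t (y2 k)) N).
  (* [E1] and [E2] are the exact remainders of the geometric sums in [- t ^ 2] and [- 1 / t ^ 2];
     [y1 k] and [y2 k] are the exponents of the integrated terms. *)
  assert (E1 : forall t, 0 < t -> f t - rsum (fun k => c k * Rpower t (y1 k - 1)) N = (-1) ^ N * Rpower t (y1 N - 1) / (1 + t ^ 2)).
  { intros t Ht. assert (E : forall k, Rpower t (y1 k - 1) = Rpower t (s - 1) * (t ^ 2) ^ k).
    { intros k. rewrite <- pow_mult, <- Rpower_pow, <- Rpower_plus by easy. f_equal. unfold y1. rewrite mult_INR. simpl. ring. }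
    rewrite (rsum_ext _ (fun k => Rpower t (s - 1) * ((-1) ^ k * (t ^ 2) ^ k))) by (intros k _; rewrite E; unfold c; ring).
    assert (H2 : 0 <= t ^ 2) by apply pow2_ge_0.
    rewrite rsum_scal, rsum_geom_alt, E by easy. unfold f, cauchy_kernel. field. lra. }
  assert (E2 : forall t, 0 < t -> f t - rsum (fun k => c k * Rpower t (y2 k - 1)) N = (-1) ^ N * Rpower t (y2 N - 1) * (t ^ 2 / (1 + t ^ 2))).
  { intros t Ht. assert (Ht2 : 0 < t ^ 2) by now apply pow_lt. assert (Hti : 0 < / t ^ 2) by now apply Rinv_0_lt_compat.
    assert (E : forall k, Rpower t (y2 k - 1) = Rpower t (s - 1) * (/ t ^ 2) * (/ t ^ 2) ^ k).
    { intros k. rewrite pow_inv, <- pow_mult, <- !Rpower_pow, <- !Rpower_Ropp, <- !Rpower_plus by easy.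
      f_equal. unfold y2. rewrite mult_INR. simpl. ring. }
    rewrite (rsum_ext _ (fun k => Rpower t (s - 1) * (/ t ^ 2) * ((-1) ^ k * (/ t ^ 2) ^ k))) by (intros k _; rewrite E; unfold c; ring).
    rewrite rsum_scal, rsum_geom_alt, E by lra. unfold f, cauchy_kernel.
    set (z := (/ t ^ 2) ^ N). field. repeat split; lra || nra. }
  assert (Habs1 : forall n, Rabs ((-1) ^ n) = 1).
  { intros n. rewrite <- RPow_abs, (Rabs_left (-1)) by lra. replace (- -1) with 1 by ring. apply pow1. }
  assert (B1 : forall a, 0 < a -> a <= 1 -> Rabs (RInt f a 1 - (P 1 - P a)) <= / (2 * INR N + s)).
  { intros a Ha Ha1. eapply Rle_trans.
    - apply (RInt_primitive_approx f P (fun t => rsum (fun k => c k * Rpower t (y1 k - 1)) N) a 1 (y1 N)); try easy.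
      + specialize (Hy1 N). lra.
      + apply (continuous_pos_rsum (fun k t => c k * Rpower t (y1 k - 1))). intros k.
        apply continuous_pos_mult; [intros t _; apply continuous_const|apply continuous_pos_Rpower].
      + intros t Ht. apply is_derive_rsum_Rpower; [easy|]. intros k. specialize (Hy1 k). lra.
      + intros t Ht. rewrite E1 by lra. assert (H2 : 0 <= t ^ 2) by apply pow2_ge_0. assert (Hr := Rpower_pos t (y1 N - 1)).
        unfold Rdiv. rewrite !Rabs_mult, Habs1, Rmult_1_l, Rabs_inv, !Rabs_pos_eq by lra.
        rewrite <- (Rmult_1_r (Rpower t (y1 N - 1))) at 2. apply Rmult_le_compat_l; [lra|].
        rewrite <- Rinv_1. apply Rinv_le_contravar; lra.
    - fold (y1 N). specialize (Hy1 N). assert (Hr := Rpower_pos a (y1 N)).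
      assert (R1 : Rpower 1 (y1 N) = 1) by (unfold Rpower; now rewrite ln_1, Rmult_0_r, exp_0).
      rewrite R1. unfold Rdiv. rewrite <- (Rmult_1_l (/ y1 N)) at 2.
      apply Rmult_le_compat_r; [left; now apply Rinv_0_lt_compat|lra]. }
  assert (B2 : forall b, 1 <= b -> Rabs (RInt f 1 b - (Q b - Q 1)) <= / (2 * INR N + 2 - s)).
  { intros b Hb. eapply Rle_trans.
    - apply (RInt_primitive_approx f Q (fun t => rsum (fun k => c k * Rpower t (y2 k - 1)) N) 1 b (y2 N)); try easy; try lra.
      + specialize (Hy2 N). lra.
      + apply (continuous_pos_rsum (fun k t => c k * Rpower t (y2 k - 1))). intros k.
        apply continuous_pos_mult; [intros t _; apply continuous_const|apply continuous_pos_Rpower].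
      + intros t Ht. apply is_derive_rsum_Rpower; [easy|]. intros k. specialize (Hy2 k). lra.
      + intros t Ht. rewrite E2 by lra. assert (H2 : 0 <= t ^ 2) by apply pow2_ge_0. assert (Hr := Rpower_pos t (y2 N - 1)).
        assert (Hq : 0 <= t ^ 2 / (1 + t ^ 2) <= 1).
        { split; [apply Rdiv_le_0_compat; lra|]. apply Rmult_le_reg_r with (1 + t ^ 2); [lra|].
          unfold Rdiv. rewrite Rmult_assoc, Rinv_l; lra. }
        rewrite !Rabs_mult, Habs1, Rmult_1_l, !Rabs_pos_eq by lra.
        rewrite <- (Rmult_1_r (Rpower t (y2 N - 1))) at 2. apply Rmult_le_compat_l; lra.
    - specialize (Hy2 N). assert (Hr := Rpower_pos b (y2 N)).
      assert (R1 : Rpower 1 (y2 N) = 1) by (unfold Rpower; now rewrite ln_1, Rmult_0_r, exp_0).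
      rewrite R1. replace (2 * INR N + 2 - s) with (- y2 N) by (unfold y2; ring).
      replace ((Rpower b (y2 N) - 1) / y2 N) with ((1 - Rpower b (y2 N)) * / - y2 N) by (field; lra).
      rewrite <- (Rmult_1_l (/ - y2 N)) at 2.
      apply Rmult_le_compat_r; [left; apply Rinv_0_lt_compat; lra|lra]. }
  assert (LP : filterlim P (at_right 0) (locally 0)).
  { assert (G : filterlim P (at_right 0) (locally (rsum (fun k => c k / y1 k * 0) N))).
    { unfold P. clear - Hy1. induction N as [|n IH]; simpl; [apply filterlim_const|].
      apply (filterlim_R_plus (at_right 0)); [easy|]. apply (filterlim_R_mult (at_right 0)); [apply filterlim_const|].
      now apply filterlim_Rpower_0. }
    rewrite (rsum_ext _ (fun k => 0 * 0)), rsum_scal, Rmult_0_l in G by (intros; ring). exact G. }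
  assert (LQ : filterlim Q (Rbar_locally p_infty) (locally 0)).
  { assert (G : filterlim Q (Rbar_locally p_infty) (locally (rsum (fun k => c k / y2 k * 0) N))).
    { unfold Q. clear - Hy2. induction N as [|n IH]; simpl; [apply filterlim_const|].
      apply (filterlim_R_plus (Rbar_locally p_infty)); [easy|]. apply (filterlim_R_mult (Rbar_locally p_infty)); [apply filterlim_const|].
      assert (L := is_lim_Rpower_neg (- y2 n) ltac:(specialize (Hy2 n); lra)). rewrite Ropp_involutive in L. exact L. }
    rewrite (rsum_ext _ (fun k => 0 * 0)), rsum_scal, Rmult_0_l in G by (intros; ring). exact G. }
  assert (EPQ : rsum (fun k => c k * (/ (2 * INR k + s) + / (2 * INR k + 2 - s))) N = P 1 - Q 1).
  { unfold P, Q. rewrite <- (Rmult_1_l (rsum (fun k => c k / y2 k * _) N)).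
    replace (rsum (fun k => c k / y1 k * Rpower 1 (y1 k)) N - 1 * rsum (fun k => c k / y2 k * Rpower 1 (y2 k)) N)
      with (rsum (fun k => c k / y1 k * Rpower 1 (y1 k)) N + -1 * rsum (fun k => c k / y2 k * Rpower 1 (y2 k)) N) by ring.
    rewrite <- rsum_scal, <- rsum_plus. apply rsum_ext. intros k _.
    assert (R1 : forall y, Rpower 1 y = 1) by (intros y; unfold Rpower; now rewrite ln_1, Rmult_0_r, exp_0).
    rewrite !R1. specialize (Hy1 k). specialize (Hy2 k). unfold c, y1, y2 in *. field. lra. }
  (* An excess [D] over the bound is refuted by endpoints [a] and [b] at which [P a], [Q b] and the
     error of the truncated integral are each below [D / 3]. *)
  rewrite EPQ. apply Rnot_lt_le. intros Hlt.
  set (D := Rabs (cauchy_mellin s - (P 1 - Q 1)) - (/ (2 * INR N + s) + / (2 * INR N + 2 - s))) in *.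
  assert (HD : 0 < D) by (unfold D; lra).
  destruct (is_RInt_pos_elim f _ (is_RInt_pos_cauchy_mellin s Hs) (D / 3) ltac:(lra)) as [a0 [b0 [Ha0 [Hb0 HI]]]].
  assert (HA := at_right_0_lt (Rmin a0 1) ltac:(apply Rmin_glb_lt; lra)).
  assert (HB := proj1 (filterlim_R_spec (at_right 0) P 0) LP (D / 3) ltac:(lra)).
  destruct (filter_ex (F := at_right 0) _ (filter_and (F := at_right 0) _ _ HA HB)) as [a [Ha HPa]].
  destruct (proj1 (filterlim_R_spec (Rbar_locally p_infty) Q 0) LQ (D / 3) ltac:(lra)) as [M HM].
  set (b := Rmax (M + 1) (Rmax (b0 + 1) 1)).
  assert (M + 1 <= b) by apply Rmax_l.
  assert (Hb' : Rmax (b0 + 1) 1 <= b) by apply Rmax_r.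
  assert (b0 + 1 <= b) by (eapply Rle_trans; [apply Rmax_l|exact Hb']).
  specialize (HM b ltac:(lra)).
  assert (Ha1 : a < a0) by (eapply Rlt_le_trans; [apply Ha|apply Rmin_l]).
  assert (Ha2 : a < 1) by (eapply Rlt_le_trans; [apply Ha|apply Rmin_r]).
  specialize (HI a b ltac:(lra) ltac:(lra)).
  rewrite <- (RInt_Chasles (V := R_CompleteNormedModule) f a 1 b) in HI by (apply continuous_pos_ex_RInt; (easy || lra)).
  specialize (B1 a ltac:(lra) ltac:(lra)). specialize (B2 b ltac:(lra)).
  unfold plus in HI; simpl in HI. rewrite Rminus_0_r in HPa, HM.
  unfold D in *. clear D.
  set (X := RInt f a 1) in *. set (Y := RInt f 1 b) in *.
  revert HI B1 B2 HPa HM Hlt HD. clear.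
  unfold Rabs. repeat destruct Rcase_abs; lra.
Qed.

Lemma Rabs_pow_m1 (n : nat) : Rabs ((-1) ^ n) = 1.
Proof.
  rewrite <- RPow_abs, (Rabs_left (-1)) by lra. replace (- -1) with 1 by ring. apply pow1.
Qed.

Lemma is_lim_seq_rsum_of (f : nat -> R) (l : R) : is_lim_seq (rsum f) l -> is_series f l.
Proof.
  intros H. apply is_lim_seq_incr_1 in H. unfold is_series. apply filterlim_ext with (2 := H).
  intros n. induction n as [|n IH]; [rewrite sum_O; simpl; apply Rplus_0_l|].
  rewrite sum_Sn, <- IH. reflexivity.
Qed.

(** Among the first [2 N] terms, those with a minus sign form a quarter of the sum of [N] terms;
    removing them twice leaves [zeta(2) - zeta(2) / 2]. *)
Lemma alternating_inv_sqr : is_series (fun k => (-1) ^ k * (/ (INR k + 1)) ^ 2) (inv_sqr_sum / 2).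
Proof.
  set (x := fun k => (/ (INR k + 1)) ^ 2).
  assert (Hex : ex_series (fun k => (-1) ^ k * x k)).
  { apply ex_series_Rle with (2 := ex_series_inv_sqr). intros k.
    rewrite Rabs_mult, Rabs_pow_m1, Rmult_1_l, Rabs_pos_eq by apply pow2_ge_0. apply Rle_refl. }
  assert (E : forall N, rsum (fun k => (-1) ^ k * x k) (2 * N) = rsum x (2 * N) - / 2 * rsum x N).
  { induction N as [|N IH]; [simpl; ring|].
    replace (2 * S N)%nat with (S (S (2 * N))) by lia. cbn [rsum]. rewrite IH.
    assert (Hx : x (S (2 * N)) = / 4 * x N).
    { unfold x. rewrite S_INR, mult_INR. change (INR 2) with 2. assert (H := pos_INR N). field. lra. }
    rewrite Hx. replace ((-1) ^ (2 * N)) with 1 by (rewrite pow_1_even; easy).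
    replace ((-1) ^ S (2 * N)) with (-1) by (rewrite pow_1_odd; easy). lra. }
  assert (Hphi : filterlim (fun N => (2 * N)%nat) eventually eventually).
  { apply eventually_subseq. intros n. lia. }
  assert (L1 := filterlim_comp _ _ _ _ _ _ _ _ Hphi (is_lim_seq_rsum_Series _ Hex)).
  assert (L2 := filterlim_comp _ _ _ _ _ _ _ _ Hphi (is_lim_seq_rsum_Series _ ex_series_inv_sqr)).
  assert (L3 := is_lim_seq_rsum_Series _ ex_series_inv_sqr).
  assert (L4 := filterlim_R_minus eventually _ _ _ _ L2 (filterlim_R_mult eventually (fun _ => / 2) _ _ _ (filterlim_const _) L3)).
  assert (EQ : Series (fun k => (-1) ^ k * x k) = inv_sqr_sum - / 2 * inv_sqr_sum).
  { apply (filterlim_locally_unique (F := eventually) _ _ _ L1).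
    apply filterlim_ext with (2 := L4). intros N. symmetry. apply E. }
  replace (inv_sqr_sum / 2) with (inv_sqr_sum - / 2 * inv_sqr_sum) by field. rewrite <- EQ. now apply Series_correct.
Qed.

(** Regrouping: [1 / (2k + 2 - s)] is paired with the next [1 / (2k + 2 + s)], of opposite sign. The
    first term [1 / s] stays alone and the unpaired last one tends to 0. *)
Lemma cauchy_mellin_series (s : R) : 0 < s < 1 ->
  is_series (fun k => (-1) ^ k * (2 * s / ((2 * INR k + 2) ^ 2 - s ^ 2))) (cauchy_mellin s - / s).
Proof.
  intros Hs. apply is_lim_seq_rsum_of.
  apply (filterlim_squeeze0 eventually _ (fun N => 3 * / INR N)).
  - exists 1%nat. intros N HN. assert (HN1 : 1 <= INR N) by (apply (le_INR 1); lia).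
    assert (E : rsum (fun k => (-1) ^ k * (/ (2 * INR k + s) + / (2 * INR k + 2 - s))) N
      = / s + rsum (fun k => (-1) ^ k * (2 * s / ((2 * INR k + 2) ^ 2 - s ^ 2))) N - (-1) ^ N * / (2 * INR N + s)).
    { clear HN HN1. induction N as [|N IH]; [simpl; rewrite Rmult_0_r, Rplus_0_l; ring|].
      cbn [rsum]. rewrite IH, S_INR, <- (tech_pow_Rmult (-1) N). assert (H := pos_INR N).
      set (z := (-1) ^ N). field. repeat split; lra || nra. }
    assert (H := cauchy_mellin_partial s N Hs). rewrite E in H.
    set (W := rsum (fun k => (-1) ^ k * (2 * s / ((2 * INR k + 2) ^ 2 - s ^ 2))) N) in *.
    assert (H1 : / (2 * INR N + s) <= / INR N) by (apply Rinv_le_contravar; lra).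
    assert (H2 : / (2 * INR N + 2 - s) <= / INR N) by (apply Rinv_le_contravar; lra).
    assert (H3 : Rabs ((-1) ^ N * / (2 * INR N + s)) = / (2 * INR N + s)).
    { rewrite Rabs_mult, Rabs_pow_m1, Rmult_1_l, Rabs_pos_eq; [easy|]. left. apply Rinv_0_lt_compat. lra. }
    set (z := (-1) ^ N * / (2 * INR N + s)) in *.
    replace (W - (cauchy_mellin s - / s)) with (- (cauchy_mellin s - (/ s + W - z)) + z) by ring.
    eapply Rle_trans; [apply Rabs_triang|]. rewrite Rabs_Ropp. lra.
  - replace 0 with (3 * 0) at 1 by ring. apply (filterlim_R_mult eventually); [apply filterlim_const|].
    apply (is_lim_seq_inv _ p_infty); [apply is_lim_seq_INR|easy].
Qed.

Lemma Taylor2_ext (f g : R -> R) (d c0 c1 c2 : R) : 0 < d -> (forall s, 0 < s < d -> f s = g s) ->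
  Taylor2 f c0 c1 c2 -> Taylor2 g c0 c1 c2.
Proof.
  intros Hd H Hf. apply filterlim_ext_loc with (2 := Hf).
  apply filter_imp with (2 := at_right_0_lt d Hd). intros s Hs. now rewrite H.
Qed.

(** [s I(s) - 1] is [s ^ 2] times a series whose limit at 0, by Tannery's theorem, is half the
    alternating sum of inverse squares. *)
Lemma Taylor2_cauchy_mellin : Taylor2 (fun s => s * cauchy_mellin s) 1 0 (inv_sqr_sum / 4).
Proof.
  destruct (filterlim_Series (at_right 0) (fun s k => (-1) ^ k * (2 / ((2 * INR k + 2) ^ 2 - s ^ 2)))
    (fun k => / 2 * ((-1) ^ k * (/ (INR k + 1)) ^ 2)) (fun k => 2 * (/ (INR k + 1)) ^ 2)) as [_ H].
  - intros k. assert (Hk := pos_INR k).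
    assert (L1 := filterlim_R_mult (at_right 0) _ _ _ _ filterlim_id_at_right_0 filterlim_id_at_right_0).
    assert (L2 := filterlim_R_minus (at_right 0) (fun _ => (2 * INR k + 2) ^ 2) _ _ _ (filterlim_const _) L1).
    assert (Hne : (2 * INR k + 2) ^ 2 - 0 * 0 <> 0).
    { rewrite Rmult_0_l, Rminus_0_r. apply pow_nonzero. lra. }
    assert (L3 := filterlim_R_mult (at_right 0) (fun _ => (-1) ^ k * 2) _ _ _ (filterlim_const _) (filterlim_R_inv (at_right 0) _ _ Hne L2)).
    replace (/ 2 * ((-1) ^ k * (/ (INR k + 1)) ^ 2)) with ((-1) ^ k * 2 * / ((2 * INR k + 2) ^ 2 - 0 * 0)) by (field; lra).
    apply filterlim_ext with (2 := L3). intros t. unfold Rdiv. rewrite Rmult_assoc. f_equal. f_equal. f_equal. ring.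
  - apply filter_imp with (2 := at_right_0_lt 1 Rlt_0_1). intros s Hs k. assert (Hk := pos_INR k).
    rewrite Rabs_mult, Rabs_pow_m1, Rmult_1_l.
    set (m := INR k + 1) in *. assert (Hm : 1 <= m) by (unfold m; lra).
    assert (Hm2 : 1 <= m ^ 2) by (rewrite <- (pow1 2); apply pow_incr; lra).
    assert (Hx2 : s ^ 2 <= 1) by (rewrite <- (pow1 2); apply pow_incr; lra).
    replace ((2 * INR k + 2) ^ 2) with (4 * m ^ 2) by (unfold m; ring).
    unfold Rdiv. rewrite Rabs_pos_eq by (apply Rmult_le_pos; [lra|left; apply Rinv_0_lt_compat; lra]).
    apply Rmult_le_compat_l; [lra|]. rewrite pow_inv. apply Rinv_le_contravar; lra.
  - apply ex_series_Rscal, ex_series_inv_sqr.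
  - rewrite Series_scal_l, (is_series_unique _ _ alternating_inv_sqr) in H.
    assert (H' := filterlim_R_minus (at_right 0) _ (fun _ => inv_sqr_sum / 4) _ _ H (filterlim_const _)).
    replace (/ 2 * (inv_sqr_sum / 2) - inv_sqr_sum / 4) with 0 in H' by field.
    apply filterlim_ext_loc with (2 := H').
    apply filter_imp with (2 := at_right_0_lt 1 Rlt_0_1). intros s Hs.
    assert (E := is_series_unique _ _ (cauchy_mellin_series s Hs)).
    replace (cauchy_mellin s) with (/ s + Series (fun k => (-1) ^ k * (2 * s / ((2 * INR k + 2) ^ 2 - s ^ 2)))) by (rewrite E; ring).
    rewrite (Series_ext (fun k => (-1) ^ k * (2 * s / ((2 * INR k + 2) ^ 2 - s ^ 2)))
      (fun k => s * ((-1) ^ k * (2 / ((2 * INR k + 2) ^ 2 - s ^ 2))))) by (intros k; unfold Rdiv; ring).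
    rewrite Series_scal_l. field. lra.
Qed.

(** * Uniqueness and algebra of second order expansions *)

Lemma Taylor2_lim (f : R -> R) (c0 c1 c2 : R) : Taylor2 f c0 c1 c2 -> filterlim f (at_right 0) (locally c0).
Proof.
  intros H. assert (L := filterlim_id_at_right_0).
  assert (L2 := filterlim_R_mult (at_right 0) _ _ _ _ L L).
  assert (L3 := filterlim_R_mult (at_right 0) _ _ _ _ H L2).
  assert (L4 := filterlim_R_plus (at_right 0) _ _ _ _ (filterlim_R_plus (at_right 0) _ _ _ _
     (filterlim_at_right_0_linear c1) (filterlim_R_mult (at_right 0) (fun _ => c2) _ _ _ (filterlim_const _) L2))
     (filterlim_const c0)).
  assert (L5 := filterlim_R_plus (at_right 0) _ _ _ _ L3 L4).
  replace (0 * (0 * 0) + (0 + c2 * (0 * 0) + c0)) with c0 in L5 by ring.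
  apply filterlim_ext_loc with (2 := L5).
  apply filter_imp with (2 := at_right_0_lt 1 Rlt_0_1). intros s Hs. field. lra.
Qed.

Lemma Taylor2_slope (f : R -> R) (c0 c1 c2 : R) : Taylor2 f c0 c1 c2 ->
  filterlim (fun s => (f s - c0) / s) (at_right 0) (locally c1).
Proof.
  intros H. assert (L := filterlim_id_at_right_0).
  assert (L3 := filterlim_R_mult (at_right 0) _ _ _ _ H L).
  assert (L4 := filterlim_R_plus (at_right 0) _ _ _ _ (filterlim_at_right_0_linear c2) (filterlim_const c1)).
  assert (L5 := filterlim_R_plus (at_right 0) _ _ _ _ L3 L4).
  replace (0 * 0 + (0 + c1)) with c1 in L5 by ring.
  apply filterlim_ext_loc with (2 := L5).
  apply filter_imp with (2 := at_right_0_lt 1 Rlt_0_1). intros s Hs. field. lra.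
Qed.

Lemma filterlim_of_slope (f : R -> R) (c0 c1 : R) :
  filterlim (fun s => (f s - c0) / s) (at_right 0) (locally c1) -> filterlim f (at_right 0) (locally c0).
Proof.
  intros H. assert (L3 := filterlim_R_plus (at_right 0) _ _ _ _ (filterlim_R_mult (at_right 0) _ _ _ _ H filterlim_id_at_right_0) (filterlim_const c0)).
  replace (c1 * 0 + c0) with c0 in L3 by ring.
  apply filterlim_ext_loc with (2 := L3).
  apply filter_imp with (2 := at_right_0_lt 1 Rlt_0_1). intros s Hs. field. lra.
Qed.

(** Identifies the first two coefficients of an expansion known only to exist, from a first order
    limit. *)
Lemma Taylor2_unique01 (f : R -> R) (a0 a1 c0 c1 c2 : R) : Taylor2 f c0 c1 c2 ->
  filterlim (fun s => (f s - a0) / s) (at_right 0) (locally a1) -> c0 = a0 /\ c1 = a1.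
Proof.
  intros H Ha. assert (E : c0 = a0).
  { apply (filterlim_locally_unique (F := at_right 0) f); [exact (Taylor2_lim _ _ _ _ H)|exact (filterlim_of_slope _ _ _ Ha)]. }
  split; [easy|]. subst a0.
  apply (filterlim_locally_unique (F := at_right 0) (fun s => (f s - c0) / s)); [exact (Taylor2_slope _ _ _ _ H)|exact Ha].
Qed.

Lemma Taylor2_unique (f : R -> R) (a0 a1 a2 c0 c1 c2 : R) : Taylor2 f a0 a1 a2 -> Taylor2 f c0 c1 c2 ->
  a0 = c0 /\ a1 = c1 /\ a2 = c2.
Proof.
  intros Ha Hc. destruct (Taylor2_unique01 f a0 a1 c0 c1 c2 Hc (Taylor2_slope _ _ _ _ Ha)) as [-> ->].
  split; [easy|]. split; [easy|].
  assert (L := filterlim_R_plus (at_right 0) _ _ _ _ (filterlim_R_minus (at_right 0) _ _ _ _ Ha Hc) (filterlim_const a2)).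
  assert (L' : filterlim (fun _ : R => c2) (at_right 0) (locally (0 - 0 + a2))).
  { apply filterlim_ext_loc with (2 := L).
    apply filter_imp with (2 := at_right_0_lt 1 Rlt_0_1). intros s Hs. field. lra. }
  assert (E := filterlim_locally_unique (F := at_right 0) _ _ _ L' (filterlim_const c2)). lra.
Qed.

Lemma Taylor2_mult (f g : R -> R) (a0 a1 a2 b0 b1 b2 : R) : Taylor2 f a0 a1 a2 -> Taylor2 g b0 b1 b2 ->
  Taylor2 (fun s => f s * g s) (a0 * b0) (a0 * b1 + a1 * b0) (a0 * b2 + a1 * b1 + a2 * b0).
Proof.
  intros Hf Hg. assert (L := filterlim_id_at_right_0).
  assert (L2 := filterlim_R_mult (at_right 0) _ _ _ _ L L).
  assert (L1 := filterlim_R_mult (at_right 0) _ _ _ _ Hf (Taylor2_lim _ _ _ _ Hg)).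
  assert (LP := filterlim_R_plus (at_right 0) _ _ _ _ (filterlim_R_plus (at_right 0) _ _ _ _
     (filterlim_at_right_0_linear a1) (filterlim_R_mult (at_right 0) (fun _ => a2) _ _ _ (filterlim_const _) L2))
     (filterlim_const a0)).
  assert (L3 := filterlim_R_mult (at_right 0) _ _ _ _ Hg LP).
  assert (L4 := filterlim_at_right_0_linear (a1 * b2 + a2 * b1)).
  assert (L5 := filterlim_R_mult (at_right 0) (fun _ => a2 * b2) _ _ _ (filterlim_const _) L2).
  assert (LL := filterlim_R_plus (at_right 0) _ _ _ _ (filterlim_R_plus (at_right 0) _ _ _ _ L1 L3) (filterlim_R_plus (at_right 0) _ _ _ _ L4 L5)).
  replace (0 * b0 + 0 * (0 + a2 * (0 * 0) + a0) + (0 + a2 * b2 * (0 * 0))) with 0 in LL by ring.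
  apply filterlim_ext_loc with (2 := LL).
  apply filter_imp with (2 := at_right_0_lt 1 Rlt_0_1). intros s Hs. field. lra.
Qed.

Lemma Taylor2_const (c : R) : Taylor2 (fun _ => c) c 0 0.
Proof.
  apply (filterlim_ext_loc (F := at_right 0) (fun _ => 0)); [|apply filterlim_const].
  apply filter_imp with (2 := at_right_0_lt 1 Rlt_0_1). intros s Hs. field. lra.
Qed.

Lemma Taylor2_plus (f g : R -> R) (a0 a1 a2 b0 b1 b2 : R) : Taylor2 f a0 a1 a2 -> Taylor2 g b0 b1 b2 ->
  Taylor2 (fun s => f s + g s) (a0 + b0) (a1 + b1) (a2 + b2).
Proof.
  intros Hf Hg. assert (L := filterlim_R_plus (at_right 0) _ _ _ _ Hf Hg). rewrite Rplus_0_r in L.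
  apply filterlim_ext_loc with (2 := L).
  apply filter_imp with (2 := at_right_0_lt 1 Rlt_0_1). intros s Hs. field. lra.
Qed.

Lemma Taylor2_scal (c : R) (f : R -> R) (a0 a1 a2 : R) : Taylor2 f a0 a1 a2 ->
  Taylor2 (fun s => c * f s) (c * a0) (c * a1) (c * a2).
Proof.
  intros H. assert (T := Taylor2_mult _ _ _ _ _ _ _ _ (Taylor2_const c) H).
  now rewrite !Rmult_0_l, !Rplus_0_r in T.
Qed.

Lemma Taylor2_rsum (f : nat -> R -> R) (a0 a1 a2 : nat -> R) (N : nat) :
  (forall k, (k < N)%nat -> Taylor2 (f k) (a0 k) (a1 k) (a2 k)) ->
  Taylor2 (fun s => rsum (fun k => f k s) N) (rsum a0 N) (rsum a1 N) (rsum a2 N).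
Proof.
  induction N as [|N IH]; intros H; simpl; [apply Taylor2_const|].
  apply (Taylor2_plus (fun s => rsum (fun k => f k s) N) (f N)); [apply IH; intros; apply H; lia|apply H; lia].
Qed.

Lemma exp_Taylor2_bound : exists M, forall x, Rabs x <= 1 -> Rabs (exp x - 1 - x - x ^ 2 / 2) <= M * Rabs x * x ^ 2.
Proof.
  set (a := fun k => / INR (Factorial.fact k)).
  assert (Ha : geo_bounded (fun k => RtoC (a k)) 2).
  { exists (exp 2). intros k. rewrite Cmod_R, Rabs_pos_eq by (left; apply Rinv_0_lt_compat, INR_fact_lt_0).
    unfold a. rewrite Rmult_comm. apply pow_fact_le_exp. lra. }
  assert (Ha1 := geo_bounded_incr _ _ Rlt_0_2 Ha). assert (Ha2 := geo_bounded_incr _ _ Rlt_0_2 Ha1).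
  assert (Ha3 := geo_bounded_incr _ _ Rlt_0_2 Ha2).
  destruct (PSeries_bounded (fun k => a (S (S (S k)))) 2 1 Ha3 ltac:(lra)) as [M HM].
  exists M. intros x Hx. assert (Hx2 : Rabs x < 2) by lra.
  assert (E : exp x = PSeries a x).
  { symmetry. apply is_pseries_unique. apply is_exp_Reals. }
  rewrite E, (PSeries_tail a 2), (PSeries_tail (fun k => a (S k)) 2), (PSeries_tail (fun k => a (S (S k))) 2) by easy.
  specialize (HM x Hx). set (P := PSeries (fun k => a (S (S (S k)))) x) in *.
  unfold a. simpl INR.
  match goal with |- Rabs ?e <= _ => replace e with (P * (x * x ^ 2)) by field end.
  rewrite !Rabs_mult, (Rabs_pos_eq (x ^ 2)), <- Rmult_assoc by apply pow2_ge_0.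
  apply Rmult_le_compat_r; [apply pow2_ge_0|]. apply Rmult_le_compat_r; [apply Rabs_pos|easy].
Qed.

(** The constant term of [f] is 0, so [f s = O(s)] and the cubic remainder of [exp] is negligible
    against [s ^ 2]. *)
Lemma Taylor2_exp (f : R -> R) (a1 a2 : R) : Taylor2 f 0 a1 a2 -> Taylor2 (fun s => exp (f s)) 1 a1 (a2 + a1 ^ 2 / 2).
Proof.
  intros H. destruct exp_Taylor2_bound as [M HM].
  assert (L0 := Taylor2_lim _ _ _ _ H). assert (L1 := Taylor2_slope _ _ _ _ H).
  assert (L2 := filterlim_R_mult (at_right 0) _ _ _ _ L1 L1).
  assert (L0a : filterlim (fun s => Rabs (f s)) (at_right 0) (locally 0)).
  { assert (LA : filterlim (fun s => Rabs (f s)) (at_right 0) (locally (Rabs 0))).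
    { apply (filterlim_comp _ _ _ f Rabs _ (locally 0)); [exact L0|]. apply continuous_Rabs. }
    now rewrite Rabs_R0 in LA. }
  assert (L3 : filterlim (fun s => (exp (f s) - 1 - f s - f s ^ 2 / 2) / s ^ 2) (at_right 0) (locally 0)).
  { assert (L4 := filterlim_R_mult (at_right 0) _ _ _ _ (filterlim_R_mult (at_right 0) (fun _ => M) _ _ _ (filterlim_const _) L0a) L2).
    replace (M * 0 * (a1 * a1)) with 0 in L4 by ring.
    apply (filterlim_squeeze0 (at_right 0) _ _ _) with (2 := L4).
    assert (Hb := proj1 (filterlim_R_spec (at_right 0) f 0) L0 1 Rlt_0_1).
    apply filter_imp with (2 := filter_and (F := at_right 0) _ _ (at_right_0_lt 1 Rlt_0_1) Hb).
    intros s [Hs Hfs]. rewrite Rminus_0_r in Hfs |- *. specialize (HM (f s) ltac:(lra)).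
    assert (Hs2 : 0 < s ^ 2) by (apply pow_lt; lra).
    unfold Rdiv. rewrite Rabs_mult, Rabs_inv, (Rabs_pos_eq (s ^ 2)) by lra.
    apply Rmult_le_reg_r with (s ^ 2); [easy|]. rewrite Rmult_assoc, Rinv_l, Rmult_1_r by lra.
    eapply Rle_trans; [exact HM|]. right. rewrite Rminus_0_r. field. lra. }
  assert (L5 := filterlim_R_mult (at_right 0) (fun _ => / 2) _ _ _ (filterlim_const _) (filterlim_R_minus (at_right 0) _ (fun _ => a1 * a1) _ _ L2 (filterlim_const _))).
  assert (L6 := filterlim_R_plus (at_right 0) _ _ _ _ (filterlim_R_plus (at_right 0) _ _ _ _ H L3) L5).
  replace (0 + 0 + / 2 * (a1 * a1 - a1 * a1)) with 0 in L6 by ring.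
  apply filterlim_ext_loc with (2 := L6).
  apply filter_imp with (2 := at_right_0_lt 1 Rlt_0_1). intros s Hs. field. lra.
Qed.

(** In Weierstrass's series each term divided by [s ^ 2] tends to half an inverse square, which also
    bounds it from above for all [s > 0]. *)
Lemma Taylor2_ln_Gamma : Taylor2 (fun s => ln (Gamma (1 + s))) 0 (- euler_gamma) (inv_sqr_sum / 2).
Proof.
  destruct (filterlim_Series (at_right 0) (fun s n => (s * / (INR n + 1) - ln (1 + s * / (INR n + 1))) / s ^ 2)
    (fun n => / 2 * (/ (INR n + 1)) ^ 2) (fun n => / 2 * (/ (INR n + 1)) ^ 2)) as [_ H].
  - intros n. assert (Hn := pos_INR n). set (x := / (INR n + 1)).
    assert (Hx : 0 < x) by (apply Rinv_0_lt_compat; lra).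
    apply (filterlim_squeeze0 (at_right 0) _ (fun s => x ^ 3 * s)); [|apply filterlim_at_right_0_linear].
    apply filter_imp with (2 := at_right_0_lt 1 Rlt_0_1). intros s Hs.
    destruct (ln_1p_Taylor (s * x)) as [_ HT]; [apply Rmult_le_pos; lra|].
    assert (Hs2 : 0 < s ^ 2) by (apply pow_lt; lra).
    replace ((s * x - ln (1 + s * x)) / s ^ 2 - / 2 * x ^ 2) with ((s * x - ln (1 + s * x) - (s * x) ^ 2 / 2) / s ^ 2) by (field; lra).
    unfold Rdiv. rewrite Rabs_mult, Rabs_inv, (Rabs_pos_eq (s ^ 2)) by lra.
    apply Rmult_le_reg_r with (s ^ 2); [easy|]. rewrite Rmult_assoc, Rinv_l, Rmult_1_r by lra.
    eapply Rle_trans; [exact HT|]. right. ring.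
  - apply filter_imp with (2 := at_right_0_lt 1 Rlt_0_1). intros s Hs n. assert (Hn := pos_INR n). set (x := / (INR n + 1)).
    assert (Hx : 0 < x) by (apply Rinv_0_lt_compat; lra).
    destruct (ln_1p_Taylor (s * x)) as [HT _]; [apply Rmult_le_pos; lra|].
    assert (Hs2 : 0 < s ^ 2) by (apply pow_lt; lra).
    unfold Rdiv. rewrite Rabs_mult, Rabs_inv, !Rabs_pos_eq by lra.
    apply Rmult_le_reg_r with (s ^ 2); [easy|]. rewrite Rmult_assoc, Rinv_l, Rmult_1_r by lra.
    eapply Rle_trans; [apply HT|]. right. field.
  - apply ex_series_Rscal, ex_series_inv_sqr.
  - rewrite Series_scal_l in H. fold inv_sqr_sum in H.
    assert (H' := filterlim_R_minus (at_right 0) _ (fun _ => inv_sqr_sum / 2) _ _ H (filterlim_const _)).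
    replace (/ 2 * inv_sqr_sum - inv_sqr_sum / 2) with 0 in H' by field.
    apply filterlim_ext_loc with (2 := H').
    apply filter_imp with (2 := at_right_0_lt 1 Rlt_0_1). intros s Hs.
    rewrite ln_Gamma_1p by lra. unfold Rdiv at 1. rewrite Series_scal_r. field. lra.
Qed.

(** * Conclusion *)

Lemma sum_j_sin (x : R) (n : nat) :
  2 * (1 - cos x) * rsum (fun j => INR (S j) * sin (INR (S j) * x)) n
  = (INR n + 1) * sin (INR n * x) - INR n * sin (INR (S n) * x).
Proof.
  induction n as [|n IH].
  - cbn [rsum]. change (INR 0) with 0. rewrite !Rmult_0_l, sin_0. ring.
  - cbn [rsum]. rewrite Rmult_plus_distr_l, IH.
    replace (INR (S (S n)) * x) with (INR (S n) * x + x) by (rewrite (S_INR (S n)); ring).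
    replace (INR n * x) with (INR (S n) * x - x) by (rewrite (S_INR n); ring).
    rewrite sin_plus, sin_minus, (S_INR n). ring.
Qed.

(** The constant term of the sum on the right of the functional equation. The weights [1 - 2 j / q]
    are an antisymmetrised linear function of [j], and [sum_j_sin] over a full period evaluates the
    sum. *)
Lemma rsum_sine_coef_linear (p q : nat) : (0 < p)%nat -> (p < q)%nat ->
  rsum (fun j => sine_coef p q (S j) * (1 - 2 * (INR (S j) / INR q))) (q - 1) = cot (PI * INR p / INR q).
Proof.
  intros Hp Hpq. assert (Hq : 0 < INR q) by (apply lt_0_INR; lia). assert (HPI := PI_RGT_0).
  assert (Ha := frac_bounds q p Hp Hpq). set (a := INR p / INR q) in *.
  assert (Hy : 0 < PI * a < PI).
  { split; [apply Rmult_lt_0_compat; lra|]. rewrite <- (Rmult_1_r PI) at 2. apply Rmult_lt_compat_l; lra. }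
  assert (Hs := sin_gt_0 (PI * a) ltac:(lra) ltac:(lra)).
  assert (E1 := rsum_sine_coef_antisym p q (fun j => - (2 / INR q) * INR j) ltac:(lia)).
  assert (E2 := sum_j_sin (2 * PI * a) q).
  replace (INR q * (2 * PI * a)) with (0 + 2 * PI * INR (1 * p)) in E2
    by (unfold a; rewrite Nat.mul_1_l; field; lra).
  replace (INR (S q) * (2 * PI * a)) with (2 * PI * a + 2 * PI * INR (1 * p)) in E2
    by (unfold a; rewrite Nat.mul_1_l, S_INR; field; lra).
  rewrite !sin_periodic, sin_0 in E2.
  replace (2 * PI * a) with (2 * (PI * a)) in E2 by ring. rewrite cos_2a_sin, sin_2a in E2.
  set (X := rsum (fun j => INR (S j) * sin (INR (S j) * (2 * (PI * a)))) q) in E2.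
  assert (HX : X = - (INR q * cos (PI * a)) / (2 * sin (PI * a))).
  { apply Rmult_eq_reg_l with (4 * sin (PI * a) ^ 2); [|apply Rgt_not_eq; assert (0 < sin (PI * a) ^ 2) by (now apply pow_lt); lra].
    transitivity (2 * (1 - (1 - 2 * sin (PI * a) * sin (PI * a))) * X); [ring|]. rewrite E2. field. lra. }
  assert (EX : rsum (fun j => sine_coef p q (S j) * (- (2 / INR q) * INR (S j))) q = - (2 / INR q) * X).
  { unfold X. rewrite <- rsum_scal. apply rsum_ext. intros j _.
    rewrite <- (sine_coef_period p q 0 (S j)) by lia. fold a. rewrite Nat.mul_0_l, Nat.add_0_l.
    replace (2 * (PI * a)) with (2 * PI * a) by ring. ring. }
  cbv beta in E1. rewrite EX, HX in E1.
  transitivity (/ 2 * rsum (fun j => sine_coef p q (S j) * (- (2 / INR q) * INR (S j) - - (2 / INR q) * INR (q - S j))) (q - 1)).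
  - rewrite <- rsum_scal. apply rsum_ext. intros j Hj. rewrite minus_INR by lia. field. lra.
  - rewrite <- E1. unfold cot. replace (PI * INR p / INR q) with (PI * a) by (unfold a; field; lra). field. lra.
Qed.

Lemma sum_n_m_1_rsum (f : nat -> R) (q : nat) : sum_n_m f 1 q = rsum (fun j => f (S j)) q.
Proof.
  induction q as [|q IH]; [now rewrite sum_n_m_zero by lia|].
  rewrite sum_n_Sm, IH by lia. reflexivity.
Qed.

Lemma sum_n_m_1_C (f : nat -> C) (q : nat) :
  sum_n_m f 1 q = (rsum (fun j => Re (f (S j))) q, rsum (fun j => Im (f (S j))) q).
Proof.
  induction q as [|q IH]; [now rewrite sum_n_m_zero by lia|].
  rewrite sum_n_Sm, IH by lia. reflexivity.
Qed.

Lemma Re_RtoC_mult (x : R) (z : C) : Re (RtoC x * z)%C = x * Re z.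
Proof. destruct z. unfold Re. simpl. ring. Qed.

Lemma Im_RtoC_mult (x : R) (z : C) : Im (RtoC x * z)%C = x * Im z.
Proof. destruct z. unfold Im. simpl. ring. Qed.

Lemma Taylor2_linear (c : R) : Taylor2 (fun s => c * s) 0 c 0.
Proof.
  apply (filterlim_ext_loc (F := at_right 0) (fun _ => 0)); [|apply filterlim_const].
  apply filter_imp with (2 := at_right_0_lt 1 Rlt_0_1). intros s Hs. field. lra.
Qed.

(** Analyticity at 0 provides the expansion, and the slope computed from Gamma identifies its first
    two coefficients; the third is left as the second derivative that the theorem mentions. *)
Lemma hurwitz_diff_Taylor2 (u : R) (f g : C -> C) : 0 < u < 1 ->
  is_hurwitz_zeta u f -> is_hurwitz_zeta (1 - u) g ->
  Im (C_derive2 f 0 - C_derive2 g 0)%C = 0 /\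
  Taylor2 (hdiff u) (1 - 2 * u) (ln (Gamma u) - ln (Gamma (1 - u))) (Re (C_derive2 f 0 - C_derive2 g 0)%C / 2).
Proof.
  intros Hu Hf Hg. destruct (hurwitz_diff_at_0 u f g Hu Hf Hg) as [c0 [c1 [c2 [E T]]]].
  destruct (Taylor2_unique01 _ _ _ _ _ _ T (hdiff_slope_0 u Hu)) as [<- <-].
  rewrite E. split; [easy|]. replace (Re (RtoC (2 * c2)) / 2) with c2 by (unfold Re; simpl; field). exact T.
Qed.

(** The functional equation multiplied by [s]: the poles of [Gamma s] and [cauchy_mellin s] at 0
    disappear, and [Gamma (1 + s)] with the powers of [2 PI] and [q] becomes one exponential with
    exponent vanishing at 0. *)
Lemma hdiff_product_form (p q : nat) (s : R) : (0 < p)%nat -> (p < q)%nat -> 0 < s < 1 ->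
  s * cauchy_mellin s * hdiff (INR p / INR q) (1 - s)
  = PI * (exp (ln (Gamma (1 + s)) + - ln (2 * PI * INR q) * s)
          * rsum (fun j => sine_coef p q (S j) * hdiff (INR (S j) / INR q) s) (q - 1)).
Proof.
  intros Hp Hpq Hs. assert (Hq : 0 < INR q) by (apply lt_0_INR; lia). assert (HPI := PI_RGT_0).
  assert (E := hdiff_functional_equation p q s Hp Hpq Hs).
  rewrite exp_plus, exp_ln by (apply Gamma_pos; lra). rewrite (Rplus_comm 1 s), Gamma_S by lra.
  replace (exp (- ln (2 * PI * INR q) * s)) with (Rpower (2 * PI) (- s) * Rpower (INR q) (- s)).
  2:{ rewrite Rpower_mult_distr by lra. unfold Rpower. f_equal. ring. }
  set (H := rsum _ (q - 1)) in *.
  assert (HR := Rpower_pos (2 * PI) (s - 1)).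
  assert (E2 : Rpower (2 * PI) (- s) * Rpower (2 * PI) (s - 1) = / (2 * PI)).
  { rewrite <- Rpower_plus. replace (- s + (s - 1)) with (- (1)) by ring. now rewrite Rpower_Ropp, Rpower_1 by lra. }
  apply Rmult_eq_reg_r with (Rpower (2 * PI) (s - 1)); [|lra].
  transitivity (s * (cauchy_mellin s * Rpower (2 * PI) (s - 1) * hdiff (INR p / INR q) (1 - s))); [ring|].
  rewrite E.
  transitivity (PI * (s * Gamma s * Rpower (INR q) (- s) * H) * (Rpower (2 * PI) (- s) * Rpower (2 * PI) (s - 1))); [|ring].
  rewrite E2. field. lra.
Qed.

Theorem mainTheorem5 (zeta : R -> C -> C)
  (Hzeta : forall u : R, 0 < u -> is_hurwitz_zeta u (zeta u))
  (p q : nat) (Hp : (0 < p)%nat) (Hpq : (p < q)%nat) :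
  filterlim
    (fun s : C => (C_derive2 (zeta (INR p / INR q)%R) s
                   - C_derive2 (zeta (1 - INR p / INR q)%R) s)%C)
    (locally' (RtoC 1))
    (locally
       (RtoC (2 * PI) *
          sum_n_m (fun j : nat =>
                     RtoC (sin (2 * PI * INR j * INR p / INR q))
                     * C_derive2 (zeta (INR j / INR q)%R) (RtoC 0)) 1 q
        - RtoC (4 * PI * (euler_gamma + ln (2 * PI * INR q))
                * sum_n_m (fun j : nat =>
                             sin (2 * PI * INR j * INR p / INR q)
                             * ln (Gamma (INR j / INR q))) 1 q)%R
        + RtoC (PI / 2
                * (2 * (euler_gamma + ln (2 * PI * INR q)) ^ 2 + PI ^ 2 / 6)
                * cot (PI * INR p / INR q))%R)%C).
Proof.
  set (a := INR p / INR q). set (L := euler_gamma + ln (2 * PI * INR q)).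
  assert (Hq : 0 < INR q) by (apply lt_0_INR; lia).
  assert (Ha : 0 < a < 1) by now apply frac_bounds.
  destruct (hurwitz_diff_at_1 a (zeta a) (zeta (1 - a)) Ha (Hzeta a ltac:(lra)) (Hzeta (1 - a) ltac:(lra)))
    as [f0 [f1 [f2 [TF Hlim]]]].
  (* The limit exists already; what remains is to compute the coefficient [f2]. *)
  match goal with |- filterlim _ _ (locally ?t) => replace t with (RtoC (2 * f2)); [exact Hlim|] end.
  clear Hlim.
  set (u := fun j => INR (S j) / INR q).
  set (Z := fun j : nat => C_derive2 (zeta (INR j / INR q)) (RtoC 0)).
  assert (HZ : forall j, (j < q - 1)%nat ->
     Im (Z (S j)) = Im (Z (q - S j)%nat) /\
     Taylor2 (hdiff (u j)) (1 - 2 * u j) (ln (Gamma (u j)) - ln (Gamma (1 - u j)))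
       ((Re (Z (S j)) - Re (Z (q - S j)%nat)) / 2)).
  { intros j Hj. assert (Hu : 0 < u j < 1) by (apply frac_bounds; lia).
    destruct (hurwitz_diff_Taylor2 (u j) (zeta (u j)) (zeta (1 - u j)) Hu (Hzeta (u j) ltac:(lra)) (Hzeta (1 - u j) ltac:(lra))) as [HI HT].
    assert (Eu : INR (q - S j) / INR q = 1 - u j).
    { unfold u. rewrite minus_INR by lia. field. lra. }
    unfold Z. rewrite Eu. fold (u j). split; [now apply Rminus_diag_uniq|exact HT]. }
  set (c := sine_coef p q).
  set (h1 := rsum (fun j => c (S j) * (ln (Gamma (u j)) - ln (Gamma (1 - u j)))) (q - 1)).
  set (h2 := rsum (fun j => c (S j) * ((Re (Z (S j)) - Re (Z (q - S j)%nat)) / 2)) (q - 1)).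
  assert (TH : Taylor2 (fun s => rsum (fun j => c (S j) * hdiff (u j) s) (q - 1)) (cot (PI * INR p / INR q)) h1 h2).
  { rewrite <- rsum_sine_coef_linear by easy.
    apply (Taylor2_rsum (fun j s => c (S j) * hdiff (u j) s)). intros j Hj. apply Taylor2_scal. now apply HZ. }
  (* The transport rewrites the constant term [0 + 0] of the exponent to 0, as [Taylor2_exp]
     requires. *)
  assert (TE := Taylor2_exp _ _ _ (eq_rect _ (fun x => Taylor2 _ x _ _)
     (Taylor2_plus _ _ _ _ _ _ _ _ Taylor2_ln_Gamma (Taylor2_linear (- ln (2 * PI * INR q)))) 0 (Rplus_0_r 0))).
  assert (TR := Taylor2_scal PI _ _ _ _ (Taylor2_mult _ _ _ _ _ _ _ _ TE TH)).
  assert (TL := Taylor2_mult _ _ _ _ _ _ _ _ Taylor2_cauchy_mellin TF).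
  assert (TR' := Taylor2_ext _ _ 1 _ _ _ Rlt_0_1 (fun s Hs => eq_sym (hdiff_product_form p q s Hp Hpq Hs)) TR).
  (* Both sides of the product form are expanded. The constant terms give [f0], the quadratic ones a
     linear equation for [f2]. *)
  destruct (Taylor2_unique _ _ _ _ _ _ _ TL TR') as [Q0 [_ Q2]].
  rewrite inv_sqr_sum_eq in Q2.
  assert (Eu : forall j, (j < q - 1)%nat -> INR (q - S j) / INR q = 1 - u j).
  { intros j Hj. unfold u. rewrite minus_INR by lia. field. lra. }
  assert (SZ : sum_n_m (fun j : nat => (RtoC (sin (2 * PI * INR j * INR p / INR q)) * C_derive2 (zeta (INR j / INR q)%R) (RtoC 0))%C) 1 q = RtoC h2).
  { rewrite sum_n_m_1_C. unfold RtoC. f_equal.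
    - transitivity (rsum (fun j => c (S j) * Re (Z (S j))) q).
      + apply rsum_ext. intros j _. exact (Re_RtoC_mult _ (Z (S j))).
      + unfold c. rewrite (rsum_sine_coef_antisym p q (fun j => Re (Z j))) by lia.
        rewrite <- rsum_scal. apply rsum_ext. intros j _. unfold c. field.
    (* The second derivatives are not shown to be real one by one; equality of the imaginary parts
       at [j] and [q - j] is enough, by antisymmetry of the coefficients. *)
    - transitivity (rsum (fun j => c (S j) * Im (Z (S j))) q).
      + apply rsum_ext. intros j _. exact (Im_RtoC_mult _ (Z (S j))).
      + unfold c. rewrite (rsum_sine_coef_antisym p q (fun j => Im (Z j))) by lia.
        rewrite (rsum_ext _ (fun _ => 0 * 0)), rsum_scal; [ring|].
        intros j Hj. rewrite (proj1 (HZ j Hj)). ring. }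
  assert (SG : sum_n_m (fun j : nat => sin (2 * PI * INR j * INR p / INR q) * ln (Gamma (INR j / INR q))) 1 q = h1 / 2).
  { rewrite sum_n_m_1_rsum. transitivity (rsum (fun j => c (S j) * ln (Gamma (INR (S j) / INR q))) q); [easy|].
    unfold c. rewrite (rsum_sine_coef_antisym p q (fun j => ln (Gamma (INR j / INR q)))) by lia.
    replace (h1 / 2) with (/ 2 * h1) by field. f_equal. apply rsum_ext. intros j Hj. now rewrite Eu. }
  rewrite SZ, SG, <- RtoC_mult, <- RtoC_minus, <- RtoC_plus. f_equal.
  fold L. set (ct := cot (PI * INR p / INR q)) in *.
  (* The contribution [f0 zeta(2) / 4] from the Cauchy kernel lowers the coefficient [zeta(2) / 2]
     of the cotangent to [zeta(2) / 4]; after doubling this is the [PI ^ 2 / 6] of the statement. *)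
  assert (Ef0 : f0 = PI * ct) by lra. rewrite Ef0 in Q2. unfold L. lra.
Qed.
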